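(* Let $A$ be a compactly generated locally compact abelian group, $M$ a sheer LC $A$-module and $N$ a closed submodule of $M$. Then $N$ is sheer if and only if $M/N$ is sheer.
   Context: An LC $A$-module is an LCA group with a continuous action of $A$ by topological automorphisms. Compact parafinite: compact, no nonzero finite quotient module; purely discrete: discrete, no nonzero finite submodule; $\mathrm{W}^\flat(M)$ = sum of compact parafinite submodules; $\Omega^\sharp(M)$ = intersection of open submodules $U$ with $M/U$ purely discrete; $M$ is sheer if $\mathrm{W}^\flat(M)=0$ and $\Omega^\sharp(M)=M$. *)

(* Defs.v *)
From HB Require Import structures.
From mathcomp Require Import all_boot all_order all_algebra.
From mathcomp Require Import all_classical all_reals all_analysis.
Set Implicit Arguments. Unset Strict Implicit. Unset Printing Implicit Defensive.
Import Order.TTheory GRing.Theory Num.Theory.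
Local Open Scope classical_set_scope.
Local Open Scope ring_scope.

Definition LCA (T : topologicalZmodType) : Prop :=
  hausdorff_space T /\ forall x : T, exists2 K : set T, nbhs x K & compact K.

Definition is_subgroup (T : zmodType) (G : set T) : Prop :=
  G 0 /\ forall x y, G x -> G y -> G (x - y).

Definition compactly_generated (T : topologicalZmodType) : Prop :=
  exists K : set T, compact K /\
    forall G : set T, is_subgroup G -> K `<=` G -> G = setT.

Section Modules.
Variables (A M : topologicalZmodType) (act : A -> M -> M).

Definition LC_module : Prop :=
  LCA M /\
  (forall a x y, act a (x + y) = act a x + act a y) /\
  (forall x, act 0 x = x) /\
  (forall a b x, act (a + b) x = act a (act b x)) /\
  continuous (fun p : A * M => act p.1 p.2).

Definition submodule_in (S L : set M) : Prop :=
  L `<=` S /\ is_subgroup L /\ forall a x, L x -> L (act a x).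

Definition rel_open (S U : set M) : Prop :=
  exists W : set M, open W /\ U = S `&` W.
Definition rel_closed (S U : set M) : Prop :=
  exists C : set M, closed C /\ U = S `&` C.

Definition finite_index (S L : set M) : Prop :=
  exists F : set M, finite_set F /\
    S `<=` [set x | exists f l, F f /\ L l /\ x = f + l].

(* compact parafinite submodule of S: compact, and no nonzero finite quotient
   module (quotients by closed submodules) *)
Definition compact_parafinite (S K : set M) : Prop :=
  submodule_in S K /\ compact K /\
  forall L, submodule_in K L -> rel_closed K L -> finite_index K L -> L = K.

(* S/U (discrete) is purely discrete: no nonzero finite submodule *)
Definition purely_discrete_quot (S U : set M) : Prop :=
  forall F, submodule_in S F -> U `<=` F -> finite_index F U -> F = U.

Definition Wflat (S : set M) : set M :=
  [set x | exists s : seq M,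
     (forall y, y \in s -> exists K, compact_parafinite S K /\ K y) /\
     x = \sum_(y <- s) y].

Definition Omegasharp (S : set M) : set M :=
  [set x | S x /\ forall U, submodule_in S U -> rel_open S U ->
                   purely_discrete_quot S U -> U x].

(* the module S (a closed submodule of M, with the subspace topology) is sheer *)
Definition sheer (S : set M) : Prop :=
  Wflat S = [set 0] /\ Omegasharp S = S.

End Modules.

(* Main.v *)
Require Import Defs.
From HB Require Import structures.
From mathcomp Require Import all_boot all_order all_algebra.
From mathcomp Require Import all_classical all_reals all_analysis.
From mathcomp Require Import zify.
Set Implicit Arguments. Unset Strict Implicit. Unset Printing Implicit Defensive.
Import Order.TTheory GRing.Theory Num.Theory.
Local Open Scope classical_set_scope.
Local Open Scope ring_scope.

(** W-flat passes to submodules and Omega-sharp to quotients, so two implications are at stake.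

    If [N] is sheer and [K] is a compact parafinite submodule of [M/N] with preimage [P],
    one produces a compact submodule [Y] with [Y + N = P]; a minimal such [Y] is parafinite,
    hence zero, and [K = 0]. If [M/N] is sheer and [U] is an open submodule of [N] with
    [N/U] purely discrete, one produces dually an open submodule [Y] of [M] with
    [Y & N = U]; a maximal such [Y] has purely discrete quotient, hence [Y = M] and [U = N].

    Both existence statements are proved by Zorn's lemma: as [A] is compactly generated, a
    counterexample can be chosen with [N] replaced by a minimal quotient (resp. [M/N] by a
    minimal submodule) that has no compact submodule (resp. no open submodule). If that
    module has a compact open subgroup, some [a] in [A] contracts a nonzero piece of it (resp.
    expands a proper open subgroup to everything), and iterating [a] produces [Y]. If not,
    multiplication by 2 plays the role of [a], on the subgroup of elements that admit a chain
    of successive halves tending to 0 (resp. modulo the elements with bounded orbit under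
    doubling). Instead of the structure theorem for locally compact abelian groups this uses
    a coarse integer-valued norm, obtained from a cocompact lattice. *)

(** * Deciding equalities in abelian groups *)

(** Zorn's lemma applies only if a complement relative to the limit of a chain already yields one
    relative to a member of the chain. This is where compact generation of [A] enters: stability
    under [A] is stability under one compact set [S]. A compact set that is closed under addition
    and under [S] modulo the closed union of a chain becomes so, after fattening by a compact
    neighbourhood of 0, modulo a single member; dually, a small neighbourhood behaves well over a
    single member of a decreasing chain.

    Sheerness is used sparingly: it excludes that the minimal quotient of [N] is discrete and
    nonzero, and that the minimal submodule of [M/N] is compact and nonzero.

    The two halves are Pontryagin dual, but duality is never invoked. Each argument therefore occurs
    twice, with compact and open, intersections and unions exchanged. In the case without a compact
    open subgroup only the behaviour of doubling up to bounded error matters, which is why an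
    integer-valued norm suffices. *)

Inductive zexpr := ZVar of nat | Zadd of zexpr & zexpr | Zopp of zexpr | Zzero
  | Zmuln of zexpr & nat.

Fixpoint zeval (G : zmodType) (env : seq G) (e : zexpr) : G :=
  match e with
  | ZVar i => nth 0 env i
  | Zadd a b => zeval env a + zeval env b
  | Zopp a => - zeval env a
  | Zzero => 0
  | Zmuln a n => zeval env a *+ n
  end.

Fixpoint zcoef (e : zexpr) (i : nat) : int :=
  match e with
  | ZVar j => if (i == j)%N then 1 else 0
  | Zadd a b => zcoef a i + zcoef b i
  | Zopp a => - zcoef a i
  | Zzero => 0
  | Zmuln a n => zcoef a i *+ n
  end.

Lemma zevalE (G : zmodType) (env : seq G) e :
  zeval env e = \sum_(i < size env) env`_i *~ zcoef e i.
Proof.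
elim: e => [j|a iha b ihb|a iha||a iha n] /=.
- have [js|sj] := ltnP j (size env).
    rewrite (bigD1 (Ordinal js)) //= eqxx mulr1z big1 ?addr0 // => i.
    by rewrite -val_eqE /= => /negbTE ->; rewrite mulr0z.
  rewrite nth_default // big1 // => i _; rewrite (_ : (_ == _) = false) ?mulr0z //.
  by apply/negbTE; rewrite neq_ltn (leq_trans (ltn_ord i) sj).
- by rewrite iha ihb -big_split /=; apply: eq_bigr => i _; rewrite mulrzDr.
- by rewrite iha -sumrN; apply: eq_bigr => i _; rewrite mulrNz.
- by rewrite big1 // => i _; rewrite mulr0z.
- rewrite iha -sumrMnl; apply: eq_bigr => i _.
  by elim: n => [|n ih]; rewrite ?mulr0n ?mulr0z // !mulrS mulrzDr ih.
Qed.

(** The hypothesis is a closed boolean, so [zmod] discharges it by computation. Indices beyond the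
    environment need no comparison, as their variables evaluate to 0. *)
Lemma zeval_eq (G : zmodType) (env : seq G) e f :
  all (fun i => zcoef e i == zcoef f i) (iota 0 (size env)) ->
  zeval env e = zeval env f.
Proof.
move=> /allP h; rewrite !zevalE; apply: eq_bigr => i _; congr (_ *~ _).
by apply/eqP/h; rewrite mem_iota /=.
Qed.

Ltac zmod_mem x l :=
  match l with
  | nil => constr:(false)
  | cons ?y ?l' => match y with x => constr:(true) | _ => zmod_mem x l' end
  end.
Ltac zmod_idx x l :=
  match l with
  | cons ?y ?l' =>
    match y with x => constr:(0%N) | _ => let n := zmod_idx x l' in constr:(S n) end
  end.
Ltac zmod_vars G l t :=
  lazymatch t with
  | GRing.add ?a ?b => let l' := zmod_vars G l a in zmod_vars G l' b
  | GRing.opp ?a => zmod_vars G l a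
  | GRing.natmul ?a _ => zmod_vars G l a
  | GRing.zero => l
  | _ => let b := zmod_mem t l in
         lazymatch b with true => l | false => constr:(@cons G t l) end
  end.
Ltac zmod_reify l t :=
  lazymatch t with
  | GRing.add ?a ?b =>
    let a' := zmod_reify l a in let b' := zmod_reify l b in constr:(Zadd a' b')
  | GRing.opp ?a => let a' := zmod_reify l a in constr:(Zopp a')
  | GRing.natmul ?a ?n => let a' := zmod_reify l a in constr:(Zmuln a' n)
  | GRing.zero => constr:(Zzero)
  | _ => let n := zmod_idx t l in constr:(ZVar n)
  end.
(* Proves equalities that hold in every abelian group; exponents of [*+] must be literals. *)
Ltac zmod :=
  lazymatch goal with
  | |- @eq ?G ?a ?b =>
    let l := zmod_vars G (@nil G) a in
    let l := zmod_vars G l b in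
    let e := zmod_reify l a in
    let f := zmod_reify l b in
    exact: (@zeval_eq _ l e f isT)
  end.

Lemma subgroupN (G : zmodType) (N : set G) x : is_subgroup N -> N x -> N (- x).
Proof. by case=> N0 NB Nx; rewrite -sub0r; exact: NB. Qed.

Lemma subgroupD (G : zmodType) (N : set G) x y :
  is_subgroup N -> N x -> N y -> N (x + y).
Proof.
by move=> sN Nx Ny; rewrite -[y]opprK; apply: sN.2 => //; exact: subgroupN.
Qed.

Lemma subgroupMn (G : zmodType) (N : set G) x n : is_subgroup N -> N x -> N (x *+ n).
Proof.
move=> sN Nx; elim: n => [|n ih]; first by rewrite mulr0n; exact: sN.1.
by rewrite mulrS; exact: subgroupD.
Qed.

Lemma subgroupMz (G : zmodType) (N : set G) x (n : int) :
  is_subgroup N -> N x -> N (x *~ n).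
Proof.
move=> sN Nx; case: n => n; rewrite ?NegzE ?mulrNz -pmulrn.
  exact: subgroupMn.
by apply: subgroupN => //; exact: subgroupMn.
Qed.

Lemma subgroup_sum (G : zmodType) (N : set G) (I : Type) (r : seq I) (F : I -> G) :
  is_subgroup N -> (forall i, N (F i)) -> N (\sum_(i <- r) F i).
Proof.
move=> sN NF; elim/big_ind : _ => //; first exact: sN.1.
by move=> x y; exact: subgroupD.
Qed.

(** The set A + B with a single witness: for a subgroup [B] the condition says that [x] is congruent
    to [a] modulo [B], which is how it is mostly used. *)
Definition sums (G : zmodType) (A B : set G) : set G :=
  [set x | exists2 a, A a & B (x - a)].

Lemma sumsP (G : zmodType) (A B : set G) a b : A a -> B b -> sums A B (a + b).
Proof. by move=> Aa Bb; exists a => //; rewrite addrC addKr. Qed.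

Lemma subgroup_sums (G : zmodType) (A B : set G) :
  is_subgroup A -> is_subgroup B -> is_subgroup (sums A B).
Proof.
move=> sA sB; split; first by exists 0; [exact: sA.1|rewrite subr0; exact: sB.1].
move=> x y [a Aa Ba] [b Ab Bb]; exists (a - b); first exact: sA.2.
have -> : x - y - (a - b) = (x - a) - (y - b) by zmod.
exact: sB.2.
Qed.

(** * Compactness in terms of directed families *)

Section Compactness.
Variable X : topologicalType.

(** Directedness lets one member absorb a finite subcover. If no [G i] contained [K], the sets K \ G
    i would generate a proper filter with a cluster point in [K], and there some [G i] is a
    neighbourhood. *)
Lemma compact_directed_cover (K : set X) (I : Type) (D : set I) (G : I -> set X) :
  compact K -> (exists i, D i) ->
  (forall i j, D i -> D j -> exists k, [/\ D k, G i `<=` G k & G j `<=` G k]) ->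
  (forall x, K x -> exists2 i, D i & nbhs x (G i)) ->
  exists2 i, D i & K `<=` G i.
Proof.
move=> cK [i0 Di0] dir cov; apply: contrapT => nK.
pose F := filter_from D (fun i => K `\` G i).
have FF : ProperFilter F.
  apply: filter_from_proper.
    apply: filter_from_filter; first by exists i0.
    move=> i j Di Dj; have [k [Dk ik jk]] := dir i j Di Dj; exists k => //.
    by move=> x [Kx nGx]; split; split=> // g; apply: nGx; [exact: ik|exact: jk].
  move=> i Di; apply: contrapT => h; apply: nK; exists i => // x Kx.
  by apply: contrapT => nG; apply: h; exists x.
have FK : F K by exists i0 => // x [].
have [x [Kx clx]] := cK F FF FK.
have [i Di nG] := cov x Kx.
have [|y [[_ nGy] Gy]] := clx (K `\` G i) (G i) _ nG; first by exists i.
exact: nGy.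
Qed.

(** Apply the covering lemma to the union of [O] and the complement of [C i]. *)
Lemma compact_directed_cap_sub (K : set X) (I : Type) (D : set I) (C : I -> set X)
    (O : set X) :
  compact K -> (exists i, D i) ->
  (forall i j, D i -> D j -> exists k, [/\ D k, C k `<=` C i & C k `<=` C j]) ->
  (forall i, D i -> closed (C i)) ->
  (forall x, K x -> (forall i, D i -> C i x) -> nbhs x O) ->
  exists2 i, D i & K `&` C i `<=` O.
Proof.
move=> cK D0 dir clC h.
have [| |i Di Ki] := @compact_directed_cover K I D (fun i => O `|` ~` C i) cK D0.
- move=> i j Di Dj; have [k [Dk ki kj]] := dir i j Di Dj.
  by exists k; split=> //; apply: setUS; apply: subsetC.
- move=> x Kx; have [hx|] := pselect (forall i, D i -> C i x).
    have [i Di] := D0; exists i => //; apply: filterS (h x Kx hx).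
    exact: subsetUl.
  move=> /existsNP[i /not_implyP[Di nC]]; exists i => //.
  apply: (@filterS _ _ _ (~` C i)); first exact: subsetUr.
  by apply: open_nbhs_nbhs; split=> //; apply: closed_openC; exact: clC.
- by exists i => // x [/Ki[|]].
Qed.

Lemma compact_directed_cap (K : set X) (I : Type) (D : set I) (C : I -> set X) :
  compact K -> (exists i, D i) ->
  (forall i j, D i -> D j -> exists k, [/\ D k, C k `<=` C i & C k `<=` C j]) ->
  (forall i, D i -> closed (C i)) ->
  (forall i, D i -> exists2 x, K x & C i x) ->
  exists2 x, K x & forall i, D i -> C i x.
Proof.
move=> cK D0 dir clC h; apply: contrapT => nx.
have [|i Di KC] := @compact_directed_cap_sub K I D C set0 cK D0 dir clC.
  by move=> x Kx hx; exfalso; apply: nx; exists x.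
by have [x Kx Cx] := h i Di; exact: (KC x).
Qed.

(** The neighbourhoods of [y0] serve as the index set of a directed cover of [K]; the predicate [P]
    makes this a uniformity principle. *)
Lemma compact_tube (Y : topologicalType) (K : set X) (y0 : Y) (P : X -> Y -> Prop) :
  compact K ->
  (forall x, K x -> exists U W, [/\ nbhs x U, nbhs y0 W &
     forall x' y, U x' -> W y -> P x' y]) ->
  exists2 W, nbhs y0 W & forall x y, K x -> W y -> P x y.
Proof.
move=> cK h.
have [| | |W nW KW] := @compact_directed_cover K (set Y) (nbhs y0)
   (fun W => [set x | forall y, W y -> P x y]) cK.
- by exists setT; exact: filterT.
- move=> V W nV nW; exists (V `&` W); split; first exact: filterI.
    by move=> x hx y [Vy _]; exact: hx.
  by move=> x hx y [_ Wy]; exact: hx.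
- move=> x Kx; have [U [W [nU nW hP]]] := h x Kx; exists W => //.
  by apply: filterS nU => x' Ux' y; exact: hP.
- by exists W => // x y /KW; exact.
Qed.

End Compactness.

(** * Topological abelian groups, locally compact groups and modules *)

Section TopGroup.
Variable T : topologicalZmodType.
Implicit Types (x y : T) (K V W G H : set T).

Lemma continuous_addr x : continuous (fun y : T => x + y).
Proof.
move=> y; apply: (@continuous_comp _ _ _ (fun y => (x, y)) (fun z : T * T => z.1 + z.2)).
  by apply: cvg_pair => /=; [exact: cvg_cst|exact: cvg_id].
exact: add_continuous.
Qed.

Lemma nbhs_shift x y W : nbhs (x + y) W -> nbhs y [set z | W (x + z)].
Proof. by move=> nW; exact: (continuous_addr nW). Qed.

Lemma nbhs_at0P x W : nbhs x W <-> nbhs 0 [set z | W (x + z)].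
Proof.
split=> [nW|]; first by apply: nbhs_shift; rewrite addr0.
move=> nW; have := @nbhs_shift (- x) x [set z | W (x + z)].
by rewrite addNr => /(_ nW); apply: filterS => z /=; rewrite addrA subrr add0r.
Qed.

Lemma nbhs0_opp W : nbhs 0 W -> nbhs 0 [set x | W (- x)].
Proof. by move=> nW; apply: (@opp_continuous T 0); rewrite oppr0. Qed.

Lemma nbhs0D W : nbhs 0 W -> exists V, [/\ nbhs 0 V, (forall x, V x -> V (- x)) &
  forall x y, V x -> V y -> W (x + y)].
Proof.
move=> nW; have := @add_continuous T (0, 0); rewrite /continuous_at /= addr0.
move=> /(_ W nW) [[V1 V2] /= [n1 n2] h].
pose V := V1 `&` V2; have nV : nbhs 0 V by exact: filterI.
exists (V `&` [set x | V (- x)]); split.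
- by apply: filterI => //; exact: nbhs0_opp.
- by move=> x [Vx Vnx]; split=> //=; rewrite opprK.
- by move=> x y [[V1x _] _] [[_ V2y] _]; exact: (h (x, y)).
Qed.

Lemma nbhs0D3 W : nbhs 0 W -> exists V, [/\ nbhs 0 V, (forall x, V x -> V (- x)) &
  forall x y z, V x -> V y -> V z -> W (x + y + z)].
Proof.
move=> /nbhs0D[V1 [n1 s1 h1]]; have [V2 [n2 s2 h2]] := nbhs0D n1.
exists V2; split=> // x y z Vx Vy Vz; apply: h1; first exact: h2.
by rewrite -[z]addr0; apply: h2 => //; exact: nbhs_singleton.
Qed.

Lemma closureP (E : set T) x :
  closure E x <-> forall W, nbhs 0 W -> exists2 e, E e & W (x - e).
Proof.
split=> [cl W nW|h U nU].
  have [|e [Ee We]] := cl [set z | W (x - z)]; last by exists e.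
  apply/nbhs_at0P; have := nbhs0_opp nW; apply: filterS => z /=.
  by rewrite opprD addrA subrr add0r.
move/nbhs_at0P: nU => /nbhs0_opp /h[e Ee /=]; rewrite opprB addrC subrK => Ue.
by exists e.
Qed.

Lemma closure_add (E F H : set T) x y : (forall a b, E a -> F b -> H (a + b)) ->
  closure E x -> closure F y -> closure H (x + y).
Proof.
move=> h /closureP cx /closureP cy; apply/closureP => W nW.
have [V [nV _ hV]] := nbhs0D nW.
have [a Ea Va] := cx V nV; have [b Fb Vb] := cy V nV.
exists (a + b); first exact: h.
by rewrite opprD addrACA; exact: hV.
Qed.

Lemma closure_cont (U : topologicalType) (f : T -> U) (E : set T) (F : set U) x :
  {for x, continuous f} -> (forall a, E a -> F (f a)) -> closure E x -> closure F (f x).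
Proof.
move=> cf h cx V /cf nV; have [e [Ee Ve]] := cx _ nV.
by exists (f e); split=> //; exact: h.
Qed.

Lemma subgroup_closure G : is_subgroup G -> is_subgroup (closure G).
Proof.
move=> sG; split; first by apply: subset_closure; exact: sG.1.
move=> x y cx cy; apply: (@closure_add G G G) => //.
  by move=> a b; exact: subgroupD.
by apply: (closure_cont (@opp_continuous T y)) cy => a; exact: subgroupN.
Qed.

Lemma compact_sums K V : compact K -> compact V -> compact (sums K V).
Proof.
move=> cK cV.
have -> : sums K V = (fun x : T * T => x.1 + x.2) @` (K `*` V).
  apply/seteqP; split=> x /=.
    by move=> [a Ka Vx]; exists (a, x - a) => //=; rewrite addrC subrK.
  by move=> [[a b] /= [Ka Vb] <-]; exact: sumsP.
apply: continuous_compact; last exact: compact_setX.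
by apply: continuous_subspaceT => x; exact: add_continuous.
Qed.

Lemma compact_image (U : topologicalType) (f : T -> U) K :
  continuous f -> compact K -> compact (f @` K).
Proof. by move=> cf; apply: continuous_compact; exact: continuous_subspaceT. Qed.

Lemma compact_opp K : compact K -> compact [set x | K (- x)].
Proof.
move=> cK; have -> : [set x | K (- x)] = (-%R @` K).
  apply/seteqP; split=> x /=; last by move=> [y Ky <-]; rewrite opprK.
  by exists (- x) => //; rewrite opprK.
exact: compact_image (@opp_continuous T) cK.
Qed.

Lemma closed_sums K H : compact K -> closed H -> closed (sums K H).
Proof.
move=> cK clH x clx; apply: contrapT => nx.
have := @compact_tube _ T K x (fun a y => ~ H (y - a)) cK.
case=> [a Ka|W nW hW].
  have nH : nbhs (x - a) (~` H).
    apply: open_nbhs_nbhs; split; first exact: closed_openC.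
    by move=> Hxa; apply: nx; exists a.
  have := @sub_continuous T (x, a) _ nH; case=> -[W U] /= [nW nU] h.
  by exists U, W; split=> // a' y Ua Wy; exact: (h (y, a')).
have [y [[a Ka Hy] Wy]] := clx W nW.
exact: (hW a y).
Qed.

(** A closure point [x] of [G] lies in [N] and differs from some [g] in [G] by an element of N and
    W, hence of [G]. *)
Lemma closed_relopen_subgroup N G W : is_subgroup G -> is_subgroup N -> closed N ->
  G `<=` N -> nbhs 0 W -> (forall x, N x -> W x -> G x) -> closed G.
Proof.
move=> sG sN cN GN nW h x clx.
have Nx : N x by apply: cN; exact: closureS clx.
move/closureP: clx => /(_ W nW)[g Gg Wg].
rewrite -(subrK g x); apply: subgroupD => //; apply: h => //.
by apply: sN.2 => //; exact: GN.
Qed.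

End TopGroup.

Lemma hausdorff_topgroup (T : topologicalZmodType) :
  closed [set 0 : T] -> hausdorff_space T.
Proof.
move=> cl0 x y cl; apply/eqP; rewrite -subr_eq0; apply/eqP.
apply: cl0; apply/closureP => W nW; exists 0 => //; rewrite subr0.
have [V [nV sV hV]] := nbhs0D nW.
have nb (z : T) : nbhs z [set u | V (u - z)].
  by apply/nbhs_at0P; apply: filterS nV => u /=; rewrite addrC addKr.
have [u [/= Vx Vy]] := cl _ _ (nb x) (nb y).
have -> : x - y = - (u - x) + (u - y) by zmod.
by apply: hV => //; exact: sV.
Qed.

Section LCgroup.
Variables (T : topologicalZmodType) (lT : LCA T).

Lemma LC_closed1 : closed [set 0 : T].
Proof. by apply: compact_closed; [exact: lT.1|exact: compact_set1]. Qed.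

Lemma LC_compact_closed (K : set T) : compact K -> closed K.
Proof. by apply: compact_closed; exact: lT.1. Qed.

Lemma LC_compact_nbhs (K0 : set T) : compact K0 ->
  exists W : set T, [/\ compact W, nbhs 0 W, (forall x, W x -> W (- x)) & K0 `<=` W].
Proof.
move=> cK0; have [K nK cK] := lT.2 0.
pose V := K `|` K0; exists (V `|` [set x | V (- x)]).
have cV : compact V by exact: compactU.
split.
- by apply: compactU => //; exact: compact_opp.
- by apply: filterS nK => x Kx; left; left.
- by move=> x [Vx|Vx]; [right; rewrite /= opprK|left].
- by move=> x Kx; left; right.
Qed.

Lemma LC_compact_nbhs_in (W : set T) : nbhs 0 W ->
  exists V : set T, [/\ compact V, nbhs 0 V, (forall x, V x -> V (- x)) & V `<=` W].
Proof.
move=> nW; have [K nK cK] := lT.2 0.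
have [V [nV sV hV]] := nbhs0D nW.
have cVW x : closure V x -> W x.
  move=> /closureP /(_ V nV)[e Ve Vxe].
  by rewrite -(subrK e x); exact: hV.
pose C := closure V `&` K; have cC : compact C.
  by rewrite /C setIC; apply: compact_closedI => //; exact: closed_closure.
exists (C `&` [set x | C (- x)]); split.
- apply: compact_closedI => //; apply: LC_compact_closed.
  exact: compact_opp.
- have nC : nbhs 0 C by apply: filterI => //; apply: filterS nV; exact: subset_closure.
  by apply: filterI => //; exact: nbhs0_opp.
- by move=> x [Cx Cnx]; split=> //=; rewrite opprK.
- by move=> x [[/cVW]].
Qed.

Lemma compact_subset_closure (E K : set T) : compact K -> E `<=` K -> compact (closure E).
Proof.
move=> cK EK; apply: (subclosed_compact _ cK); first exact: closed_closure.
by have /closure_id -> : closed K by [exact: LC_compact_closed]; exact: closureS.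
Qed.

End LCgroup.

Section Module.
Variables (A M : topologicalZmodType) (act : A -> M -> M).

Definition submod (L : set M) : Prop :=
  is_subgroup L /\ forall a x, L x -> L (act a x).

Hypothesis lM : LC_module act.

Lemma actD a x y : act a (x + y) = act a x + act a y.
Proof. by case: lM => _ []. Qed.
Lemma act0 x : act 0 x = x.
Proof. by case: lM => _ [_ []]. Qed.
Lemma actA a b x : act (a + b) x = act a (act b x).
Proof. by case: lM => _ [_ [_ []]]. Qed.
Lemma act_cont : continuous (fun p : A * M => act p.1 p.2).
Proof. by case: lM => _ [_ [_ []]]. Qed.
Lemma actr0 a : act a 0 = 0.
Proof. by apply: (addrI (act a 0)); rewrite -actD !addr0. Qed.
Lemma actN a x : act a (- x) = - act a x.
Proof. by apply/eqP; rewrite -addr_eq0 -actD addNr actr0. Qed.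
Lemma actB a x y : act a (x - y) = act a x - act a y.
Proof. by rewrite actD actN. Qed.
Lemma actMn a x n : act a (x *+ n) = act a x *+ n.
Proof. by elim: n => [|n ih]; rewrite ?mulr0n ?actr0 // !mulrS actD ih. Qed.
Lemma actK a x : act (- a) (act a x) = x.
Proof. by rewrite -actA addNr act0. Qed.
Lemma actVK a x : act a (act (- a) x) = x.
Proof. by rewrite -actA subrr act0. Qed.
Lemma actC a b x : act a (act b x) = act b (act a x).
Proof. by rewrite -!actA addrC. Qed.

Lemma act_continuous a : continuous (act a).
Proof.
move=> x; apply: (@continuous_comp _ _ _ (fun y => (a, y)) (fun p : A * M => act p.1 p.2)).
  by apply: cvg_pair => /=; [exact: cvg_cst|exact: cvg_id].
exact: act_cont.
Qed.

Lemma nbhs0_act a W : nbhs 0 W -> nbhs 0 [set x | W (act a x)].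
Proof. by move=> nW; apply: (@act_continuous a 0); rewrite actr0. Qed.

Lemma compact_act_image (S : set A) (V : set M) : compact S -> compact V ->
  compact [set x | exists a v, [/\ S a, V v & x = act a v]].
Proof.
move=> cS cV.
have -> : [set x | exists a v, [/\ S a, V v & x = act a v]] =
   (fun p : A * M => act p.1 p.2) @` (S `*` V).
  apply/seteqP; split=> x /=; first by move=> [a [v [Sa Vv ->]]]; exists (a, v).
  by move=> [[a v] /= [Sa Vv] <-]; exists a, v.
apply: continuous_compact; last exact: compact_setX.
by apply: continuous_subspaceT => x; exact: act_cont.
Qed.

Lemma compact_act_nbhs (S : set A) (W : set M) : compact S -> nbhs 0 W ->
  exists2 V, nbhs 0 V & forall a x, S a -> V x -> W (act a x).
Proof.
move=> cS nW; apply: (compact_tube cS) => a Sa.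
have := @act_cont (a, 0) W; rewrite /= actr0 => /(_ nW)[[U V] /= [nU nV] h].
by exists U, V; split=> // a' x Ua Vx; exact: (h (a', x)).
Qed.

Lemma compact_act_pre (a : A) (K : set M) : compact K -> compact [set x | K (act a x)].
Proof.
move=> cK; have -> : [set x | K (act a x)] = act (- a) @` K.
  apply/seteqP; split=> x /=; last by move=> [y Ky <-]; rewrite actVK.
  by move=> Kx; exists (act a x) => //; rewrite actK.
exact: compact_image (@act_continuous _) cK.
Qed.

Lemma closed_act_pre (a : A) (C : set M) : closed C -> closed [set x | C (act a x)].
Proof. by move=> cC; apply: preimage_closed => // x _; exact: act_continuous. Qed.

Lemma subgroup_act_pre a L : is_subgroup L -> is_subgroup [set x | L (act a x)].
Proof.
move=> sL; split; first by rewrite /= actr0; exact: sL.1.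
by move=> x y /= Lx Ly; rewrite actB; exact: sL.2.
Qed.

Lemma submod_closure L : submod L -> submod (closure L).
Proof.
case=> sL aL; split; first exact: subgroup_closure.
by move=> a x; apply: closure_cont; [exact: act_continuous|exact: aL].
Qed.

Lemma submod_setI L L' : submod L -> submod L' -> submod (L `&` L').
Proof.
move=> [sL aL] [sL' aL']; split; last by move=> a x [? ?]; split; [exact: aL|exact: aL'].
split; first by split; [exact: sL.1|exact: sL'.1].
by move=> x y [? ?] [? ?]; split; [exact: sL.2|exact: sL'.2].
Qed.

(** The elements that preserve [L] together with their opposites form a subgroup of [A], so it is
    enough that it contains a compact generating set. *)
Lemma compactly_generated_act : compactly_generated A ->
  exists S : set A, [/\ compact S, (forall s, S s -> S (- s)) &
    forall L : set M, (forall s x, S s -> L x -> L (act s x)) ->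
      forall a x, L x -> L (act a x)].
Proof.
move=> [K [cK genK]]; pose S := K `|` [set a | K (- a)]; exists S.
have cS : compact S by apply: compactU => //; exact: compact_opp.
have sS s : S s -> S (- s) by move=> [Ks|Ks]; [right; rewrite /= opprK|left].
split=> // L hL a x Lx.
pose G := [set a | (forall x, L x -> L (act a x)) /\ (forall x, L x -> L (act (- a) x))].
suff GT : G = setT by have : G a by [rewrite GT]; case=> + _; exact.
apply: genK.
  split; first by split=> y Ly; rewrite ?oppr0 act0.
  move=> b c [b1 b2] [c1 c2]; split=> y Ly; rewrite ?opprB actA; first exact/b1/c2.
  exact/c1/b2.
move=> s Ks; have Ss : S s by left.
by split=> y Ly; apply: hL => //; exact: sS.
Qed.

End Module.

(** Characterises [Q] as M/N without fixing a construction, so that the quotient given in the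
    theorem and the auxiliary quotients built from cosets are treated alike. *)
Definition quotient_map (A M Q : topologicalZmodType) (actM : A -> M -> M)
    (actQ : A -> Q -> Q) (N : set M) (p : M -> Q) : Prop :=
  [/\ forall x y, p (x + y) = p x + p y,
      forall a x, p (actM a x) = actQ a (p x),
      continuous p /\ (forall V : set M, open V -> open (p @` V)),
      forall q : Q, exists x, p x = q &
      p @^-1` [set 0] = N].

Section QuotientMap.
Variables (A M Q : topologicalZmodType) (actM : A -> M -> M) (actQ : A -> Q -> Q).
Variables (N : set M) (p : M -> Q).
Hypothesis qp : quotient_map actM actQ N p.

Lemma qmapD x y : p (x + y) = p x + p y.
Proof. by case: qp. Qed.
Lemma qmap0 : p 0 = 0.
Proof. by apply: (addrI (p 0)); rewrite -qmapD !addr0. Qed.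
Lemma qmapN x : p (- x) = - p x.
Proof. by apply/eqP; rewrite -addr_eq0 -qmapD addNr qmap0. Qed.
Lemma qmapB x y : p (x - y) = p x - p y.
Proof. by rewrite qmapD qmapN. Qed.
Lemma qmapMn x n : p (x *+ n) = p x *+ n.
Proof. by elim: n => [|n ih]; rewrite ?mulr0n ?qmap0 // !mulrS qmapD ih. Qed.
Lemma qmap_act a x : p (actM a x) = actQ a (p x).
Proof. by case: qp. Qed.
Lemma qmap_cont : continuous p.
Proof. by case: qp => _ _ []. Qed.
Lemma qmap_surj q : exists x, p x = q.
Proof. by case: qp. Qed.
Lemma qmap_ker x : p x = 0 <-> N x.
Proof. by case: qp => _ _ _ _ <-. Qed.
Lemma qmap_eq x y : p x = p y <-> N (x - y).
Proof.
rewrite -qmap_ker qmapB; split=> [->|/eqP]; first by rewrite subrr.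
by rewrite subr_eq0 => /eqP.
Qed.

Lemma qmap_nbhs x W : nbhs x W -> nbhs (p x) (p @` W).
Proof.
rewrite nbhsE => -[V [oV Vx] VW]; apply: (@filterS _ _ _ (p @` V)).
  exact: image_subset.
by apply: open_nbhs_nbhs; split; [case: qp => _ _ [_ h] _ _; exact: h|exists x].
Qed.

Lemma qmap_nbhs0 W : nbhs 0 W -> nbhs 0 (p @` W).
Proof. by rewrite -[X in nbhs X (p @` W)]qmap0; exact: qmap_nbhs. Qed.

Lemma qmap_nbhs0_pre W : nbhs 0 W -> nbhs 0 [set x | W (p x)].
Proof. by move=> nW; apply: (@qmap_cont 0); rewrite qmap0. Qed.

(** For a set saturated under [N], the complement of the image is the image of the complement, and
    [p] is open. *)
Lemma qmap_closed_image (E : set M) : closed E ->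
  (forall x n, E x -> N n -> E (x + n)) -> closed (p @` E).
Proof.
move=> cE hE; rewrite -openC.
have -> : ~` (p @` E) = p @` (~` E).
  apply/seteqP; split=> q; have [x <-] := qmap_surj q.
    by move=> nE; exists x => // Ex; apply: nE; exists x.
  move=> [y nEy] yx [z Ez] zx; apply: nEy.
  have /qmap_eq Nyz : p y = p z by rewrite zx.
  by rewrite -(subrK z y) addrC; exact: hE.
by case: qp => _ _ [_ h] _ _; apply: h; exact: closed_openC.
Qed.

Lemma qmap_closed_pre (E : set Q) : closed E -> closed (p @^-1` E).
Proof. by move=> cE; apply: preimage_closed => // x _; exact: qmap_cont. Qed.

Lemma qmap_subgroup_image (L : set M) : is_subgroup L -> is_subgroup (p @` L).
Proof.
move=> sL; split; first by exists 0; [exact: sL.1|exact: qmap0].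
by move=> _ _ [x Lx <-] [y Ly <-]; exists (x - y); [exact: sL.2|exact: qmapB].
Qed.

Lemma qmap_submod_image (L : set M) : submod actM L -> submod actQ (p @` L).
Proof.
move=> [sL aL]; split; first exact: qmap_subgroup_image.
by move=> a _ [x Lx <-]; exists (actM a x); [exact: aL|exact: qmap_act].
Qed.

Lemma qmap_subgroup_pre (L : set Q) : is_subgroup L -> is_subgroup (p @^-1` L).
Proof.
move=> sL; split; first by rewrite /= qmap0; exact: sL.1.
by move=> x y /= Lx Ly; rewrite qmapB; exact: sL.2.
Qed.

Lemma qmap_submod_pre (L : set Q) : submod actQ L -> submod actM (p @^-1` L).
Proof.
move=> [sL aL]; split; first exact: qmap_subgroup_pre.
by move=> a x /= Lx; rewrite qmap_act; exact: aL.
Qed.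

(** By local compactness of [M] the images of compact sets form a directed family of neighbourhoods
    covering [K]. *)
Lemma qmap_compact_lift (lM : LCA M) (K : set Q) : compact K ->
  exists2 V : set M, compact V & K `<=` p @` V.
Proof.
move=> cK.
have [| | |V cV KV] := @compact_directed_cover Q K (set M) compact (fun V => p @` V) cK.
- by exists set0; exact: compact0.
- move=> V W cV cW; exists (V `|` W); split; first exact: compactU.
    by apply: image_subset; exact: subsetUl.
  by apply: image_subset; exact: subsetUr.
- move=> q _; have [x <-] := qmap_surj q; have [V nV cV] := lM.2 x.
  by exists V => //; exact: qmap_nbhs.
- by exists V.
Qed.

End QuotientMap.

(** * Construction of the quotient module *)

Local Open Scope quotient_scope.
Section Coset.
Variables (M : topologicalZmodType) (N : set M) (sN : is_subgroup N).

Definition coset_rel (x y : M) : bool := `[< N (x - y) >].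

Lemma coset_rel_equiv : equiv_class_of coset_rel.
Proof.
case: (sN) => N0 NB; split.
- by move=> x; apply/asboolP; rewrite subrr.
- have h x y : coset_rel x y -> coset_rel y x.
    by move=> /asboolP h; apply/asboolP; rewrite -opprB; exact: subgroupN.
  by move=> x y; apply/idP/idP; exact: h.
- move=> y x z /asboolP h1 /asboolP h2; apply/asboolP.
  by rewrite -(subrK y x) -addrA; exact: subgroupD.
Qed.

Canonical coset_equiv := EquivRelPack coset_rel_equiv.

Definition coset_space : Type := quotient_topology {eq_quot coset_equiv}.
HB.instance Definition _ := Topological.on coset_space.
HB.instance Definition _ := Quotient.on coset_space.

Definition coset_pi (x : M) : coset_space := \pi_(coset_space) x.

Lemma coset_piP x y : coset_pi x = coset_pi y <-> N (x - y).
Proof.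
have e : (x == y %[mod {eq_quot coset_equiv}]) = coset_rel x y by exact: eqmodE.
split=> [h|h].
  by apply/asboolP; rewrite -[asbool _]e; apply/eqP.
suff : x = y %[mod {eq_quot coset_equiv}] by [].
by apply/eqP; rewrite e; apply/asboolP.
Qed.

Lemma coset_piK x : N (repr (coset_pi x) - x).
Proof. by apply/coset_piP; rewrite /coset_pi reprK. Qed.

Lemma coset_reprK (q : coset_space) : coset_pi (repr q) = q.
Proof. exact: reprK. Qed.

Definition coset_add (a b : coset_space) := coset_pi (repr a + repr b).
Definition coset_opp (a : coset_space) := coset_pi (- repr a).

Lemma coset_addE x y : coset_add (coset_pi x) (coset_pi y) = coset_pi (x + y).
Proof.
by apply/coset_piP; rewrite opprD addrACA; apply: subgroupD => //; exact: coset_piK.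
Qed.
Lemma coset_oppE x : coset_opp (coset_pi x) = coset_pi (- x).
Proof.
by apply/coset_piP; rewrite -opprD; apply: subgroupN => //; exact: coset_piK.
Qed.

Lemma coset_addA : associative coset_add.
Proof.
move=> a b c; rewrite -(coset_reprK a) -(coset_reprK b) -(coset_reprK c).
by rewrite !coset_addE addrA.
Qed.
Lemma coset_addC : commutative coset_add.
Proof. by move=> a b; rewrite /coset_add addrC. Qed.
Lemma coset_add0 : left_id (coset_pi 0) coset_add.
Proof. by move=> a; rewrite -(coset_reprK a) coset_addE add0r. Qed.
Lemma coset_addN : left_inverse (coset_pi 0) coset_opp coset_add.
Proof. by move=> a; rewrite -(coset_reprK a) coset_oppE coset_addE addNr. Qed.

HB.instance Definition _ := GRing.isZmodule.Build coset_space
  coset_addA coset_addC coset_add0 coset_addN.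

Lemma coset_piD x y : coset_pi (x + y) = coset_pi x + coset_pi y.
Proof. by rewrite -coset_addE. Qed.
Lemma coset_piB x y : coset_pi (x - y) = coset_pi x - coset_pi y.
Proof. by rewrite coset_piD; congr (_ + _); rewrite -coset_oppE. Qed.

Lemma coset_pi_continuous : continuous coset_pi.
Proof. exact: pi_continuous. Qed.

Lemma coset_openP (V : set coset_space) : open V <-> open (coset_pi @^-1` V).
Proof. by []. Qed.

Lemma coset_pi_open (V : set M) : open V -> open (coset_pi @` V).
Proof.
move=> oV; apply/coset_openP.
have -> : coset_pi @^-1` (coset_pi @` V) =
   \bigcup_(n in N) ((fun x => x + n) @^-1` V).
  apply/seteqP; split=> x /=.
    move=> [y Vy /coset_piP h]; exists (y - x) => //=.
    by rewrite addrC subrK.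
  move=> [n Nn /= V1]; exists (x + n) => //; apply/coset_piP.
  by rewrite addrC addKr.
apply: bigcup_open => n Nn; apply: open_comp => // x _.
apply: (@continuous_comp _ _ _ (fun x => (x, n)) (fun x : M * M => x.1 + x.2)).
  by apply: cvg_pair => /=; [exact: cvg_id|exact: cvg_cst].
exact: add_continuous.
Qed.

Lemma coset_sub_continuous : continuous (fun x : coset_space * coset_space => x.1 - x.2).
Proof.
move=> [a b] U /=; rewrite -(coset_reprK a) -(coset_reprK b) -coset_piB.
move=> /coset_pi_continuous /(@sub_continuous M (_, _)) [[V W] /= [nV nW] h].
exists (coset_pi @` V, coset_pi @` W) => /=.
  split.
    move: nV; rewrite nbhsE => -[V' [oV' V'x] V'V].
    apply: (@filterS _ _ _ (coset_pi @` V')); first exact: image_subset.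
    by apply: open_nbhs_nbhs; split; [exact: coset_pi_open|exists (repr a)].
  move: nW; rewrite nbhsE => -[V' [oV' V'x] V'V].
  apply: (@filterS _ _ _ (coset_pi @` V')); first exact: image_subset.
  by apply: open_nbhs_nbhs; split; [exact: coset_pi_open|exists (repr b)].
move=> [c d] /= [[x Vx <-] [y Wy <-]].
rewrite -coset_piB; exact: (h (x, y)).
Qed.

HB.instance Definition _ :=
  PreTopologicalNmodule_isTopologicalZmodule.Build coset_space coset_sub_continuous.

End Coset.
Local Close Scope quotient_scope.

Lemma quotient_exists (A M : topologicalZmodType) (act : A -> M -> M) (N : set M) :
  LC_module act -> submod act N -> closed N ->
  exists (Q : topologicalZmodType) (actQ : A -> Q -> Q) (p : M -> Q),
    LC_module actQ /\ quotient_map act actQ N p.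
Proof.
move=> lM [sN aN] cN; pose Q : topologicalZmodType := coset_space sN.
pose p : M -> Q := coset_pi sN.
pose actQ (a : A) (q : Q) : Q := p (act a (repr q)).
have actQE a x : actQ a (p x) = p (act a x).
  by apply/coset_piP; rewrite -(actB lM); apply: aN; exact: coset_piK.
have ps q : exists x, p x = q by exists (repr q); exact: coset_reprK.
have qp : quotient_map act actQ N p.
  split=> //; first exact: coset_piD.
    by split; [exact: coset_pi_continuous|exact: coset_pi_open].
  apply/seteqP; split=> x /=.
    by rewrite -[0]/(p 0) => /coset_piP; rewrite subr0.
  by move=> Nx; rewrite -[0]/(p 0); apply/coset_piP; rewrite subr0.
exists Q, actQ, p; split=> //; split.
  split.
    apply: hausdorff_topgroup.
    have -> : [set 0 : Q] = p @` N.
      apply/seteqP; split=> q /=; first by move=> ->; exists 0; [exact: sN.1|].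
      by move=> [x /(qmap_ker qp) + <-].
    by apply: (qmap_closed_image qp) => // x n; exact: subgroupD.
  move=> q; have [x <-] := ps q; have [K nK cK] := lM.1.2 x.
  exists (p @` K); first exact: (qmap_nbhs qp).
  by apply: compact_image => //; exact: (qmap_cont qp).
split; [|split; [|split]].
- move=> a x y; have [x' <-] := ps x; have [y' <-] := ps y.
  by rewrite -(qmapD qp) !actQE (actD lM) (qmapD qp).
- by move=> x; have [x' <-] := ps x; rewrite actQE (act0 lM).
- by move=> a b x; have [x' <-] := ps x; rewrite !actQE (actA lM).
- move=> [a q] U /=; have [x <-] := ps q; rewrite actQE.
  move=> /(qmap_cont qp) /(@act_cont _ _ _ lM (a, x)) [[V W] /= [nV nW] h].
  exists (V, p @` W); first by split=> //=; exact: (qmap_nbhs qp).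
  by move=> [b r] /= [Vb [y Wy <-]]; rewrite actQE; exact: (h (b, y)).
Qed.

(** * Coarse norms on locally compact abelian groups *)

(* If infinitely many multiples of [x] come close to [Lam], then all of them do: this is
   Weil's dichotomy for monothetic groups, relative to the subgroup [Lam]. *)
Section Recurrence.
Variables (T : topologicalZmodType) (lT : LCA T) (Lam : set T).
Hypothesis sLam : is_subgroup Lam.
Variables (x : T) (V : set T).
Hypothesis cV : compact V.
Hypothesis often : forall R : nat, exists2 n, (R < n)%N & sums V Lam (x *+ n).

(** Two late multiples of [x] have representatives in [V] close to the same cluster point [v]; the
    difference of these multiples is then close to [Lam]. *)
Lemma recurrence_nbhs W (R : nat) : nbhs 0 W -> exists2 n, (R < n)%N & sums W Lam (x *+ n).
Proof.
move=> nW; have [W1 [nW1 sW1 hW1]] := nbhs0D nW.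
pose E R := [set v | V v /\ exists2 n, (R < n)%N & Lam (x *+ n - v)].
have [| | |i _|v Vv clv] := @compact_directed_cap T V nat setT (fun R => closure (E R)) cV.
- by exists 0%N.
- move=> i j _ _; exists (maxn i j); split=> //; apply: closureS => v [Vv [n ijn Ln]].
    by split=> //; exists n => //; apply: leq_ltn_trans ijn; exact: leq_maxl.
  by split=> //; exists n => //; apply: leq_ltn_trans ijn; exact: leq_maxr.
- by move=> i _; exact: closed_closure.
- have [n Rn [v Vv Lv]] := often i; exists v => //; apply: subset_closure.
  by split=> //; exists n.
have /closureP /(_ _ nW1)[v1 [_ [n1 _ L1]] W1v1] := clv 0%N I.
have /closureP /(_ _ nW1)[v2 [_ [n2 n12 L2]] W1v2] := clv (R + n1)%N I.
have le12 : (n1 <= n2)%N by apply: ltnW; apply: leq_ltn_trans n12; exact: leq_addl.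
exists (n2 - n1)%N; first by rewrite ltn_subRL addnC.
exists (v2 - v1).
  have -> : v2 - v1 = (v - v1) + (- (v - v2)) by zmod.
  by apply: hW1 => //; exact: sW1.
rewrite mulrnBr //.
have -> : x *+ n2 - x *+ n1 - (v2 - v1) = (x *+ n2 - v2) - (x *+ n1 - v1).
  by move: (x *+ n2) (x *+ n1) => a b; zmod.
exact: sLam.2.
Qed.

Lemma recurrence_compact : exists2 K, compact K & forall n : int, sums K Lam (x *~ n).
Proof.
have [V1 [cV1 nV1 sV1 _]] := LC_compact_nbhs lT (@compact0 T).
pose E := [set y | exists (n : int), Lam (y - x *~ n)].
pose C := V1 `&` closure E.
have cC : compact C by apply: compact_closedI => //; exact: closed_closure.
(* The points that return to [V1] modulo [Lam] within [M] positive steps. A point near x n + Lam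
   returns at m = l - n, where l > |n| is a time at which x l is close to [Lam]; compactness bounds
   the return time uniformly. *)
pose G M := [set v | exists m, [/\ (0 < m)%N, (m <= M)%N & sums V1 Lam (v + x *+ m)]].
have [| | |M _ hM] := @compact_directed_cover T C nat setT G cC.
- by exists 0%N.
- move=> i j _ _; exists (maxn i j); split=> // v [m [m0 mi hm]]; exists m; split=> //.
    by apply: leq_trans mi _; exact: leq_maxl.
  by apply: leq_trans mi _; exact: leq_maxr.
- move=> v [V1v clv]; have [W [nW sW hW]] := nbhs0D3 nV1.
  move/closureP: clv => /(_ _ nW)[y [n Ln] Wvy].
  have [l nl [w Ww Lw]] := recurrence_nbhs (absz n) nW.
  have [m me m0] : exists2 m : nat, (m : int) = l%:Z - n & (0 < m)%N.
    exists (absz (l%:Z - n)); first by rewrite gez0_abs //; lia.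
    by lia.
  exists m => //; apply/nbhs_at0P; apply: filterS nW => v' Wv'.
  exists m; split=> //; exists (v' + (v - y) + w); first exact: hW.
  have -> : v + v' + x *+ m - (v' + (v - y) + w) = (y - x *~ n) + (x *+ l - w).
    rewrite pmulrn me mulrzBr -pmulrn.
    by move: (x *~ n) (x *+ l) => a b; zmod.
  exact: subgroupD.
(* Take [s] as the last return time up to [n]: the next return is at most [M] steps later, so [s]
   stays within [M] of [n]. *)
have step n : exists s, [/\ (s <= n)%N, (n - s <= M)%N & sums V1 Lam (x *+ s)].
  elim: n => [|n [s [sn nsM hs]]].
    by exists 0%N; split=> //; exists 0; [exact: nbhs_singleton|rewrite subr0 mulr0n; exact: sLam.1].
  have [h|h] := leqP (n.+1 - s) M; first by exists s; split=> //; exact: leqW.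
  case: hs => v V1v Lv.
  have Cv : C v.
    split=> //; apply: subset_closure; exists s%:Z.
    by rewrite -pmulrn -opprB; exact: subgroupN.
  have [m [m0 mM [u Vu Lu]]] := hM v Cv.
  exists (s + m)%N; split; [lia|lia|].
  exists u => //; have -> : x *+ (s + m) - u = (x *+ s - v) + (v + x *+ m - u).
    by rewrite mulrnDr; move: (x *+ s) (x *+ m) => a b; zmod.
  exact: subgroupD.
pose J := [set x *+ j | j in `I_M.+1].
have cJ : compact J by apply: finite_compact; apply: finite_image; exact: finite_II.
have cK : compact (sums V1 J) by exact: compact_sums.
have hn n : sums (sums V1 J) Lam (x *+ n).
  have [s [sn nsM [v V1v Lv]]] := step n; exists (v + x *+ (n - s)).
    by apply: sumsP => //; exists (n - s)%N.
  have -> : x *+ n - (v + x *+ (n - s)) = x *+ s - v.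
    by rewrite -{1}(subnKC sn) mulrnDr; move: (x *+ s) (x *+ (n - s)) => a b; zmod.
  by [].
exists (sums V1 J `|` [set y | sums V1 J (- y)]).
  by apply: compactU => //; exact: compact_opp.
case=> n.
  have [y hy Ly] := hn n; exists y; first by left.
  by rewrite -pmulrn.
have [y hy Ly] := hn n.+1; exists (- y); first by right; rewrite /= opprK.
by rewrite NegzE mulrNz -pmulrn -opprD; exact: subgroupN.
Qed.

End Recurrence.

Section Lattice.
Variables (T : topologicalZmodType) (lT : LCA T) (k : nat) (F : 'I_k -> T).

Definition comb (z : 'I_k -> int) : T := \sum_i F i *~ z i.
Definition supported (J : {set 'I_k}) (z : 'I_k -> int) := forall i, i \notin J -> z i = 0.
Definition lattice J : set T := [set x | exists2 z, supported J z & x = comb z].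
(** Properness of the homomorphism from Z^J to [T] given by the [F i]: preimages of compact sets are
    finite. *)
Definition proper_comb (J : {set 'I_k}) : Prop := forall K, compact K ->
  exists r : nat, forall z, supported J z -> K (comb z) -> forall i, (absz (z i) <= r)%N.

Lemma combB z w : comb (fun i => z i - w i) = comb z - comb w.
Proof. by rewrite /comb -sumrB; apply: eq_bigr => i _; rewrite mulrzBr. Qed.

Lemma combD z w : comb (fun i => z i + w i) = comb z + comb w.
Proof. by rewrite /comb -big_split; apply: eq_bigr => i _; rewrite mulrzDr. Qed.

Lemma subgroup_lattice J : is_subgroup (lattice J).
Proof.
split; first by exists (fun=> 0) => //; rewrite /comb big1 // => i _; rewrite mulr0z.
move=> _ _ [z Jz ->] [w Jw ->]; exists (fun i => z i - w i); last by rewrite combB.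
by move=> i iJ; rewrite Jz // Jw // subrr.
Qed.

Lemma proper_comb0 : proper_comb finset.set0.
Proof. by move=> K _; exists 0%N => z Jz _ i; rewrite Jz // inE. Qed.

Lemma comb_setD1 z (f : 'I_k) :
  comb z = comb (fun i => if i == f then 0 else z i) + F f *~ z f.
Proof.
rewrite /comb (bigD1 f) //= [in RHS](bigD1 f) //= eqxx mulr0z add0r addrC; congr (_ + _).
by apply: eq_bigr => i /negbTE ->.
Qed.

(** If the coefficients of [f] were bounded on combinations in [K0], then removing their finitely
    many values would reduce to properness for [J]. So they are unbounded, and multiples of [F f]
    come back to a compact set modulo the lattice infinitely often. *)
Lemma not_proper_comb (J : {set 'I_k}) (f : 'I_k) : f \notin J -> proper_comb J -> ~ proper_comb (f |: J)%SET ->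
  exists2 K, compact K & forall n : int, sums K (lattice J) (F f *~ n).
Proof.
move=> fJ pJ /existsNP[K0 /not_implyP[cK0 nK0]].
pose K := K0 `|` [set x | K0 (- x)].
have cK : compact K by apply: compactU => //; exact: compact_opp.
have sup z : supported (f |: J)%SET z -> supported J (fun i => if i == f then 0 else z i).
  move=> Jz i iJ; case: eqP => // /eqP nif; apply: Jz.
  by rewrite !inE negb_or nif.
apply: (@recurrence_compact T lT (lattice J) (subgroup_lattice J) (F f) K cK) => R.
apply: contrapT => hR; apply: nK0.
pose J' := [set F f *~ n%:Z | n in `I_R.+1] `|` [set F f *~ (- n%:Z) | n in `I_R.+1].
have cJ' : compact J'.
  apply: finite_compact; rewrite finite_setU.
  by split; apply: finite_image; exact: finite_II.
have bound z : supported (f |: J)%SET z -> K0 (comb z) -> (absz (z f) <= R)%N.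
  move=> Jz Kz; rewrite leqNgt; apply/negP => Rz; apply: hR.
  exists (absz (z f)) => //.
  have [zf|zf] := leP 0 (z f).
    exists (comb z); first by left.
    have -> : F f *+ absz (z f) = F f *~ z f by rewrite pmulrn gez0_abs.
    rewrite (comb_setD1 z f) opprD addrCA subrr addr0.
    apply: subgroupN; first exact: subgroup_lattice.
    by exists (fun i => if i == f then 0 else z i) => //; exact: sup.
  exists (- comb z); first by right; rewrite /= opprK.
  have -> : F f *+ absz (z f) = - (F f *~ z f).
    by rewrite -mulrNz pmulrn ltz0_abs.
  rewrite opprK [X in _ + X](comb_setD1 z f) addrCA addNr addr0.
  by exists (fun i => if i == f then 0 else z i) => //; exact: sup.
have cKJ : compact (sums K0 J') by exact: compact_sums.
have [r hr] := pJ _ cKJ.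
exists (maxn r R) => z Jz Kz i.
have [->|nif] := eqVneq i f; first by rewrite (leq_trans (bound z Jz Kz)) // leq_maxr.
have := hr _ (sup z Jz); move=> /(_ _ i); rewrite (negbTE nif) => hz.
apply: leq_trans (leq_maxl _ _); apply: hz.
exists (comb z) => //.
have -> : comb (fun i => if i == f then 0 else z i) - comb z = - (F f *~ z f).
  by rewrite [comb z](comb_setD1 z f) opprD addrA subrr add0r.
have := bound z Jz Kz; rewrite -mulrNz.
have [zf|zf] := leP 0 (z f) => zR.
  by right; exists (absz (z f)) => //; rewrite gez0_abs.
by left; exists (absz (z f)) => //; rewrite ltz0_abs.
Qed.

(** For a maximal [J] with proper combinations, every generator outside [J] has all its multiples in
    a compact set modulo the lattice; these compact sets are added up. *)
Lemma cocompact_lattice : exists J K, [/\ proper_comb J, compact K &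
  forall z, sums K (lattice J) (comb z)].
Proof.
have [J] : {J | maxset (fun J => `[< proper_comb J >]) J}.
  by apply: ex_maxset; exists finset.set0; apply/asboolP; exact: proper_comb0.
move=> /maxsetP[/asboolP pJ maxJ].
have hi i : exists2 K, compact K & forall n : int, sums K (lattice J) (F i *~ n).
  have [iJ|iJ] := boolP (i \in J).
    exists [set 0]; first exact: compact_set1.
    move=> n; exists 0 => //; rewrite subr0; exists (fun j => if j == i then n else 0).
      by move=> j jJ; case: eqP => // ji; move: jJ; rewrite ji iJ.
    rewrite /comb (bigD1 i) //= eqxx big1 ?addr0 // => j /negbTE ->.
    by rewrite mulr0z.
  apply: not_proper_comb => // pi.
  have /setP/(_ i) : (i |: J)%SET = J by apply: maxJ; [exact/asboolP|exact: finset.subsetUr].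
  by rewrite !inE eqxx (negbTE iJ).
have sL := subgroup_lattice J.
suff [K cK hK] : exists2 K, compact K & forall z : 'I_k -> int,
    sums K (lattice J) (\sum_(i <- index_enum 'I_k) F i *~ z i).
  by exists J, K.
elim: (index_enum _) => [|i s [K cK ih]].
  exists [set 0]; first exact: compact_set1.
  by move=> z; rewrite big_nil; exists 0 => //; rewrite subr0; exact: sL.1.
have [Ki cKi hKi] := hi i; exists (sums Ki K); first exact: compact_sums.
move=> z; rewrite big_cons.
have [a Ka La] := hKi (z i); have [b Kb Lb] := ih z.
exists (a + b); first exact: sumsP.
by rewrite opprD addrACA; exact: subgroupD.
Qed.

End Lattice.

Section CoarseNorm.
Variable (T : topologicalZmodType).

(** Abstracts the sup norm of lattice coordinates. Up to the constant [c] it is subadditive, even,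
    and at least doubled by doubling; a subset of [L] has bounded norm exactly when it lies in a
    compact set. *)
Definition coarse_norm (L : set T) (h : T -> nat) (c : nat) : Prop :=
  [/\ forall x y, L x -> L y -> (h (x + y)%R <= h x + h y + c)%N,
      forall x, L x -> (2 * h x <= h (x *+ 2)%R + c)%N,
      forall x, L x -> (h (- x)%R <= h x + c)%N,
      forall r, exists2 K, compact K & forall x, L x -> (h x <= r)%N -> K x &
      forall K, compact K -> exists r, forall x, L x -> K x -> (h x <= r)%N].

Lemma coarse_normS (L L' : set T) h c : L `<=` L' -> coarse_norm L' h c -> coarse_norm L h c.
Proof.
move=> LL [h1 h2 h3 h4 h5]; split.
- by move=> x y /LL Lx /LL Ly; exact: h1.
- by move=> x /LL; exact: h2.
- by move=> x /LL; exact: h3.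
- by move=> r; have [K cK hK] := h4 r; exists K => // x /LL; exact: hK.
- by move=> K /h5[r hr]; exists r => x /LL; exact: hr.
Qed.

(** [h] is the sup norm of chosen coordinates [pi]. They are not additive, but the combination of pi
    (x + y) - pi x - pi y lies in the fixed compact set [K3], so properness bounds this error by
    [c1]; likewise [c2] for opposites. *)
Lemma coarse_norm_lattice (k : nat) (F : 'I_k -> T) (J : {set 'I_k}) (L K : set T) :
  proper_comb F J -> compact K -> is_subgroup L -> L `<=` sums K (lattice F J) ->
  exists h c, coarse_norm L h c.
Proof.
move=> pJ cK sL hL.
have /choice[pi hpi] : forall x, exists z, L x -> supported J z /\ K (x - comb F z).
  move=> x; have [Lx|nLx] := pselect (L x); last by exists (fun=> 0).
  have [a Ka [z Jz xa]] := hL x Lx; exists z => _; split=> //.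
  by rewrite -xa opprB addrC subrK.
pose h x := (\max_(i < k) absz (pi x i))%N.
have hle x r : (h x <= r)%N <-> forall i, (absz (pi x i) <= r)%N.
  split=> [hr i|hr]; first by apply: leq_trans hr; exact: (leq_bigmax i).
  by apply/bigmax_leqP => i _; exact: hr.
have hx x i : (absz (pi x i) <= h x)%N by exact: (hle x (h x)).1.
pose nK := [set x | K (- x)]; have cnK : compact nK by exact: compact_opp.
have Kn a : K a -> nK (- a) by rewrite /nK /= opprK.
pose K3 := sums (sums nK K) K.
have cK3 : compact K3 by do 2?apply: compact_sums.
have [c1 hc1] := pJ _ cK3; have [c2 hc2] := pJ _ (compact_sums cnK cnK).
have eK x : L x -> supported J (pi x) by move=> /hpi[].
have xK x : L x -> K (x - comb F (pi x)) by move=> /hpi[].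
have dbl x y i : L x -> L y ->
    (absz (pi (x + y)%R i - pi x i - pi y i)%R <= c1)%N.
  move=> Lx Ly; have Lxy : L (x + y) by exact: subgroupD.
  apply: (hc1 (fun i => pi (x + y) i - pi x i - pi y i)).
    by move=> j jJ; rewrite !eK // !subrr.
  rewrite [comb _ _](_ : _ = comb F (pi (x + y)) - comb F (pi x) - comb F (pi y)); last first.
    by rewrite -!combB.
  have -> : comb F (pi (x + y)) - comb F (pi x) - comb F (pi y) =
     - (x + y - comb F (pi (x + y))) + (x - comb F (pi x)) + (y - comb F (pi y)).
    by move: (comb F _) (comb F _) (comb F _) => a b d; zmod.
  by apply: sumsP; [apply: sumsP; [apply: Kn|]|]; exact: xK.
exists h, (maxn c1 c2); split.
- move=> x y Lx Ly; apply/hle => i.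
  by have := dbl x y i Lx Ly; have := hx x i; have := hx y i; lia.
- move=> x Lx.
  suff : (h x <= (h (x *+ 2)%R + maxn c1 c2)./2)%N by lia.
  apply/hle => i; have := dbl x x i Lx Lx; rewrite -[x + x]mulr2n.
  have := hx (x *+ 2) i; move: (h (x *+ 2)%R) (pi (x *+ 2)%R i) (pi x i) => a b d.
  lia.
- move=> x Lx; apply/hle => i; have LNx : L (- x) by exact: subgroupN.
  have : (absz (pi (- x)%R i + pi x i)%R <= c2)%N.
    apply: (hc2 (fun i => pi (- x) i + pi x i)).
      by move=> j jJ; rewrite !eK // addr0.
    rewrite combD.
    have -> : comb F (pi (- x)) + comb F (pi x) =
      - (- x - comb F (pi (- x))) - (x - comb F (pi x)).
      by move: (comb F _) (comb F _) => a b; zmod.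
    by apply: sumsP; apply: Kn; exact: xK.
  by have := hx x i; lia.
- move=> r; pose B := [set comb F (fun i => (z i : int) - r%:Z) | z in [set: {ffun 'I_k -> 'I_(2 * r).+1}]].
  exists (sums K B).
    apply: compact_sums => //; apply: finite_compact; apply: finite_image.
    exact: finite_finset.
  move=> x Lx /hle hr; exists (x - comb F (pi x)); first exact: xK.
  rewrite opprB addrC subrK.
  have zz i : (absz (pi x i + r%:Z)%R < (2 * r).+1)%N by have := hr i; lia.
  exists [ffun i => Ordinal (zz i)] => //; congr comb; apply/funext => i.
  rewrite ffunE /=; have := hr i; lia.
- move=> K0 cK0; have [r hr] := pJ _ (compact_sums cK0 cnK).
  exists r => x Lx K0x; apply/hle; apply: hr; first exact: eK.
  have -> : comb F (pi x) = x - (x - comb F (pi x)) by rewrite opprB addrC subrK.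
  by apply: sumsP => //; apply: Kn; exact: xK.
Qed.

(** A compact relative neighbourhood [V] of 0 generates an open subgroup [G] of [S]. As V + V is
    covered by finitely many translates F i + W0, already V plus the span of the [F i] is a group,
    and the cocompact lattice of this span gives the norm. [K0] is there to force a prescribed
    compact part of [S] into [G]. *)
Lemma coarse_norm_exists (lT : LCA T) (S K0 : set T) :
  is_subgroup S -> closed S -> compact K0 ->
  exists G h c, [/\ is_subgroup G /\ G `<=` S,
    exists2 W, nbhs 0 W & forall x, S x -> W x -> G x,
    forall x, S x -> K0 x -> G x & coarse_norm G h c].
Proof.
move=> sS cS cK0; have [W0 [cW0 nW0 sW0 KW0]] := LC_compact_nbhs lT cK0.
pose V := W0 `&` S.
have cV : compact V by exact: compact_closedI.
have V0 : V 0 by split; [exact: nbhs_singleton|exact: sS.1].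
have sV x : V x -> V (- x) by case=> W0x Sx; split; [exact: sW0|exact: subgroupN].
have cVV : compact (sums V V) by exact: compact_sums.
have VS : sums V V `<=` S.
  by move=> x [a [_ Sa] [_ Sxa]]; rewrite -(subrK a x); exact: subgroupD.
have [| | |s sVV hs] := @compact_directed_cover T (sums V V) (seq T)
  [set s | forall f, f \in s -> sums V V f] (fun s => [set x | exists2 f, f \in s & W0 (x - f)]) cVV.
- by exists [::].
- move=> s1 s2 h1 h2; exists (s1 ++ s2); split.
  + by move=> f; rewrite mem_cat => /orP[/h1|/h2].
  + by move=> x [f fs Wf]; exists f => //; rewrite mem_cat fs.
  + by move=> x [f fs Wf]; exists f => //; rewrite mem_cat fs orbT.
- move=> x VVx; exists [:: x]; first by move=> f; rewrite inE => /eqP ->.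
  apply/nbhs_at0P; apply: filterS nW0 => w Ww; exists x; first by rewrite inE.
  by rewrite addrC addKr.
pose k := size s; pose F (i : 'I_k) : T := tnth (in_tuple s) i.
have FS i : S (F i) by apply: VS; apply: sVV; exact: mem_tnth.
pose G := sums V [set x | exists z, x = comb F z].
have [J [K [pJ cK hK]]] := cocompact_lattice lT F.
have GP v z : V v -> G (v + comb F z) by move=> Vv; apply: sumsP => //; exists z.
have VG x : V x -> G x.
  move=> Vx; rewrite -(addr0 x).
  have -> : 0 = comb F (fun=> 0) by rewrite /comb big1 // => i _; rewrite mulr0z.
  exact: GP.
have sG : is_subgroup G.
  split; first exact: VG.
  move=> x y [v Vv [z xv]] [w Vw [u yw]].
  have [|f fs W0f] := hs (v - w); first by exists v => //; rewrite addrC addKr; exact: sV.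
  have [i fE] : exists i : 'I_k, f = F i.
    have si : (index f s < k)%N by rewrite index_mem.
    by exists (Ordinal si); rewrite /F (tnth_nth 0) /= nth_index.
  have -> : x - y = (v - w - f) + comb F (fun j => z j - u j + (if j == i then 1 else 0)).
    rewrite (combD F (fun j => z j - u j)) combB -xv -yw.
    rewrite [X in _ + (_ + X)](_ : _ = f); first by zmod.
    rewrite /comb (bigD1 i) //= eqxx mulr1z big1 ?addr0 // => j /negbTE ->.
    by rewrite mulr0z.
  apply: GP; split=> //; rewrite fE; apply: sS.2 => //.
  by apply: sS.2; [case: Vv|case: Vw].
have GS : G `<=` S.
  move=> x [v [_ Sv] [z xv]]; rewrite -(subrK v x); apply: subgroupD => //.
  by rewrite xv /comb; apply: subgroup_sum => // i; exact: subgroupMz.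
have [| |h [c hc]] := @coarse_norm_lattice k F J G (sums V K) pJ _ sG.
- exact: compact_sums.
- move=> x [v Vv [z xv]]; have [a Ka La] := hK z.
  exists (v + a); first exact: sumsP.
  by rewrite opprD addrA xv.
exists G, h, c; split=> //.
- by exists W0 => // x Sx Wx; exact: VG.
- by move=> x Sx /KW0 Wx; exact: VG.
Qed.

End CoarseNorm.

(** * Dyadically bounded elements and dyadic one-parameter chains *)

Section UltraLimits.
Variables (X : Type) (U : set_system X) (UU : UltraFilter U) (T : topologicalZmodType).

(** With one ultrafilter, all members of a sequence of functions converge at once in compact sets,
    and relations between them pass to the limit. *)
Definition ulim (f : X -> T) (p : T) := forall W, nbhs 0 W -> U [set u | W (f u - p)].

Lemma ulim_exists (f : X -> T) (K : set T) : compact K -> U [set u | K (f u)] ->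
  exists2 p, K p & ulim f p.
Proof.
move=> cK UK.
have PF : ProperFilter (f @ U) by exact: fmap_proper_filter.
have [p [Kp clp]] := cK (f @ U) PF UK; exists p => // W nW.
have [//|UC] := in_ultra_setVsetC [set u | W (f u - p)] UU.
have nb : nbhs p [set y | W (y - p)].
  by apply/nbhs_at0P; apply: filterS nW => w /=; rewrite addrC addKr.
have UI : U (f @^-1` (f @` ~` [set u | W (f u - p)])).
  by apply: filterS UC => u hu /=; exists u.
have [y [[u nWu <-] Wy]] := clp _ _ UI nb.
by case: (nWu).
Qed.

Lemma ulim_closed (f : X -> T) p (C : set T) :
  closed C -> U [set u | C (f u)] -> ulim f p -> C p.
Proof.
move=> cC UC lf; apply: cC; apply/closureP => W nW.
have [u [/= Cu Wu]] := filter_ex (filterI UC (lf _ (nbhs0_opp nW))).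
by exists (f u) => //; rewrite -opprB.
Qed.

Lemma ulimD (f g : X -> T) p q : ulim f p -> ulim g q -> ulim (fun u => f u + g u) (p + q).
Proof.
move=> lf lg W nW; have [V [nV _ hV]] := nbhs0D nW.
apply: filterS (filterI (lf _ nV) (lg _ nV)) => u [/= Vf Vg].
by rewrite opprD addrACA; exact: hV.
Qed.

Lemma ulim_eq (f g : X -> T) p q : closed [set 0 : T] ->
  ulim f p -> ulim g q -> ulim (fun u => f u - g u) 0 -> p = q.
Proof.
move=> cl0 lf lg lfg; apply/eqP; rewrite -subr_eq0; apply/eqP; apply: cl0.
apply/closureP => W nW; exists 0 => //; rewrite subr0.
have [V [nV sV hV]] := nbhs0D3 nW.
have [u [[/= Vf Vg] Vfg]] := filter_ex (filterI (filterI (lf _ nV) (lg _ nV)) (lfg _ nV)).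
have -> : p - q = - (f u - p) + (g u - q) + (f u - g u - 0) by zmod.
by apply: hV => //; exact: sV.
Qed.

End UltraLimits.

Section Dyadic.
Variable T : topologicalZmodType.
Implicit Types (x : T) (S L K : set T).

(** In the product of R^n and a compact group [C] these are the elements of [C]. *)
Definition bdd x : Prop := exists2 K : set T, compact K & forall n, K (x *+ 2 ^ n).
Definition nobdd S : Prop := forall x, S x -> bdd x -> x = 0.
(** All of R^n when [S] is R^n, and 0 when [S] is discrete: it serves as the vector part of [S]. *)
Definition dyadic S : set T := [set x | exists u : nat -> T,
  [/\ u 0%N = x, forall k, S (u k), forall k, u k.+1 *+ 2 = u k &
      forall W, nbhs 0 W -> exists k0, forall k, (k0 <= k)%N -> W (u k)]].

Lemma continuous_mulrn n : continuous (fun x : T => x *+ n).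
Proof.
elim: n => [|n ih] x; first exact: cst_continuous.
have -> : (fun x : T => x *+ n.+1) = (fun x => x + x *+ n).
  by apply/funext => y; rewrite mulrS.
apply: (@continuous_comp _ _ _ (fun y => (y, y *+ n)) (fun z : T * T => z.1 + z.2)).
  by apply: cvg_pair => /=; [exact: cvg_id|exact: ih].
exact: add_continuous.
Qed.

Lemma closed_mulrn n K : closed K -> closed [set x : T | K (x *+ n)].
Proof. by move=> cK; apply: preimage_closed => // x _; exact: continuous_mulrn. Qed.

Lemma bdd0 : bdd 0.
Proof. by exists [set 0]; [exact: compact_set1|move=> n; rewrite mul0rn]. Qed.

Lemma bddB x y : bdd x -> bdd y -> bdd (x - y).
Proof.
move=> [K cK hK] [V cV hV]; exists (sums K [set z | V (- z)]).
  by apply: compact_sums => //; exact: compact_opp.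
by move=> n; rewrite mulrnBl; apply: sumsP => //=; rewrite opprK.
Qed.

Lemma bddD x y : bdd x -> bdd y -> bdd (x + y).
Proof.
by move=> bx By; rewrite -[y]opprK -[- y]sub0r; do 2?apply: bddB => //; exact: bdd0.
Qed.

Lemma subgroup_bdd S : is_subgroup S -> is_subgroup [set x | S x /\ bdd x].
Proof.
move=> sS; split; first by split; [exact: sS.1|exact: bdd0].
by move=> x y [Sx bx] [Sy By]; split; [exact: sS.2|exact: bddB].
Qed.

Lemma compact_subgroup_bdd S x : is_subgroup S -> compact S -> S x -> bdd x.
Proof. by move=> sS cS Sx; exists S => // n; exact: subgroupMn. Qed.

(** Once the norm exceeds [c], each doubling increases it, and the orbit leaves every compact
    set. *)
Lemma coarse_norm_bdd L h c x : is_subgroup L -> coarse_norm L h c -> L x -> bdd x ->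
  (h x <= c)%N.
Proof.
move=> sL [_ h2 _ _ h5] Lx [K cK Kx]; rewrite leqNgt; apply/negP => cx.
have [r hr] := h5 K cK.
have grow n : (c + n.+1 <= h (x *+ 2 ^ n)%R)%N.
  elim: n => [|n ih]; first by rewrite expn0 mulr1n addn1.
  have := h2 _ (subgroupMn (2 ^ n) sL Lx); rewrite -mulrnA -expnSr.
  by move: ih; set a := h (x *+ 2 ^ n); set b := h (x *+ 2 ^ n.+1); lia.
by have := leq_trans (grow r) (hr _ (subgroupMn (2 ^ r) sL Lx) (Kx r)); lia.
Qed.

Lemma dyadic_chainE (u : nat -> T) : (forall k, u k.+1 *+ 2 = u k) ->
  forall k j, u (k + j)%N *+ 2 ^ j = u k.
Proof.
move=> hu k; elim=> [|j ih]; first by rewrite addn0 expn0 mulr1n.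
by rewrite expnS mulrnA addnS hu ih.
Qed.

Lemma dyadic_sub S : dyadic S `<=` S.
Proof. by move=> x [u [<- Su _ _]]. Qed.

Lemma subgroup_dyadic S : is_subgroup S -> is_subgroup (dyadic S).
Proof.
move=> sS; split.
  exists (fun=> 0); split=> //; [by move=> _; exact: sS.1|by rewrite mul0rn|].
  by move=> W nW; exists 0%N => k _; exact: nbhs_singleton.
move=> x y [u [u0 Su hu lu]] [v [v0 Sv hv lv]]; exists (fun k => u k - v k); split.
- by rewrite u0 v0.
- by move=> k; exact: sS.2.
- by move=> k; rewrite mulrnBl hu hv.
- move=> W nW; have [V [nV sV hV]] := nbhs0D nW.
  have [k1 h1] := lu V nV; have [k2 h2] := lv V nV; exists (maxn k1 k2) => k.
  by rewrite geq_max => /andP[/h1 Vu /h2 Vv]; apply: hV => //; exact: sV.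
Qed.

Lemma dyadic_half S x : dyadic S x -> exists2 y, dyadic S y & y *+ 2 = x.
Proof.
move=> [u [u0 Su hu lu]]; exists (u 1%N); last by rewrite hu.
exists (fun k => u k.+1); split=> // W /lu[k0 hk]; exists k0 => k kk.
by apply: hk; exact: leqW.
Qed.

(** A late member of the chain is in [G], and repeated doubling leads back to [x]. *)
Lemma dyadic_relopen S G : is_subgroup G ->
  (exists2 W, nbhs 0 W & forall x, S x -> W x -> G x) -> dyadic S `<=` G.
Proof.
move=> sG [W nW hW] x [u [<- Su hu lu]]; have [k hk] := lu W nW.
rewrite -(dyadic_chainE hu 0 k) add0n; apply: subgroupMn => //.
by apply: hW => //; exact: hk.
Qed.

Hypothesis lT : LCA T.

(** An element whose doublings never leave [K] is bounded, hence 0; compactness replaces never by a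
    finite number [J] of steps. *)
Lemma nobdd_uniform S K W : closed S -> nobdd S -> compact K -> nbhs 0 W ->
  exists J, forall t, S t -> (forall j, (j <= J)%N -> K (t *+ 2 ^ j)) -> W t.
Proof.
move=> cS nS cK nW.
pose C J := [set t | S t /\ forall j, (j <= J)%N -> K (t *+ 2 ^ j)].
have [| | |x Kx hx|J _ hJ] := @compact_directed_cap_sub T K nat setT C W cK.
- by exists 0%N.
- move=> i j _ _; exists (maxn i j); split=> // t [St ht]; split=> // l li; apply: ht.
    by apply: leq_trans li _; exact: leq_maxl.
  by apply: leq_trans li _; exact: leq_maxr.
- move=> i _; apply: (@closedI _ S
    (\bigcap_(j in [set j | (j <= i)%N]) [set t : T | K (t *+ 2 ^ j)])) => //.
  by apply: closed_bigI => j _; apply: closed_mulrn; exact: (LC_compact_closed lT).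
- suff -> : x = 0 by [].
  apply: nS; first by case: (hx 0%N I).
  by exists K => // n; have [_] := hx n I; apply.
- exists J => t St ht; apply: hJ; split=> //.
  by have := ht 0%N (leq0n _); rewrite expn0 mulr1n.
Qed.

(** Convergence to 0 is automatic: doubling [u k] runs back through k members of the chain inside
    [K], so [nobdd_uniform] applies to it for k >= J. *)
Lemma dyadic_compact_chain S K (u : nat -> T) : closed S -> nobdd S -> compact K ->
  (forall k, S (u k)) -> (forall k, K (u k)) -> (forall k, u k.+1 *+ 2 = u k) ->
  dyadic S (u 0%N).
Proof.
move=> cS nS cK Su Ku hu; exists u; split=> // W nW.
have [J hJ] := nobdd_uniform cS nS cK nW; exists J => k Jk; apply: hJ => // j jJ.
by rewrite -(subnK (leq_trans jJ Jk)) dyadic_chainE.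
Qed.

(* For [u] tending to 0 along an ultrafilter, let [n] be least with [u *+ n] outside a compact
   neighbourhood; the limits of [u *+ (n %/ 2 ^ k)] form the chain. *)
Lemma dyadic_exists S : is_subgroup S -> closed S -> nobdd S ->
  (forall W, nbhs 0 W -> exists x, [/\ S x, W x & x <> 0]) ->
  exists2 x, dyadic S x & x <> 0.
Proof.
move=> sS cS nS nd.
have [V [cV nV sV _]] := LC_compact_nbhs lT (@compact0 T).
pose V2 := sums V V; have cV2 : compact V2 by exact: compact_sums.
have V0 : V 0 by exact: nbhs_singleton.
have VV2 x : V x -> V2 x by move=> Vx; exists x => //; rewrite subrr.
have /choice[n hn] : forall u, exists n, S u -> u <> 0 ->
    ~ V (u *+ n) /\ forall m, (m < n)%N -> V (u *+ m).
  move=> u; have [[Su u0]|nu] := pselect (S u /\ u <> 0); last first.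
    by exists 0%N => Su u0; exfalso; apply: nu.
  have ex : exists n, ~~ `[< V (u *+ n) >].
    apply: contrapT => hu; apply: u0; apply: nS => //; exists V => // k.
    by apply: contrapT => /asboolPn nVk; apply: hu; exists (2 ^ k)%N.
  have [m /asboolPn nVm hm] := ex_minnP ex; exists m => _ _; split=> // l lm.
  apply: contrapT => /asboolPn /hm; by rewrite leqNgt lm.
pose F := filter_from (nbhs 0) (fun W => [set u | [/\ S u, W u & u <> 0]]).
have FF : ProperFilter F.
  apply: filter_from_proper.
    apply: filter_from_filter; first by exists setT; exact: filterT.
    move=> W1 W2 n1 n2; exists (W1 `&` W2); first exact: filterI.
    by move=> u [Su [W1u W2u] u0].
  by move=> W /nd[x [Sx Wx x0]]; exists x.
have [U [UU FU]] := ultraFilterLemma FF.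
have UW W : nbhs 0 W -> U [set u | [/\ S u, W u & u <> 0]].
  by move=> nW; apply: FU; exists W.
pose f k u := u *+ (n u %/ 2 ^ k).
have fV2 k u : S u -> V u -> u <> 0 -> V2 (f k u).
  move=> Su Vu u0; have [nVn Vm] := hn u Su u0.
  have : (n u %/ 2 ^ k <= n u)%N by exact: leq_div.
  rewrite leq_eqVlt /f => /orP[/eqP ->|/Vm /VV2 //].
  case: (n u) nVn Vm => [|m] nVn Vm; first by rewrite mulr0n in nVn.
  by rewrite mulrSr; apply: sumsP => //; exact: Vm.
have fS k u : S u -> S (f k u) by move=> Su; exact: subgroupMn.
have /choice[p hp] : forall k, exists p, V2 p /\ ulim U (f k) p.
  move=> k; have [|p V2p lp] := @ulim_exists _ U UU T (f k) V2 cV2; last by exists p.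
  by apply: filterS (UW V nV) => u [Su Vu u0]; exact: fV2.
have Sp k : S (p k).
  apply: (@ulim_closed _ U UU T (f k)) (hp k).2 => //.
  by apply: filterS (UW V nV) => u [Su _ _]; exact: fS.
have p2 k : p k.+1 *+ 2 = p k.
  rewrite mulr2n; apply: (@ulim_eq _ U UU T (fun u => f k.+1 u + f k.+1 u) (f k)).
  - exact: LC_closed1.
  - by apply: ulimD; exact: (hp _).2.
  - exact: (hp _).2.
  (* The quotient of [n u] by 2^k exceeds twice the quotient by 2^(k+1) by 0 or 1, so the defect is
     0 or -u, and [u] tends to 0. *)
  move=> W nW; have := UW _ (nbhs0_opp nW); apply: filterS => u [_ /= Wu _].
  rewrite subr0 -mulrnDr /f expnSr divnMA.
  move: (n u %/ 2 ^ k)%N => m; have em : m = (m %/ 2 + m %/ 2 + m %% 2)%N.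
    by rewrite addnn -muln2 -divn_eq.
  rewrite [X in _ - u *+ X]em [in X in _ - X]mulrnDr opprD addrA subrr add0r.
  have : (m %% 2 < 2)%N by rewrite ltn_mod.
  case: (m %% 2)%N => [|[|//]] _; rewrite ?mulr0n ?oppr0 ?mulr1n //.
  exact: nbhs_singleton.
exists (p 0%N); first by apply: (dyadic_compact_chain cS nS cV2) => // k; exact: (hp k).1.
(* For k = 0 the multiple is [u *+ n u], which is outside the neighbourhood [V], so its limit is not
   0. *)
move=> p0; have : closure (~` V) (p 0%N).
  apply: (@ulim_closed _ U UU T (f 0%N)) (hp 0%N).2; first exact: closed_closure.
  apply: filterS (UW V nV) => u [Su _ u0]; apply: subset_closure.
  by rewrite /f expn0 divn1; exact: (hn u Su u0).1.
by rewrite p0 => /(_ V nV)[x [nVx Vx]].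
Qed.

(** For closedness, take elements y of [dyadic S] tending to [x]. Halving keeps the norm of their
    chains below max r c, so these chains stay in one compact set and their ultralimits form a chain
    for [x]. *)
Lemma dyadic_coarse_norm S : is_subgroup S -> closed S -> nobdd S ->
  closed (dyadic S) /\ exists h c, coarse_norm (dyadic S) h c.
Proof.
move=> sS cS nS.
have [G [h [c [[sG GS] GW _ hc]]]] := coarse_norm_exists lT sS cS (@compact0 T).
have DG : dyadic S `<=` G by exact: dyadic_relopen.
split; last by exists h, c; exact: coarse_normS hc.
case: (hc) => _ h2 _ h4 h5.
move=> x clx.
have [K0 nK0 cK0] := lT.2 x.
have [r hr] := h5 K0 cK0; have [K1 cK1 hK1] := h4 (maxn r c).
have /choice[D hD] : forall y, exists u : nat -> T, dyadic S y ->
    [/\ u 0%N = y, forall k, dyadic S (u k) & forall k, u k.+1 *+ 2 = u k].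
  move=> y; have [[u [u0 Su hu lu]]|ny] := pselect (dyadic S y); last by exists (fun=> 0).
  exists u => _; split=> // k; exists (fun j => u (k + j)%N); split.
  - by rewrite addn0.
  - by move=> j; exact: Su.
  - by move=> j; rewrite addnS.
  - by move=> W /lu[k0 hk]; exists k0 => j jk; apply: hk; rewrite (leq_trans jk) // leq_addl.
have DK k y : dyadic S y -> K0 y -> K1 (D y k).
  move=> Dy Ky; have [D0 DD D2] := hD y Dy; apply: hK1; first exact: DG.
  elim: k => [|k ih]; first by rewrite D0 (leq_trans (hr y _ Ky)) ?leq_maxl //; exact: DG.
  by have := h2 _ (DG _ (DD k.+1)); rewrite D2; lia.
have PF : ProperFilter (within (dyadic S) (nbhs x)) by exact: (@within_nbhs_proper _ _ _ (inferP clx)).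
have [U [UU FU]] := ultraFilterLemma PF.
have UD : U (dyadic S) by apply: FU; exact: withinT.
have UN W : nbhs x W -> U W by move=> nW; apply: FU; exact: (@cvg_within _ (nbhs x) _ (dyadic S)).
have /choice[p hp] : forall k, exists p, K1 p /\ ulim U (fun y => D y k) p.
  move=> k; have [|p K1p lp] := @ulim_exists _ U UU T (fun y => D y k) K1 cK1.
    by apply: filterS (filterI UD (UN _ nK0)) => y [Dy Ky]; exact: DK.
  by exists p.
have Sp k : S (p k).
  apply: (@ulim_closed _ U UU T (fun y => D y k)) (hp k).2 => //.
  by apply: filterS UD => y /hD[_ /(_ k) /dyadic_sub].
have p2 k : p k.+1 *+ 2 = p k.
  rewrite mulr2n; apply: (@ulim_eq _ U UU T (fun y => D y k.+1 + D y k.+1) (fun y => D y k)).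
  - exact: LC_closed1.
  - by apply: ulimD; exact: (hp _).2.
  - exact: (hp _).2.
  move=> W nW; apply: filterS UD => y /hD[_ _ D2] /=.
  by rewrite -mulr2n D2 !subrr; exact: nbhs_singleton.
have -> : x = p 0%N.
  apply: (@ulim_eq _ U UU T id (fun y => D y 0%N)) (hp 0%N).2 _.
  - exact: LC_closed1.
  - move=> W nW; apply: UN; apply/nbhs_at0P; apply: filterS nW => w /=.
    by rewrite addrC addKr.
  move=> W nW; apply: filterS UD => y /hD[D0 _ _] /=.
  by rewrite D0 !subrr; exact: nbhs_singleton.
by apply: (dyadic_compact_chain cS nS cK1) => // k; exact: (hp k).1.
Qed.

End Dyadic.

Section Expansion.
Variables (T : topologicalZmodType) (lT : LCA T) (L : set T) (h : T -> nat) (c : nat).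
Hypotheses (sL : is_subgroup L) (cL : closed L) (hc : coarse_norm L h c).
Hypothesis halfL : forall x, L x -> exists2 y, L y & y *+ 2 = x.

Lemma half_fun : exists d : T -> T, forall x, L x -> L (d x) /\ d x *+ 2 = x.
Proof.
suff /choice[d hd] : forall x, exists y, L x -> L y /\ y *+ 2 = x by exists d.
move=> x; have [Lx|nLx] := pselect (L x); last by exists 0.
by have [y Ly yx] := halfL Lx; exists y.
Qed.

Lemma chain_errors (V : set T) : compact V -> exists r, forall v w,
  V v -> V w -> L (w - v *+ 2) -> (h (w - v *+ 2)%R <= r)%N.
Proof.
move=> cV; case: hc => _ _ _ _ h5.
have [|r hr] := h5 (sums V [set y | exists2 v, V v & y = - (v *+ 2)]).
  apply: compact_sums => //.
  have -> : [set y | exists2 v, V v & y = - (v *+ 2)] = [set y | ((fun x => x *+ 2) @` V) (- y)].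
    apply/seteqP; split=> y /=; first by move=> [v Vv ->]; exists v => //; rewrite opprK.
    by move=> [v Vv e]; exists v => //; rewrite e opprK.
  by apply: compact_opp; apply: compact_image => //; exact: continuous_mulrn.
by exists r => v w Vv Vw Lvw; apply: hr => //; apply: sumsP => //; exists v.
Qed.

(* The correction [e] solves [2 ^ i (x + e) = v_i + g_i] with [g_i] bounded, where
   [v_i] represents [2 ^ i x] modulo [L]: halving contracts the coarse norm. *)
Lemma bdd_correction (V : set T) x : compact V ->
  (forall n, sums V L (x *+ 2 ^ n)) -> exists2 e, L e & bdd (x + e).
Proof.
move=> cV hx; have [d hd] := half_fun.
have /choice[v hv] : forall n, exists v, V v /\ L (x *+ 2 ^ n - v).
  by move=> n; have [v Vv Lv] := hx n; exists v.
have [r hr] := chain_errors cV.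
pose l n := v n.+1 - v n *+ 2.
have Ll n : L (l n).
  have -> : l n = (x *+ 2 ^ n - v n) *+ 2 - (x *+ 2 ^ n.+1 - v n.+1).
    by rewrite expnSr mulrnA /l; move: (x *+ _) => a; zmod.
  by apply: sL.2; [apply: subgroupMn|]; rewrite //; exact: (hv _).2.
have hl n : (h (l n) <= r)%N by apply: hr; [exact: (hv _).1|exact: (hv _).1|exact: Ll].
(* The ideal correction would be the sum of the l (i + j) / 2^(j+1). Halves are chosen, not unique,
   so the series is cut after [m] terms and compactness gives the limit. *)
pose fix g (m i : nat) {struct m} : T := if m is m'.+1 then d (l i + g m' i.+1) else 0.
have Lg m i : L (g m i).
  elim: m i => [|m ih] i /=; first exact: sL.1.
  by apply: (hd _ _).1; exact: subgroupD.
have g2 m i : g m.+1 i *+ 2 = l i + g m i.+1 by apply: (hd _ _).2; exact: subgroupD.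
case: (hc) => h1 h2 _ h4 _.
(* Stable under the recursion: 2 h (g) <= h (l) + h (g') + 2 c <= r + 2 c + c3 <= 2 c3; the summand
   [h 0] starts the induction. *)
pose c3 := (h 0%R + r + 2 * c)%N.
have hg m i : (h (g m i) <= c3)%N.
  elim: m i => [|m ih] i; first by rewrite /c3 /=; lia.
  have := h2 _ (Lg m.+1 i); rewrite g2.
  have := h1 _ _ (Ll i) (Lg m i.+1); have := hl i; have := ih i.+1; rewrite /c3.
  by move: (h (g m.+1 i)) (h (g m i.+1)) (h (l i)) (h (l i + g m i.+1)%R) (h 0%R); lia.
have [K cK hK] := h4 c3.
pose X := sums V K; have cX : compact X by exact: compact_sums.
have vg i m j : (j <= m)%N -> (v i + g m i) *+ 2 ^ j = v (i + j)%N + g (m - j)%N (i + j)%N.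
  elim: j i m => [|j ih] i m; first by rewrite expn0 mulr1n addn0 subn0.
  case: m => // m jm; rewrite expnS mulrnA [(v i + _) *+ 2]mulrnDl g2.
  have -> : v i *+ 2 + (l i + g m i.+1) = v i.+1 + g m i.+1 by rewrite /l; zmod.
  by rewrite ih // addSnnS subSS.
pose C m := [set y | L (y - v 0%N) /\ forall i, (i <= m)%N -> X (y *+ 2 ^ i)].
have [| | | |y Xy hy] := @compact_directed_cap T X nat setT C cX.
- by exists 0%N.
- move=> i j _ _; exists (maxn i j); split=> // t [St ht]; split=> // k li; apply: ht.
    by apply: leq_trans li _; exact: leq_maxl.
  by apply: leq_trans li _; exact: leq_maxr.
- move=> m _; apply: (@closedI _ [set y : T | L (y - v 0%N)]
    (\bigcap_(j in [set j | (j <= m)%N]) [set t : T | X (t *+ 2 ^ j)])).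
    apply: preimage_closed => // y _.
    have -> : (fun y : T => y - v 0%N) = (fun y => - v 0%N + y).
      by apply/funext => z; rewrite addrC.
    exact: continuous_addr.
  by apply: closed_bigI => j _; apply: closed_mulrn; exact: (LC_compact_closed lT).
- move=> m _; exists (v 0%N + g m 0%N).
    by apply: sumsP; [exact: (hv _).1|apply: hK].
  split; first by rewrite addrC addKr.
  move=> i im; rewrite vg // add0n; apply: sumsP; first exact: (hv _).1.
  exact: hK.
exists (y - x); last first.
  rewrite addrC subrK; exists X => // n.
  by have [_] := hy n I; apply.
have -> : y - x = (y - v 0%N) - (x - v 0%N) by zmod.
apply: sL.2; first by case: (hy 0%N I).
by have := (hv 0%N).2; rewrite expn0 mulr1n.
Qed.

(** The deviations [e n] of the orbit from its representatives in [V] have bounded norm. Since their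
    norm nearly doubles at each step, already h (e 0) <= c2, a bound independent of [y]. *)
Lemma bdd_compact (V : set T) : compact V -> exists2 K : set T, compact K &
  forall y, (forall n, sums V L (y *+ 2 ^ n)) -> bdd y -> K y.
Proof.
move=> cV; have [r hr] := chain_errors cV; case: (hc) => h1 h2 h3 h4 h5.
pose c2 := (r + 3 * c)%N.
have [K cK hK] := h4 c2.
exists (sums V K); first exact: compact_sums.
move=> y hy [Y cY Yy].
have /choice[v hv] : forall n, exists v, V v /\ L (y *+ 2 ^ n - v).
  by move=> n; have [v Vv Lv] := hy n; exists v.
pose e n := y *+ 2 ^ n - v n.
have [R hR] : exists R, forall n, (h (e n) <= R)%N.
  have [|R hR] := h5 (sums Y [set x | V (- x)]).
    by apply: compact_sums => //; exact: compact_opp.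
  exists R => n; apply: hR; first exact: (hv n).2.
  by apply: sumsP => //=; rewrite opprK; exact: (hv n).1.
have grow n : (2 * h (e n) <= h (e n.+1) + c2)%N.
  have ee : e n *+ 2 = e n.+1 + (v n.+1 - v n *+ 2).
    by rewrite /e expnSr mulrnA; move: (y *+ _) => a; zmod.
  have Ld : L (v n.+1 - v n *+ 2).
    have -> : v n.+1 - v n *+ 2 = e n *+ 2 - e n.+1 by rewrite ee; zmod.
    by apply: sL.2; [apply: subgroupMn => //|]; exact: (hv _).2.
  have := h2 _ (hv n).2; rewrite -/(e n) ee.
  have := h1 _ _ (hv n.+1).2 Ld; rewrite -/(e n.+1).
  have := hr _ _ (hv n).1 (hv n.+1).1 Ld; rewrite /c2.
  by move: (h (e n)) (h (e n.+1)) (h (v n.+1 - v n *+ 2)%R)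
    (h (e n.+1 + (v n.+1 - v n *+ 2))%R); lia.
have e0 : (h (e 0%N) <= c2)%N.
  rewrite leqNgt; apply/negP => lt.
  have gr n : (c2 + n.+1 <= h (e n))%N.
    elim: n => [|n ih]; first by rewrite addn1.
    by have := grow n; move: ih; lia.
  by have := leq_trans (gr R) (hR R); lia.
exists (v 0%N); first exact: (hv _).1.
have := hK (e 0%N) (hv 0%N).2 e0.
by rewrite /e expn0 mulr1n.
Qed.

End Expansion.

Section BddModule.
Variables (A T : topologicalZmodType) (act : A -> T -> T).
Hypothesis lT : LC_module act.

Lemma bdd_act a x : bdd x -> bdd (act a x).
Proof.
move=> [K cK hK]; exists [set y | K (act (- a) y)].
  exact: (compact_act_pre lT).
by move=> n; rewrite /= -(actMn lT) (actK lT).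
Qed.

Lemma submod_bdd (S : set T) : submod act S -> submod act [set x | S x /\ bdd x].
Proof.
move=> [sS aS]; split; first exact: subgroup_bdd.
by move=> a x [Sx bx]; split; [exact: aS|exact: bdd_act].
Qed.

Lemma submod_dyadic (S : set T) : submod act S -> submod act (dyadic S).
Proof.
move=> [sS aS]; split; first exact: subgroup_dyadic.
move=> a x [u [u0 Su hu lu]]; exists (fun k => act a (u k)); split.
- by rewrite u0.
- by move=> k; exact: aS.
- by move=> k; rewrite -(actMn lT) hu.
- by move=> W nW; have [k0 hk] := lu _ (nbhs0_act lT a nW); exists k0.
Qed.

(** Bounded elements of [G] have norm at most [c], so the closure of their group is a compact group
    and consists of bounded elements; a closure point differs from a bounded element by a member of
    it. *)
Lemma closed_bdd (S : set T) : is_subgroup S -> closed S -> closed [set x | S x /\ bdd x].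
Proof.
move=> sS cS; set B := [set x | _].
have [G [h [c [[sG GS] [W nW GW] _ hc]]]] := coarse_norm_exists lT.1 sS cS (@compact0 T).
have sB : is_subgroup B by exact: subgroup_bdd.
have sBG : is_subgroup (B `&` G).
  split; first by split; [exact: sB.1|exact: sG.1].
  by move=> x y [? ?] [? ?]; split; [exact: sB.2|exact: sG.2].
case: (hc) => _ _ _ h4 _; have [K cK hK] := h4 c.
have cBG : compact (closure (B `&` G)).
  apply: (compact_subset_closure lT.1 cK) => x [[Sx bx] Gx]; apply: hK => //.
  exact: coarse_norm_bdd hc _ _.
have scl := subgroup_closure sBG.
move=> x clx; have Sx : S x by apply: cS; apply: closureS clx => y [].
have [V [nV sV hV]] := nbhs0D nW.
move/closureP: (clx) => /(_ W nW)[b [Sb bb] Wb].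
have Gxb : G (x - b) by apply: GW => //; exact: sS.2.
suff hb : bdd (x - b).
  by split=> //; rewrite -(subrK b x); exact: bddD.
apply: (compact_subgroup_bdd scl cBG); apply/closureP => W' nW'.
move/closureP: clx => /(_ _ (filterI nW nW'))[b' [Sb' bb'] [Wb' W'b']].
exists (b' - b).
  split; first by split; [exact: sS.2|exact: bddB].
  have -> : b' - b = (x - b) - (x - b') by zmod.
  by apply: sG.2 => //; apply: GW => //; exact: sS.2.
by have -> : x - b - (b' - b) = x - b' by zmod.
Qed.

End BddModule.

Section BddQuotient.
Variables (A T Q : topologicalZmodType) (act : A -> T -> T) (actQ : A -> Q -> Q).
Variables (lT : LC_module act).

(** Lift a bounded orbit to representatives in a compact [V], choosing [G] to contain V and S. They
    differ from the orbit of [v0] by bounded elements of [G], which lie in one compact set, so [v0]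
    and with it [x] is bounded. *)
Lemma nobdd_bdd_quotient (S : set T) (p : T -> Q) : is_subgroup S -> closed S ->
  quotient_map act actQ [set x | S x /\ bdd x] p -> nobdd (p @` S).
Proof.
move=> sS cS qp _ [x Sx <-] [K cK hK]; set B := [set x | _] in qp.
have sB : is_subgroup B by exact: subgroup_bdd.
have [V cV KV] := qmap_compact_lift qp lT.1 cK.
have hx n : sums V B (x *+ 2 ^ n).
  have [v Vv pv] := KV _ (hK n); exists v => //.
  by apply/(qmap_eq qp); rewrite (qmapMn qp).
have [G [h [c [[sG GS] _ GV hc]]]] := coarse_norm_exists lT.1 sS cS cV.
case: (hc) => _ _ _ h4 _; have [K1 cK1 hK1] := h4 c.
have := hx 0%N; rewrite expn0 mulr1n => -[v0 Vv0 Bv0].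
have Sv v y : S y -> B (y - v) -> S v.
  move=> Sy [Syv _]; have -> : v = y - (y - v) by zmod.
  exact: sS.2.
have Gv0 : G v0 by apply: GV => //; exact: Sv Sx Bv0.
have bv0 : bdd v0.
  exists (sums V K1); first exact: compact_sums.
  move=> n; have [v Vv Bv] := hx n.
  have Gv : G v by apply: GV => //; apply: Sv Bv; exact: subgroupMn.
  have Bd : B (v0 *+ 2 ^ n - v).
    have -> : v0 *+ 2 ^ n - v = (x *+ 2 ^ n - v) - (x - v0) *+ 2 ^ n.
      by rewrite mulrnBl; move: (x *+ _) (v0 *+ _) => a b; zmod.
    by apply: sB.2 => //; exact: subgroupMn.
  exists v => //; have Gd : G (v0 *+ 2 ^ n - v) by apply: sG.2 => //; exact: subgroupMn.
  by apply: hK1 => //; apply: coarse_norm_bdd hc _ _ => //; case: Bd.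
apply/(qmap_ker qp); split=> //.
by rewrite -(subrK v0 x); apply: bddD => //; case: Bv0.
Qed.

End BddQuotient.

Section DyadicOpen.
Variables (A T : topologicalZmodType) (act : A -> T -> T).
Hypothesis lT : LC_module act.

(* Otherwise the quotient by the dyadic part would contain a nonzero dyadic chain,
   which can be lifted by correcting it along the dyadic part. *)
Lemma dyadic_open (S : set T) : submod act S -> closed S -> nobdd S ->
  exists2 W, nbhs 0 W & forall x, S x -> W x -> dyadic S x.
Proof.
move=> sS cS nS; have smD := submod_dyadic lT sS; pose H := dyadic S.
have [cH [h [c hc]]] := dyadic_coarse_norm lT.1 sS.1 cS nS.
have halfH x : H x -> exists2 y, H y & y *+ 2 = x by exact: dyadic_half.
have [d hd] := half_fun halfH.
have [Q [actQ [p [lQ qp]]]] := quotient_exists lT smD cH.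
pose S' := p @` S.
have sS' : is_subgroup S' by apply: (qmap_subgroup_image qp); exact: sS.1.
have HS : H `<=` S by exact: dyadic_sub.
have cS' : closed S'.
  apply: (qmap_closed_image qp) => // x n Sx /HS Sn.
  by apply: subgroupD => //; exact: sS.1.
(* [bdd_correction] lifts a bounded class to a bounded element of [S], which is 0. *)
have nS' : nobdd S'.
  move=> _ [x Sx <-] [K cK hK].
  have [V cV KV] := qmap_compact_lift qp lT.1 cK.
  have [|e He be] := bdd_correction lT.1 smD.1 cH hc halfH (x := x) cV.
    move=> n; have [v Vv pv] := KV _ (hK n); exists v => //.
    by apply/(qmap_eq qp); rewrite (qmapMn qp).
  apply/(qmap_ker qp).
  have /eqP : x + e = 0.
    by apply: nS => //; apply: subgroupD => //; [exact: sS.1|exact: HS].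
  by rewrite addr_eq0 => /eqP ->; apply: subgroupN => //; exact: smD.1.
apply: contrapT => nopen.
have [|_ [s [<- Ss hs ls]] s0] := dyadic_exists lQ.1 sS' cS' nS'.
  move=> W nW; apply: contrapT => hW; apply: nopen.
  exists [set x | W (p x)]; first exact: (qmap_nbhs0_pre qp).
  move=> x Sx Wx; apply: contrapT => nx; apply: hW; exists (p x); split=> //.
    by exists x.
  by move=> /(qmap_ker qp).
have [V0 [cV0 nV0 _ _]] := LC_compact_nbhs lQ.1 (@compact0 Q).
have [k0 hk0] := ls V0 nV0.
have cs : compact (V0 `|` [set s k | k in `I_k0]).
  by apply: compactU => //; apply: finite_compact; apply: finite_image; exact: finite_II.
have [V cV KV] := qmap_compact_lift qp lT.1 cs.
have /choice[w hw] : forall k, exists w, [/\ V w, S w & p w = s k].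
  move=> k; have [|v Vv pv] := KV (s k).
    by have [kk|kk] := leqP k0 k; [left; exact: hk0|right; exists k].
  exists v; split=> //; have [x Sx px] := Ss k.
  rewrite -(subrK x v); apply: subgroupD => //; first exact: sS.1.
  by apply: HS; apply/(qmap_eq qp); rewrite pv.
have Hl k : H (w k.+1 *+ 2 - w k).
  have [_ _ pw] := hw k; have [_ _ pw1] := hw k.+1.
  by apply/(qmap_eq qp); rewrite (qmapMn qp) pw pw1 hs.
case: (hc) => h1 h2 h3 h4 h5.
have [r hr] : exists r, forall k, (h (w k.+1 *+ 2 - w k)%R <= r)%N.
  have [|r hr] := h5 (sums ((fun x => x *+ 2) @` V) [set x | V (- x)]).
    apply: compact_sums; last exact: compact_opp.
    by apply: compact_image => //; exact: continuous_mulrn.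
  exists r => k; apply: hr; first exact: Hl.
  apply: sumsP.
    by exists (w k.+1) => //; case: (hw k.+1).
  by rewrite /= opprK; case: (hw k).
(* Makes w k + e k a genuine chain of halves. Halving within [H] keeps the norm of [e] below [c3],
   and e 0 = 0 preserves the lift of the nonzero class [s 0]. *)
pose fix e (k : nat) : T := if k is k'.+1 then d (e k' - (w k'.+1 *+ 2 - w k')) else 0.
have He k : H (e k).
  elim: k => [|k ih]; first exact: smD.1.1.
  by apply: (hd _ _).1; apply: smD.1.2; [exact: ih|exact: Hl].
have e2 k : e k.+1 *+ 2 = e k - (w k.+1 *+ 2 - w k) by apply: (hd _ _).2; apply: smD.1.2; [exact: He|exact: Hl].
pose c3 := (h 0%R + r + 3 * c)%N.
have he k : (h (e k) <= c3)%N.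
  elim: k => [|k ih]; first by rewrite /c3 /=; lia.
  have := h2 _ (He k.+1); rewrite e2.
  have := h1 _ _ (He k) (subgroupN smD.1 (Hl k)).
  have := h3 _ (Hl k); have := hr k; move: ih; rewrite /c3.
  move: (h (e k.+1)) (h (e k)) (h 0%R) (h (w k.+1 *+ 2 - w k)%R)
    (h (- (w k.+1 *+ 2 - w k))%R) (h (e k - (w k.+1 *+ 2 - w k))%R); lia.
have [K cK hK] := h4 c3.
have : dyadic S (w 0%N + e 0%N).
  apply: (@dyadic_compact_chain _ lT.1 S (sums V K) (fun k => w k + e k)) => //.
  - exact: compact_sums.
  - by move=> k; apply: subgroupD => //; [exact: sS.1|case: (hw k)|exact: HS].
  - by move=> k; apply: sumsP; [case: (hw k)|apply: hK; [exact: He|exact: he]].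
  - by move=> k; rewrite mulrnDl e2; zmod.
rewrite addr0 => /(qmap_ker qp); have [_ _ ->] := hw 0%N; exact: s0.
Qed.

End DyadicOpen.

Section OpenSubgroups.
Variables (T : topologicalZmodType) (lT : LCA T) (N : set T).
Hypotheses (sN : is_subgroup N) (cN : closed N).

Definition relnbhs (J : set T) : Prop := exists2 W, nbhs 0 W & forall x, N x -> W x -> J x.
Definition open_subgroup (J : set T) : Prop := [/\ is_subgroup J, J `<=` N & relnbhs J].
(** The identity component of [N], in a form that avoids connectedness. *)
Definition open_core : set T := [set x | N x /\ forall J, open_subgroup J -> J x].

Lemma open_subgroup_closed J : open_subgroup J -> closed J.
Proof. by move=> [sJ JN [W nW hW]]; exact: closed_relopen_subgroup hW. Qed.

Lemma open_subgroupI J J' : open_subgroup J -> open_subgroup J' -> open_subgroup (J `&` J').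
Proof.
move=> [s1 i1 [W1 n1 h1]] [s2 i2 [W2 n2 h2]]; split.
- split; first by split; [exact: s1.1|exact: s2.1].
  by move=> x y [? ?] [? ?]; split; [exact: s1.2|exact: s2.2].
- by move=> x [/i1].
- exists (W1 `&` W2); first exact: filterI.
  by move=> x Nx [? ?]; split; [exact: h1|exact: h2].
Qed.

Lemma open_subgroup_self : open_subgroup N.
Proof. by split=> //; exists setT; [exact: filterT|]. Qed.

Lemma subgroup_open_core : is_subgroup open_core.
Proof.
split; first by split; [exact: sN.1|move=> J [sJ _ _]; exact: sJ.1].
move=> x y [Nx hx] [Ny hy]; split; first exact: sN.2.
by move=> J oJ; case: (oJ) => sJ _ _; apply: sJ.2; [exact: hx|exact: hy].
Qed.

Lemma closed_open_core : closed open_core.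
Proof.
apply: (@closedI _ N (\bigcap_(J in open_subgroup) J)) => //.
by apply: closed_bigI => J; exact: open_subgroup_closed.
Qed.

(* As in van Dantzig's theorem, the stabilizer of a compact open set containing 0 is a compact
   open subgroup. *)
Lemma open_core_discrete W : nbhs 0 W -> (forall x, open_core x -> W x -> x = 0) ->
  exists2 O, open_subgroup O & compact O.
Proof.
move=> nW hW; have [V [cV nV sV VW]] := LC_compact_nbhs_in lT nW.
(* The boundary of [V] contains no point of the core, so it misses some open subgroup [J]; then V
   and J is both compact and relatively open. *)
have [| | | |x VDx hx|J oJ hJ] := @compact_directed_cap_sub T (V `\` V°) (set T)
   open_subgroup id set0.
- by rewrite setDE; apply: compact_closedI => //; apply: open_closedC; exact: open_interior.
- by exists N; exact: open_subgroup_self.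
- move=> J J' oJ oJ'; exists (J `&` J'); split; first exact: open_subgroupI.
    exact: subIsetl.
  exact: subIsetr.
- by move=> J; exact: open_subgroup_closed.
- exfalso; case: VDx => Vx; apply; have -> // : x = 0.
  apply: hW; last exact: VW.
  by split; [exact: (hx N open_subgroup_self)|exact: hx].
case: (oJ) => sJ JN [WJ nWJ hWJ].
pose K := V `&` J; have cK : compact K.
  by apply: compact_closedI => //; exact: open_subgroup_closed.
have KI x : K x -> V° x.
  by move=> [Vx Jx]; apply: contrapT => nI; exact: (hJ x).
have K0 : K 0 by split; [exact: nbhs_singleton|exact: sJ.1].
pose O := [set x | N x /\ forall y, K y -> K (x + y) /\ K (- x + y)].
have OK : O `<=` K by move=> x [_ /(_ 0 K0)[]]; rewrite addr0.
have oO : open_subgroup O.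
  split; [|by move=> x []|].
    split; first by split; [exact: sN.1|move=> y Ky; rewrite oppr0 add0r].
    move=> x y [Nx hx] [Ny hy]; split; first exact: sN.2.
    move=> z Kz; rewrite opprB -!addrA; split.
      by apply: (hx _ _).1; exact: (hy _ _).2.
    by apply: (hy _ _).1; exact: (hx _ _).2.
  have [y Ky|W1 nW1 hW1] := @compact_tube T T K 0 (fun y x => V (x + y)) cK.
    have := @add_continuous T (0, y) V; rewrite /= add0r => /(_ (KI y Ky))[[U1 U2] /= [n1 n2] hU].
    by exists U2, U1; split=> // y' x Uy Ux; exact: (hU (x, y')).
  exists (WJ `&` (W1 `&` [set x | W1 (- x)])).
    by do 2?apply: filterI => //; exact: nbhs0_opp.
  move=> x Nx [WJx [W1x W1nx]]; have Jx := hWJ x Nx WJx; split=> // y [Vy Jy].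
  split; split; [exact: hW1|exact: subgroupD|exact: hW1|].
  by apply: subgroupD => //; exact: subgroupN.
exists O => //; apply: (subclosed_compact _ cK) => //.
exact: open_subgroup_closed.
Qed.

End OpenSubgroups.

(** * Contractions in modules with a compact open subgroup *)

Section Critical.
Variable A : zmodType.

Definition adjoin (B : set A) (a : A) : set A := sums B [set x | exists n : int, x = a *~ n].

Lemma subgroup_adjoin B a : is_subgroup B -> is_subgroup (adjoin B a).
Proof.
move=> sB; apply: subgroup_sums => //; split; first by exists 0; rewrite mulr0z.
by move=> _ _ [n ->] [m ->]; exists (n - m); rewrite mulrzBr.
Qed.

Lemma adjoin_sub B a : B `<=` adjoin B a.
Proof. by move=> b Bb; exists b => //; exists 0; rewrite subrr mulr0z. Qed.

(* Adding generators one at a time isolates a single [a] responsible for the failure of [P]. *)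
Lemma critical_subgroup (P : set A -> Prop) (A0 : set A) (s : seq A) :
  is_subgroup A0 -> P A0 ->
  (forall B, is_subgroup B -> A0 `<=` B -> (forall a, a \in s -> B a) -> ~ P B) ->
  exists B a, [/\ is_subgroup B, A0 `<=` B, P B & ~ P (adjoin B a)].
Proof.
elim: s A0 => [|a s ih] A0 sA0 PA0 hP; first by case: (hP A0 sA0).
have [Pa|nPa] := pselect (P (adjoin A0 a)); last by exists A0, a; split.
have [|B [b [sB AB PB nPB]]] := ih _ (subgroup_adjoin a sA0) Pa.
  move=> B sB AB Bs; apply: hP => //; first by move=> c Ac; apply: AB; exact: adjoin_sub.
  move=> c; rewrite inE => /predU1P[->|/Bs//]; apply: AB.
  by exists 0; [exact: sA0.1|exists 1; rewrite subr0 mulr1z].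
by exists B, b; split=> // c Ac; apply: AB; exact: adjoin_sub.
Qed.

End Critical.

Section Stabilizer.
Variables (A M : topologicalZmodType) (act : A -> M -> M).
Hypotheses (lM : LC_module act) (gA : compactly_generated A).
Variables (N O : set M).
Hypotheses (sN : submod act N) (oO : open_subgroup N O) (cO : compact O).

(** The stabilizer of the compact open [O] is open in [A], so finitely many of its translates cover
    a compact generating set. *)
Lemma stabilizer_cofinite : exists (A0 : set A) (s : seq A),
  [/\ is_subgroup A0, forall a x, A0 a -> O x -> O (act a x) &
      forall B, is_subgroup B -> A0 `<=` B -> (forall a, a \in s -> B a) -> B = setT].
Proof.
case: oO => sO ON [W nW hW].
pose A0 := [set a | (forall x, O x -> O (act a x)) /\ (forall x, O x -> O (act (- a) x))].
have sA0 : is_subgroup A0.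
  split; first by split=> x Ox; rewrite ?oppr0 (act0 lM).
  move=> a b [a1 a2] [b1 b2]; split=> x Ox; rewrite ?opprB (actA lM); first exact/a1/b2.
  exact/b1/a2.
have [x Ox|Wa nWa hWa] := @compact_tube M A O 0 (fun x a => W (act a x - x)) cO.
  have [V [nV sV hV]] := nbhs0D nW.
  have nb : nbhs (act 0 x) [set y | V (y - x)].
    rewrite (act0 lM); apply/nbhs_at0P; apply: filterS nV => w /=.
    by rewrite addrC addKr.
  have [[U1 U2] /= [n1 n2] hU] := @act_cont _ _ _ lM (0, x) _ nb.
  exists (U2 `&` [set y | V (y - x)]), U1; split=> //.
    apply: filterI => //; apply/nbhs_at0P; apply: filterS nV => w /=.
    by rewrite addrC addKr.
  move=> y a [U2y Vy] U1a.
  have -> : act a y - y = (act a y - x) + - (y - x) by zmod.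
  by apply: hV; [exact: (hU (a, y))|exact: sV].
have A0W a : Wa a -> Wa (- a) -> A0 a.
  have h b x : Wa b -> O x -> O (act b x).
    move=> Wb Ox; rewrite -(subrK x (act b x)); apply: subgroupD => //.
    apply: hW; last exact: hWa.
    by apply: sN.1.2; [apply: sN.2; exact: ON|exact: ON].
  by move=> W1 W2; split=> x; exact: h.
case: gA => K [cK genK].
have [| | |s _ hs] := @compact_directed_cover A K (seq A) setT
   (fun s => [set a | exists2 b, b \in s & A0 (a - b)]) cK.
- by exists [::].
- move=> s1 s2 _ _; exists (s1 ++ s2); split=> // x [b bs Ab]; exists b => //.
    by rewrite mem_cat bs.
  by rewrite mem_cat bs orbT.
- move=> a Ka; exists [:: a] => //; apply/nbhs_at0P.
  have nWa' : nbhs 0 (Wa `&` [set b | Wa (- b)]).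
    by apply: filterI => //; exact: nbhs0_opp.
  apply: filterS nWa' => b [Wb Wnb]; exists a; first by rewrite inE.
  by rewrite addrC addKr; exact: A0W.
exists A0, s; split=> // [a x [+ _]|B sB AB Bs]; first exact.
apply: genK => // a /hs[b bs Ab]; rewrite -(subrK b a); apply: subgroupD => //.
  exact: AB.
exact: Bs.
Qed.

End Stabilizer.

Section Contraction.
Variables (A M : topologicalZmodType) (act : A -> M -> M).
Hypothesis lM : LC_module act.

(** [A] is additive, so [a *+ k] acts as the power a^k. The fourth clause says that the a^k Z
    intersect in 0, and the last that b a^m Z is in [Z] for some m, which makes the union of the
    a^-k Z stable under [A]. *)
Definition contracted (N : set M) (a : A) (Z : set M) : Prop :=
  [/\ is_subgroup Z /\ compact Z, Z `<=` N,
      forall x, Z x -> Z (act a x),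
      forall x, (forall k, Z (act (- (a *+ k)) x)) -> x = 0 &
      forall b, exists m, forall x, Z x -> Z (act (b + a *+ m) x)].

Lemma contracted_pow N a Z k x : contracted N a Z -> Z x -> Z (act (a *+ k) x).
Proof.
move=> [_ _ aZ _ _] Zx; elim: k => [|k ih]; first by rewrite mulr0n (act0 lM).
by rewrite mulrS (actA lM); exact: aZ.
Qed.

Lemma actP a k j x : act (a *+ k) (act (a *+ j) x) = act (a *+ (k + j)) x.
Proof. by rewrite -(actA lM) -mulrnDr. Qed.

Lemma actPV a k j x : act (a *+ k) (act (- (a *+ (k + j))) x) = act (- (a *+ j)) x.
Proof. by rewrite -(actA lM) mulrnDr opprD addrA subrr add0r. Qed.

Hypothesis gA : compactly_generated A.

(** [C B Phi] is a compact group, stable under [B], of elements sent into [O] by [B] and finitely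
    many translates. It is nonzero for B = A0 as [N] is not discrete, and zero for B = A as a
    compact submodule. At the critical step a0, the translates of X = C B Phi under all powers of a0
    intersect in 0. *)
Lemma contraction_exists (N O : set M) : submod act N -> closed N ->
  open_subgroup N O -> compact O ->
  (forall L, submod act L -> L `<=` N -> compact L -> L `<=` [set 0]) ->
  (forall W, nbhs 0 W -> exists x, [/\ N x, W x & x <> 0]) ->
  exists a Z, contracted N a Z /\ exists2 x, Z x & x <> 0.
Proof.
move=> sN cN oO cO ncpt nd; case: (oO) => sO ON [WO nWO hWO].
have clO : closed O by exact: (LC_compact_closed lM.1).
have [A0 [s [sA0 A0O gen]]] := stabilizer_cofinite lM gA sN oO cO.
pose C (B : set A) (Phi : seq A) : set M :=
  [set x | forall b f, B b -> f \in 0 :: Phi -> O (act (b + f) x)].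
have nbPhi (c : A) (Phi : seq A) : nbhs 0 [set x | forall f, f \in Phi -> WO (act (c + f) x)].
  elim: Phi => [|f Phi ih]; first exact: nearW.
  apply: filterS (filterI ih (nbhs0_act lM (c + f) nWO)) => x [h1 h2] g.
  by rewrite inE => /predU1P[->|/h1].
have [| |B [a0 [sB AB PB nPB]]] := @critical_subgroup A
   (fun B => forall Phi, exists2 x, C B Phi x & x <> 0) A0 s sA0.
- move=> Phi; have [x [Nx Wx x0]] := nd _ (nbPhi 0 (0 :: Phi)); exists x => // b f Ab fP.
  rewrite (actA lM); apply: A0O => //; apply: hWO; first exact: sN.2.
  by have := Wx f fP; rewrite add0r.
- move=> B sB AB Bs /(_ [::])[x Cx]; apply.
  have BT := gen B sB AB Bs.
  apply: (ncpt (C B [::])) => //.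
  + split.
      split; first by move=> b f _ _; rewrite (actr0 lM); exact: sO.1.
      by move=> u v hu hv b f Bb fP; rewrite (actB lM); apply: sO.2; [exact: hu|exact: hv].
    move=> a u hu b f Bb fP; rewrite -(actA lM) addrAC.
    by apply: hu => //; rewrite BT.
  + by move=> u hu; apply: ON; have := hu 0 0 sB.1; rewrite addr0 (act0 lM) => /(_ (mem_head _ _)).
  + apply: (subclosed_compact _ cO); last first.
      by move=> u hu; have := hu 0 0 sB.1; rewrite addr0 (act0 lM) => /(_ (mem_head _ _)).
    have -> : C B [::] = \bigcap_(b in B) \bigcap_(f in [set f | f \in [:: 0]]) [set x | O (act (b + f) x)].
      apply/seteqP; split=> u hu; first by move=> b Bb f fP; exact: hu.
      by move=> b f Bb fP; exact: hu.
    apply: closed_bigI => b _; apply: closed_bigI => f _.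
    exact: (closed_act_pre lM).
move: nPB => /existsNP[Phi hPhi].
have {hPhi} C0 x : C (adjoin B a0) Phi x -> x = 0.
  by move=> Cx; apply: contrapT => x0; apply: hPhi; exists x.
pose X := C B Phi.
have X0 x : X x -> O x.
  by move=> hu; have := hu 0 0 sB.1; rewrite addr0 (act0 lM) => /(_ (mem_head _ _)).
have clX : closed X.
  have -> : X = \bigcap_(b in B) \bigcap_(f in [set f | f \in 0 :: Phi]) [set x | O (act (b + f) x)].
    apply/seteqP; split=> u hu; first by move=> b Bb f fP; exact: hu.
    by move=> b f Bb fP; exact: hu.
  apply: closed_bigI => b _; apply: closed_bigI => f _.
  exact: (closed_act_pre lM).
have cX : compact X by apply: (subclosed_compact clX cO).
have sX : is_subgroup X.
  split; first by move=> b f _ _; rewrite (actr0 lM); exact: sO.1.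
  by move=> u v hu hv b f Bb fP; rewrite (actB lM); apply: sO.2; [exact: hu|exact: hv].
have BX b x : B b -> X x -> X (act b x).
  move=> Bb hx c f Bc fP; rewrite -(actA lM) addrAC; apply: hx => //.
  exact: subgroupD.
have Xsat x : (forall b f, B b -> f \in 0 :: Phi -> O (act f (act b x))) -> X x.
  by move=> h b f Bb fP; rewrite addrC (actA lM); exact: h.
pose Z a := [set x | forall k, X (act (a *+ k) x)].
have orb a x : (a = a0 \/ a = - a0) -> (forall k, X (act (a *+ k) x)) ->
    (forall k, X (act (- (a *+ k)) x)) -> x = 0.
  move=> ha h1 h2; apply: C0 => b' f [b Bb [n bn]] fP.
  have -> : b' + f = (b + f) + a0 *~ n by rewrite -bn; zmod.
  rewrite (actA lM).
  suff : X (act (a0 *~ n) x) by apply.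
  case: n bn => n bn; rewrite ?NegzE ?mulrNz -pmulrn; case: ha => ha.
  - by rewrite -ha.
  - by have := h2 n; rewrite ha mulNrn opprK.
  - by rewrite -ha.
  - by have := h1 n.+1; rewrite ha mulNrn.
have Z1 a x : Z a x -> X x by move=> /(_ 0%N); rewrite mulr0n (act0 lM).
have [a ha [z Zz z0]] : exists2 a, a = a0 \/ a = - a0 & exists2 x, Z a x & x <> 0.
  apply: contrapT => hZ.
  have Z0 a x : (a = a0 \/ a = - a0) -> Z a x -> x = 0.
    by move=> ha Zx; apply: contrapT => x0; apply: hZ; exists a => //; exists x.
  (* If [Z a0] is 0, the [Xn] shrink to 0, so one of them is sent into [O] by all -a0 + f. It is
     then stable under -a0, hence contained in Z (- a0) = 0, against [PB] for the translates f + a0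
     k. *)
  pose Xn n := [set x | forall k, (k <= n)%N -> X (act (a0 *+ k) x)].
  have [| | |x Xx hx|n _ hn] := @compact_directed_cap_sub M X nat setT Xn
     [set x | N x -> forall f, f \in 0 :: Phi -> O (act (- a0 + f) x)] cX.
  - by exists 0%N.
  - move=> i j _ _; exists (maxn i j); split=> // x hx k ki; apply: hx.
      by apply: leq_trans ki _; exact: leq_maxl.
    by apply: leq_trans ki _; exact: leq_maxr.
  - move=> i _; apply: (@closed_bigI _ _ [set k | (k <= i)%N] (fun k => [set x | X (act (a0 *+ k) x)])).
    by move=> k _; exact: (closed_act_pre lM).
  - have -> : x = 0 by apply: (Z0 a0); [left|move=> k; exact: (hx k I)].
    apply: filterS (nbPhi (- a0) (0 :: Phi)) => y hy Ny f fP.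
    by apply: hWO; [exact: sN.2|exact: hy].
  have XnB x b : B b -> Xn n x -> Xn n (act b x).
    by move=> Bb hx k kn; rewrite (actC lM); apply: BX => //; exact: hx.
  have XnX x : Xn n x -> X x by move=> /(_ 0%N (leq0n _)); rewrite mulr0n (act0 lM).
  have Xnm x : Xn n x -> Xn n (act (- a0) x).
    move=> hx; case=> [|k] kn; last first.
      rewrite mulrS -(actA lM) addrAC subrr add0r; apply: hx; exact: ltnW.
    rewrite mulr0n (act0 lM); apply: Xsat => b f Bb fP.
    rewrite (actC lM b) -(actA lM) addrC.
    by apply: hn => //; [split; [apply: XnX|]; exact: XnB|apply: sN.2; apply: ON; apply: X0; exact: XnX].
  have [x Cx x0] := PB [seq f + a0 *+ k | f <- 0 :: Phi, k <- iota 0 n.+1].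
  have Xx : Xn n x.
    move=> k kn b f Bb fP; rewrite -(actA lM) -addrA; apply: Cx => //.
    rewrite inE; apply/orP; right; apply/allpairsP; exists (f, k).
    by rewrite mem_iota.
  apply: x0; apply: (Z0 (- a0)); first by right.
  move=> k; apply: XnX; elim: k => [|k ih]; first by rewrite mulr0n (act0 lM).
  by rewrite mulrS (actA lM); exact: Xnm.
exists a, (Z a); split; last by exists z.
have clZ : closed (Z a).
  have -> : Z a = \bigcap_k [set x | X (act (a *+ k) x)].
    by apply/seteqP; split=> x hx k; [move=> _; exact: (hx k)|exact: (hx k I)].
  by apply: closed_bigI => k _; exact: (closed_act_pre lM).
have cZ : compact (Z a) by apply: (subclosed_compact clZ cX) => x; exact: Z1.
have aZ x : Z a x -> Z a (act a x).
  by move=> hx k; rewrite -[a in act a x]mulr1n actP addn1.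
have aZk k x : Z a x -> Z a (act (a *+ k) x).
  by move=> hx j; rewrite actP.
have BZ b x : B b -> Z a x -> Z a (act b x).
  by move=> Bb hx k; rewrite (actC lM); exact: BX.
have Zorb x : (forall k, Z a (act (- (a *+ k)) x)) -> x = 0.
  move=> hx; apply: (orb a) => // k; last exact: Z1.
  by have := hx 0%N k; rewrite mulr0n oppr0 (act0 lM).
split=> //.
- split=> //; split; first by move=> k; rewrite (actr0 lM); exact: sX.1.
  by move=> u v hu hv k; rewrite (actB lM); exact: sX.2.
- by move=> x /Z1 /X0 /ON.
- move=> b.
  (* The a^m Z shrink to 0, so b + f sends one of them into [O] for all f; stability under [B]
     improves [O] to [X], stability under [a] improves [X] to [Z]. *)
  have [| | |x Zx hx|m _ hm] := @compact_directed_cap_sub M (Z a) nat setT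
     (fun m => [set x | Z a (act (- (a *+ m)) x)])
     [set x | N x -> forall f, f \in 0 :: Phi -> O (act (b + f) x)] cZ.
  + by exists 0%N.
  + move=> i j _ _; exists (i + j)%N; split=> // x /= hx.
      by rewrite -(actPV a j) addnC; exact: aZk.
    by rewrite -(actPV a i); exact: aZk.
  + by move=> i _; exact: (closed_act_pre lM).
  + have -> : x = 0 by apply: Zorb => k; exact: (hx k I).
    apply: filterS (nbPhi b (0 :: Phi)) => y hy Ny f fP.
    by apply: hWO; [exact: sN.2|exact: hy].
  have step y : Z a y -> X (act (b + a *+ m) y).
    move=> Zy; apply: Xsat => b' f Bb' fP.
    have -> : act f (act b' (act (b + a *+ m) y)) = act (b + f) (act (a *+ m) (act b' y)).
      by rewrite -!(actA lM); congr (act _ y); move: (a *+ m) => c; zmod.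
    have Zy' := BZ _ _ Bb' Zy.
    apply: hm => //; first by split; [exact: aZk|rewrite /= (actK lM)].
    by apply: ON; apply: X0; apply: Z1; exact: aZk.
  exists m => y Zy k; rewrite (actC lM); apply: step; exact: aZk.
Qed.

End Contraction.

(** * Compact complements *)

Section Absorb.
Variables (A M : topologicalZmodType) (act : A -> M -> M).
Hypothesis lM : LC_module act.

(** Fattening [V] by a compact neighbourhood [W0] gives room to replace the closure of the union by
    the union itself, and then compactness of Vh + Vh and S Vh selects a single [U i]. If the [U i]
    are groups stable under [S], then so is Vh + U i. *)
Lemma compact_absorb (I : Type) (D : set I) (U : I -> set M) (Y V : set M) (S : set A) :
  (exists i, D i) ->
  (forall i j, D i -> D j -> exists k, [/\ D k, U i `<=` U k & U j `<=` U k]) ->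
  (forall i, D i -> U i `<=` Y) ->
  submod act Y -> closed Y -> compact V -> compact S ->
  Y `<=` sums V (closure (\bigcup_(i in D) U i)) ->
  exists (Vh : set M) (i : I),
    [/\ compact Vh /\ Vh `<=` Y, D i,
        Vh 0 /\ (forall x, Vh x -> Vh (- x)),
        (forall x y, Vh x -> Vh y -> sums Vh (U i) (x + y)) /\
        (forall s x, S s -> Vh x -> sums Vh (U i) (act s x)) &
        Y `<=` sums Vh (\bigcup_(i in D) U i)].
Proof.
move=> D0 dir UY sY cY cV cS YV; have sY0 := sY.1.
have [W0 [cW0 nW0 sW0 _]] := LC_compact_nbhs lM.1 (@compact0 M).
pose V' := (V `&` Y) `|` [set 0].
pose V1 := V' `|` [set x | V' (- x)].
have cV' : compact V' by apply: compactU; [exact: compact_closedI|exact: compact_set1].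
have cV1 : compact V1 by apply: compactU => //; exact: compact_opp.
have V'Y : V' `<=` Y by move=> x [[]//|->]; exact: sY0.1.
have V1Y : V1 `<=` Y.
  by move=> x [/V'Y//|/V'Y/= Yx]; rewrite -[x]opprK; exact: subgroupN.
have sV1 x : V1 x -> V1 (- x) by move=> [h|h]; [right; rewrite /= opprK|left].
pose Uu := \bigcup_(i in D) U i.
have UuY : Uu `<=` Y by move=> x [i Di Ux]; exact: UY Ux.
have cUY : closure Uu `<=` Y by move=> x cx; apply: cY; exact: closureS cx.
have YV1 x : Y x -> exists2 v, V1 v & closure Uu (x - v).
  move=> Yx; have [v Vv cv] := YV x Yx; exists v => //; left; left; split=> //.
  by have -> : v = x - (x - v) by [zmod]; apply: sY0.2 => //; exact: cUY.
pose Vh := sums V1 W0 `&` Y.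
have cVh : compact Vh by apply: compact_closedI => //; exact: compact_sums.
have VhY : Vh `<=` Y by move=> x [].
have W00 : W0 0 by exact: nbhs_singleton.
have sVh x : Vh x -> Vh (- x).
  move=> [[v Vv Wv] Yx]; split; last exact: subgroupN.
  by exists (- v); [exact: sV1|rewrite -opprD; exact: sW0].
have near x : Y x -> exists v i u W, [/\ V1 v, D i, U i u, nbhs 0 W &
    forall w, W w -> W0 (x + w - v - u)].
  move=> Yx; have [v V1v /closureP cv] := YV1 x Yx.
  have [W [nW sW hW]] := nbhs0D nW0.
  have [u [i Di Uu'] Wu] := cv W nW; exists v, i, u, W; split=> // w Ww.
  have -> : x + w - v - u = (x - v - u) + w by zmod.
  exact: hW.
have fit v u x : V1 v -> Uu u -> Y x -> W0 (x - v - u) -> Vh (x - u).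
  move=> V1v Uuu Yx Ww; split; last by apply: sY0.2 => //; exact: UuY.
  by exists v => //; rewrite addrAC.
have YVh : Y `<=` sums Vh Uu.
  move=> x Yx; have [v [i [u [W [V1v Di Ui nW hW]]]]] := near x Yx.
  have Uuu : Uu u by exists i.
  exists (x - u); last by rewrite opprB addrC subrK.
  by apply: (fit v) => //; have := hW 0 (nbhs_singleton nW); rewrite addr0.
pose T := sums Vh Vh `|` [set x | exists s v, [/\ S s, Vh v & x = act s v]].
have cT : compact T.
  by apply: compactU; [exact: compact_sums|exact: (compact_act_image lM)].
have TY : T `<=` Y.
  move=> x [[v /VhY Yv /VhY Yxv]|[s [v [_ /VhY Yv ->]]]]; last exact: sY.2.
  by rewrite -(subrK v x); exact: subgroupD.
have [| |i Di hi] := @compact_directed_cover M T I D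
   (fun i => [set x | exists v u, [/\ V1 v, U i u & W0 (x - v - u)]]) cT D0.
- move=> i j Di Dj; have [k [Dk ik jk]] := dir i j Di Dj; exists k; split=> //.
    by move=> x [v [u [V1v /ik Uu' Ww]]]; exists v, u.
  by move=> x [v [u [V1v /jk Uu' Ww]]]; exists v, u.
- move=> x /TY Yx; have [v [i [u [W [V1v Di Ui nW hW]]]]] := near x Yx.
  exists i => //; apply/nbhs_at0P; apply: filterS nW => w Ww.
  by exists v, u; split=> //; exact: hW.
have hT x : T x -> sums Vh (U i) x.
  move=> Tx; have [v [u [V1v Uiu Ww]]] := hi x Tx.
  exists (x - u); last by rewrite opprB addrC subrK.
  by apply: (fit v) => //; [exists i|exact: TY].
exists Vh, i; split=> //.
- split=> //; split; last exact: sY0.1.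
  by exists 0; [left; right|rewrite subrr].
- split; first by move=> x y Vx Vy; apply: hT; left; exact: sumsP.
  by move=> s x Ss Vx; apply: hT; right; exists s, x.
Qed.

End Absorb.

Section Splitting.
Variables (A M : topologicalZmodType) (act : A -> M -> M).
Hypotheses (lM : LC_module act) (gA : compactly_generated A).

Definition expanded (a : A) (Z : set M) : set M := [set x | exists k, Z (act (a *+ k) x)].

Lemma submod_expanded N a Z : contracted act N a Z -> submod act (expanded a Z).
Proof.
move=> hZ; have powZ := contracted_pow lM _ hZ; case: (hZ) => [[sZ _] _ _ _ bZ].
have up k j x : Z (act (a *+ k) x) -> Z (act (a *+ (j + k)) x).
  by move=> Zx; rewrite -(actP lM); exact: powZ.
split.
  split; first by exists 0%N; rewrite (actr0 lM); exact: sZ.1.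
  move=> x y [i Zx] [j Zy]; exists (i + j)%N; rewrite (actB lM); apply: sZ.2; last exact: up.
  by rewrite addnC; exact: up.
move=> b x [k Zx]; have [m hm] := bZ b; exists (k + m)%N.
have -> : act (a *+ (k + m)) (act b x) = act (b + a *+ m) (act (a *+ k) x).
  rewrite -!(actA lM) mulrnDr; congr (act _ x).
  by move: (a *+ k) (a *+ m) => u v; zmod.
exact: hm.
Qed.

(** X = Vh + a^-k Z is a compact group stable under [a]; the required [Y'] is the intersection of
    the a^m X. *)
Lemma contraction_split N a Z Y V : contracted act N a Z ->
  submod act Y -> closed Y -> closure (expanded a Z) `<=` Y -> compact V ->
  Y `<=` sums V (closure (expanded a Z)) ->
  exists Y', [/\ submod act Y', compact Y', Y' `<=` Y &
    Y `<=` sums Y' (closure (expanded a Z))].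
Proof.
move=> hZ sY cY LY cV YV; have sN1 := submod_expanded hZ.
have powZ := contracted_pow lM _ hZ; case: (hZ) => [[sZ cZ] ZN aZ orbZ bZ].
have [S [cS sS genS]] := compactly_generated_act lM gA.
have cS' : compact (S `|` [set a]) by apply: compactU => //; exact: compact_set1.
pose Zk k := [set x | Z (act (a *+ k) x)].
have upZ k j x : Zk k x -> Zk (j + k)%N x by move=> Zx; rewrite /Zk /= -(actP lM); exact: powZ.
have eZ : expanded a Z = \bigcup_(k in setT) Zk k.
  by apply/seteqP; split=> x; [move=> [k]; exists k|move=> [k _]; exists k].
have N1Y x : expanded a Z x -> Y x by move=> ex; apply: LY; exact: subset_closure.
have ZkY k : Zk k `<=` Y by move=> x Zx; apply: N1Y; exists k.
have sZk k : is_subgroup (Zk k) by exact: (subgroup_act_pre lM).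
have cZk k : compact (Zk k) by exact: (compact_act_pre lM).
have [| | | |Vh [k [[cVh VhY] _ [Vh0 sVh] [hD hS] YVh]]] := @compact_absorb _ _ _ lM nat setT Zk Y V
   (S `|` [set a]) _ _ _ sY cY cV cS'.
- by exists 0%N.
- move=> i j _ _; exists (i + j)%N; split=> // x; last exact: upZ.
  by rewrite addnC; exact: upZ.
- by move=> i _; exact: ZkY.
- by rewrite -eZ.
rewrite -eZ in YVh.
pose X := sums Vh (Zk k); have cX : compact X by exact: compact_sums.
have clX : closed X by exact: (LC_compact_closed lM.1).
have sX : is_subgroup X.
  split; first by exists 0 => //; rewrite subrr; exact: (sZk k).1.
  move=> x y [v Vv Zv] [w Vw Zw]; have [u Vu Zu] := hD _ _ Vv (sVh _ Vw).
  exists u => //; have -> : x - y - u = (x - v) - (y - w) + (v - w - u) by zmod.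
  by apply: subgroupD => //; exact: (sZk k).2.
have ZX x : Zk k x -> X x by move=> Zx; exists 0 => //; rewrite subr0.
have VX x : Vh x -> X x by move=> Vx; exists x => //; rewrite subrr; exact: (sZk k).1.
have aZk j x : Zk j x -> Zk j (act a x) by move=> Zx; rewrite /Zk /= (actC lM); exact: aZ.
have aX x : X x -> X (act a x).
  move=> [v Vv Zv]; rewrite -(subrK v x) (actD lM); apply: subgroupD => //.
    by apply: ZX; exact: aZk.
  by apply: hS => //; right.
have aXj j x : X x -> X (act (a *+ j) x).
  move=> Xx; elim: j => [|j ih]; first by rewrite mulr0n (act0 lM).
  by rewrite mulrS (actA lM); exact: aX.
have XY x : X x -> Y x.
  move=> [v Vv Zv]; rewrite -(subrK v x); apply: subgroupD; [exact: sY.1| |exact: VhY].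
  exact: ZkY Zv.
pose Y' := [set y | forall m, X (act (- (a *+ m)) y)].
have Y'X y : Y' y -> X y by move=> /(_ 0%N); rewrite mulr0n oppr0 (act0 lM).
have small i W : nbhs 0 W -> exists j, forall z, Zk i (act (- (a *+ j)) z) -> W z.
  move=> nW.
  have down j z : Zk i (act (- (a *+ j)) z) -> Zk i z.
    move=> Zz; rewrite -(actVK lM (a *+ j) z); move: (act _ z) Zz => y Zy.
    by rewrite /Zk /= (actC lM); exact: powZ.
  have [| | |z Zz hz|j _ hj] := @compact_directed_cap_sub M (Zk i) nat setT
     (fun j => [set z | Zk i (act (- (a *+ j)) z)]) W (cZk i).
  - by exists 0%N.
  - move=> j1 j2 _ _; exists (j1 + j2)%N; split=> // z /=.
      rewrite -(actPV lM a j2 j1) addnC => h.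
      by rewrite /Zk /= (actC lM); exact: powZ.
    rewrite -(actPV lM a j1 j2) => h.
    by rewrite /Zk /= (actC lM); exact: powZ.
  - by move=> j _; do 2?apply: (closed_act_pre lM); exact: (LC_compact_closed lM.1).
  - suff -> : z = 0 by [].
    apply: orbZ => j; have := hz (i + j)%N I; rewrite /Zk /=.
    by rewrite (actPV lM).
  - by exists j => z Zz; apply: hj; split=> //; exact: down Zz.
exists Y'; split.
- split.
    split; first by move=> m; rewrite (actr0 lM); exact: sX.1.
    by move=> x y hx hy m; rewrite (actB lM); exact: sX.2.
  apply: genS => s y Ss hy m; have [ms hms] := bZ s.
  have sZk' z : Zk k z -> Zk (k + ms)%N (act s z).
    move=> Zz; rewrite /Zk /=.
    have -> : act (a *+ (k + ms)) (act s z) = act (s + a *+ ms) (act (a *+ k) z).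
      rewrite -!(actA lM) mulrnDr; congr (act _ z).
      by move: (a *+ k) (a *+ ms) => u v; zmod.
    exact: hms.
  (* Write a^-(j+m) y = v + u with v in [Vh] and u in [Zk k]. Then a^j s v is in [X], while a^j s u
     becomes small as j grows, and [X] is closed. *)
  apply: clX; apply/closureP => W nW; have [j hj] := small (k + ms)%N W nW.
  have -> : act (- (a *+ m)) (act s y) = act (a *+ j) (act s (act (- (a *+ (j + m))) y)).
    by rewrite [RHS](actC lM) (actPV lM) [LHS](actC lM).
  have [v Vv Zv] := hy (j + m)%N; move: (act (- (a *+ (j + m))) y) Zv => u Zu.
  exists (act (a *+ j) (act s v)); first by apply: aXj; apply: hS => //; left.
  apply: hj; rewrite -!(actB lM) (actK lM); exact: sZk'.
- apply: (subclosed_compact _ cX) => //.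
  have -> : Y' = \bigcap_m [set y | X (act (- (a *+ m)) y)].
    by apply/seteqP; split=> x hx m; [move=> _; exact: (hx m)|exact: (hx m I)].
  by apply: closed_bigI => m _; exact: (closed_act_pre lM).
- by move=> y /Y'X /XY.
- move=> y Yy; pose L := closure (expanded a Z).
  (* The sets of x in a^m X congruent to [y] modulo [L] decrease with m and are nonempty, because
     a^-m y is in Vh plus the expanded submodule, which is stable under [a]. *)
  have [| | |i _|x Xx hx] := @compact_directed_cap M X nat setT
     (fun m => [set x | L (y - x) /\ X (act (- (a *+ m)) x)]) cX.
  + by exists 0%N.
  + move=> i j _ _; exists (i + j)%N; split=> // x [Lx Xx]; split=> //.
      by rewrite -(actPV lM a j i) addnC; exact: aXj.
    by rewrite -(actPV lM a i j); exact: aXj.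
  + move=> i _; apply: closedI; last exact: (closed_act_pre lM).
    apply: preimage_closed; last exact: closed_closure.
    move=> x _; apply: (@continuous_comp _ _ _ -%R (fun z => y + z)).
      exact: opp_continuous.
    exact: continuous_addr.
  + have [v Vv N1v] : sums Vh (expanded a Z) (act (- (a *+ i)) y).
      by apply: YVh; exact: sY.2.
    exists (act (a *+ i) v); first by apply: aXj; exact: VX.
    split; last by rewrite (actK lM); exact: VX.
    apply: subset_closure.
    have -> : y - act (a *+ i) v = act (a *+ i) (act (- (a *+ i)) y - v).
      by rewrite (actB lM) (actVK lM).
    exact: sN1.2.
  exists x; first by move=> m; exact: (hx m I).2.
  exact: (hx 0%N I).1.
Qed.

(** [Y'] is the bounded part of [Y]: [bdd_correction] moves every element into it along [L], and
    [bdd_compact] makes it compact. *)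
Lemma expansion_split (L Y V : set M) h c : submod act L -> closed L -> coarse_norm L h c ->
  (forall x, L x -> exists2 y, L y & y *+ 2 = x) ->
  submod act Y -> closed Y -> L `<=` Y -> compact V -> Y `<=` sums V L ->
  exists Y', [/\ submod act Y', compact Y', Y' `<=` Y & Y `<=` sums Y' L].
Proof.
move=> sL cL hc half sY cY LY cV YV.
have Yn y n : Y y -> sums V L (y *+ 2 ^ n).
  by move=> Yy; apply: YV; apply: subgroupMn => //; exact: sY.1.
have [K cK hK] := bdd_compact sL.1 hc cV.
exists [set y | Y y /\ bdd y]; split.
- exact: submod_bdd.
- apply: (subclosed_compact _ cK); first by apply: (closed_bdd lM) => //; exact: sY.1.
  by move=> y [Yy bY]; apply: hK => // n; exact: Yn.
- by move=> y [].
- move=> y Yy; have [e Le be] := bdd_correction lM.1 sL.1 cL hc half cV (fun n => Yn y n Yy).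
  exists (y + e).
    by split=> //; apply: subgroupD; [exact: sY.1| |exact: LY].
  by rewrite opprD addrA subrr add0r; apply: subgroupN => //; exact: sL.1.
Qed.

Variables (N P V0 : set M).
Hypotheses (sN : submod act N) (cN : closed N) (sP : submod act P) (cP : closed P).
Hypotheses (NP : N `<=` P) (cV0 : compact V0) (PV0 : P `<=` sums V0 N).
Hypothesis oN : Omegasharp act N = N.

(** Were [N] discrete, its finite submodules would vanish, so 0 would be an open submodule with
    purely discrete quotient and contain the sharp part, which is [N]. *)
Lemma Omegasharp_nondiscrete :
  (forall L, submod act L -> L `<=` N -> compact L -> L `<=` [set 0]) ->
  (exists2 x, N x & x <> 0) ->
  forall W, nbhs 0 W -> exists x, [/\ N x, W x & x <> 0].
Proof.
move=> ncpt [x Nx x0] W nW; apply: contrapT => hW; apply: x0.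
have NW y : N y -> W y -> y = 0.
  by move=> Ny Wy; apply: contrapT => y0; apply: hW; exists y.
move: Nx; rewrite -oN => -[Nx /(_ [set 0])]; apply.
- split; first by move=> y ->; exact: sN.1.1.
  split; first by split=> // y z -> ->; rewrite subrr.
  by move=> a y ->; rewrite (actr0 lM).
- exists W°; split; first exact: open_interior.
  apply/seteqP; split=> y; first by move=> ->; split=> //; exact: sN.1.1.
  by move=> [Ny /interior_subset Wy]; exact: NW.
- move=> F [FN sF] F0 [E [fE FE]]; apply/seteqP; split=> //; apply: ncpt => //.
  apply: finite_compact; apply: sub_finite_set fE => y /FE[f [l [Ef [-> ->]]]].
  by rewrite addr0.
Qed.

Lemma submod_open_core : submod act (open_core N).
Proof.
split; first by apply: subgroup_open_core; exact: sN.1.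
move=> a x [Nx hx]; split; first exact: sN.2.
move=> J [sJ JN [W nW hW]].
suff [] : N x /\ J (act a x) by [].
apply: (hx [set y | N y /\ J (act a y)]); split.
- split; first by split; [exact: sN.1.1|rewrite (actr0 lM); exact: sJ.1].
  move=> y z [Ny Jy] [Nz Jz]; split; first exact: sN.1.2.
  by rewrite (actB lM); exact: sJ.2.
- by move=> y [].
- exists [set y | W (act a y)]; first exact: (nbhs0_act lM).
  by move=> y Ny Wy; split=> //; apply: hW => //; exact: sN.2.
Qed.

(* [L] is the closure of the expansion of a contracted subgroup when [N] has a compact open
   subgroup, and the dyadic part of [open_core N] otherwise. *)
Lemma compact_complement_min :
  (forall L, submod act L -> closed L -> L `<=` N -> (exists2 x, L x & x <> 0) ->
    exists Y V, [/\ submod act Y /\ closed Y, L `<=` Y /\ Y `<=` P, compact V,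
                    Y `<=` sums V L & P `<=` sums Y N]) ->
  exists Y, [/\ submod act Y, compact Y, Y `<=` P & P `<=` sums Y N].
Proof.
move=> good; apply: contrapT => bad.
have final L Y Y' : submod act L -> L `<=` N -> Y `<=` P -> P `<=` sums Y N ->
   submod act Y' -> compact Y' -> Y' `<=` Y -> Y `<=` sums Y' L -> False.
  move=> sL LN YP PY sY' cY' Y'Y YY'; apply: bad; exists Y'; split=> //.
    exact: subset_trans YP.
  move=> x /PY[y /YY'[y' Y'y' Ly] Nxy]; exists y' => //.
  have -> : x - y' = (x - y) + (y - y') by zmod.
  by apply: subgroupD; [exact: sN.1| |exact: LN].
(* For a compact nonzero [L] the given [Y] lies in V + L and is already compact. *)
have ncpt L : submod act L -> L `<=` N -> compact L -> L `<=` [set 0].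
  move=> sL LN cL x Lx; apply: contrapT => x0.
  have [| |Y [V [[sY cY] [LY YP] cV YV PY]]] := good L sL _ LN.
  - exact: (LC_compact_closed lM.1).
  - by exists x.
  apply: bad; exists Y; split=> //.
  by apply: (subclosed_compact cY (compact_sums cV cL)).
have N0 : exists2 x, N x & x <> 0.
  apply: contrapT => hN; apply: bad; exists P; split=> //.
    apply: (subclosed_compact cP cV0) => x /PV0[v Vv Nv].
    have /eqP : x - v = 0 by apply: contrapT => x0; apply: hN; exists (x - v).
    by rewrite subr_eq0 => /eqP ->.
  by move=> x Px; exists x => //; rewrite subrr; exact: sN.1.1.
have nd := Omegasharp_nondiscrete ncpt N0.
have [[J oO cO]|nO] := pselect (exists2 O : set M, open_subgroup N O & compact O).
  have [a [Z [hZ [z Zz z0]]]] := contraction_exists lM gA sN cN oO cO ncpt nd.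
  have sE := submod_expanded hZ; pose L := closure (expanded a Z).
  have sL : submod act L by exact: submod_closure.
  have LN : L `<=` N.
    move=> x cx; apply: cN; apply: closureS cx => y [k Zy].
    case: hZ => _ /(_ _ Zy) Ny _ _ _.
    by rewrite -(actK lM (a *+ k) y); exact: sN.2.
  have [| |Y [V [[sY cY] [LY YP] cV YV PY]]] := good L sL _ LN.
  - exact: closed_closure.
  - by exists z => //; apply: subset_closure; exists 0%N; rewrite mulr0n (act0 lM).
  have [Y' [sY' cY' Y'Y YY']] := contraction_split hZ sY cY LY cV YV.
  exact: (final L Y Y').
pose N0' := open_core N.
have sN0 : submod act N0' by exact: submod_open_core.
have cN0 : closed N0' by apply: closed_open_core => //; exact: sN.1.
have N0N : N0' `<=` N by move=> x [].
(* The core lies in the open subgroup [G], so its bounded elements have norm at most [c] and form a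
   compact submodule. *)
have nbN0 : nobdd N0'.
  have [G [h [c [[sG GN] Gopen _ hc]]]] := coarse_norm_exists lM.1 sN.1 cN (@compact0 M).
  case: (hc) => _ _ _ h4 _; have [K cK hK] := h4 c.
  move=> x N0x bx; apply: (ncpt [set x | N0' x /\ bdd x]) => //.
  - exact: submod_bdd.
  - by move=> y [/N0N].
  - apply: (subclosed_compact _ cK); first by apply: (closed_bdd lM) => //; exact: sN0.1.
    move=> y [[Ny hy] By]; have Gy : G y by apply: hy; split.
    by apply: hK => //; exact: coarse_norm_bdd hc _ _.
have [|x Dx x0] := dyadic_exists lM.1 sN0.1 cN0 nbN0.
  move=> W nW; apply: contrapT => hW; apply: nO.
  apply: (open_core_discrete lM.1 sN.1 cN nW) => x N0x Wx.
  by apply: contrapT => x0; apply: hW; exists x.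
have [cL [h [c hc]]] := dyadic_coarse_norm lM.1 sN0.1 cN0 nbN0.
have sL := submod_dyadic lM sN0.
have LN : dyadic N0' `<=` N by move=> y /dyadic_sub /N0N.
have [|Y [V [[sY cY] [LY YP] cV YV PY]]] := good _ sL cL LN; first by exists x.
have [Y' [sY' cY' Y'Y YY']] := expansion_split sL cL hc (@dyadic_half _ _) sY cY LY cV YV.
exact: (final (dyadic N0') Y Y').
Qed.

End Splitting.

(** The order is a parameter because both inclusion and reverse inclusion are needed. *)
Lemma Zorn_sets (T : Type) (P : set (set T)) (R : set T -> set T -> Prop) :
  (forall X, R X X) -> (forall X Y Z, R X Y -> R Y Z -> R X Z) ->
  (forall X Y, R X Y -> R Y X -> X = Y) ->
  (exists X, P X) ->
  (forall F : set (set T), F `<=` P -> (exists X, F X) -> total_on F R ->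
    exists2 B, P B & forall X, F X -> R X B) ->
  exists2 X, P X & forall Y, P Y -> R X Y -> Y = X.
Proof.
move=> Rxx Rt Ra [X0 PX0] h.
pose S := {X : set T | P X}; pose r (x y : S) := `[< R (sval x) (sval y) >].
have [| | | |[X PX] hX] := @Zorn S r.
- by move=> x; apply/asboolP.
- by move=> x y z /asboolP xy /asboolP yz; apply/asboolP; exact: Rt yz.
- move=> [x Px] [y Py] /asboolP /= xy /asboolP /= yx.
  by apply: eq_exist; exact: Ra.
- move=> F tF; have [[[X PX] FX]|nF] := pselect (exists x, F x); last first.
    by exists (exist _ X0 PX0) => s Fs; exfalso; apply: nF; exists s.
  have [| | |B PB hB] := h [set sval x | x in F].
  + by move=> _ [[Y PY] _ <-].
  + by exists X; exists (exist _ X PX).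
  + move=> _ _ [x Fx <-] [y Fy <-].
    by have [/asboolP|/asboolP] := tF x y Fx Fy; [left|right].
  + by exists (exist _ B PB) => s Fs; apply/asboolP => /=; apply: hB; exists s.
exists X => // Y PY XY.
by have /(congr1 sval) := hX (exist _ Y PY) (introT (asboolP _) XY).
Qed.

Section OmegaImage.
Variables (A M Q : topologicalZmodType) (act : A -> M -> M) (actQ : A -> Q -> Q).
Variables (N' : set M) (p : M -> Q).
Hypothesis qp : quotient_map act actQ N' p.

Lemma finite_index_image (F U : set M) (V : set Q) : p @` U `<=` V ->
  finite_index F U -> finite_index (p @` F) V.
Proof.
move=> UV [E [fE FE]]; exists (p @` E); split; first exact: finite_image.
move=> _ [x /FE[f [l [Ef [Ul ->]]]] <-]; exists (p f), (p l); split; first by exists f.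
by split; [apply: UV; exists l|exact: (qmapD qp)].
Qed.

Lemma Omegasharp_image (N : set M) : submod act N ->
  Omegasharp act N = N -> Omegasharp actQ (p @` N) = p @` N.
Proof.
move=> sN oN; apply/seteqP; split; first by move=> x [].
move=> _ [x Nx <-]; split; first by exists x.
move=> U [UN sU] [W [oW eU]] pU.
have sU' : submod act (N `&` p @^-1` U).
  by apply: submod_setI => //; exact: (qmap_submod_pre qp).
have : Omegasharp act N x by rewrite oN.
case=> _ /(_ (N `&` p @^-1` U)) hx; apply: (hx _ _ _).2.
- by split=> //; exact: subIsetl.
- exists (p @^-1` W); split; first by apply: open_comp => // y _; exact: (qmap_cont qp).
  rewrite eU; apply/seteqP; split=> y; first by move=> [Ny [_ Wy]].
  by move=> [Ny Wy]; split=> //; split=> //; exists y.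
- move=> F [FN sF] UF fF.
  have pF : p @` F = U.
    apply: pU; last by apply: finite_index_image fF => _ [y [_ Uy] <-].
    - split; first by move=> _ [y /FN Ny <-]; exists y.
      exact: (qmap_submod_image qp).
    - move=> q Uq; have [y Ny yq] := UN q Uq; exists y => //; apply: UF; split=> //=.
      by rewrite yq.
  apply/seteqP; split=> // y Fy; split; first exact: FN.
  by rewrite /= -pF; exists y.
Qed.

End OmegaImage.

Section CompactComplement.
Variables (A M : topologicalZmodType) (act : A -> M -> M).
Hypotheses (lM : LC_module act) (gA : compactly_generated A).
Variables (N P V0 : set M).
Hypotheses (sN : submod act N) (cN : closed N) (sP : submod act P) (cP : closed P).
Hypotheses (NP : N `<=` P) (cV0 : compact V0) (PV0 : P `<=` sums V0 N).
Hypothesis oN : Omegasharp act N = N.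

(** Says upstairs in [M] that Y/N' is compact and Y/N' + N/N' = P/N', so that all [N'] can be
    compared in one group. For N' = 0 it is the claim itself. *)
Definition cocompact_over (N' : set M) : Prop := exists Y V,
  [/\ submod act Y /\ closed Y, N' `<=` Y /\ Y `<=` P, compact V,
      Y `<=` sums V N' & P `<=` sums Y N].

(** [compact_absorb] selects one member [X] for which Vh + X is a submodule; the rest of [Y] is lost
    only modulo the union, which is inside [N]. *)
Lemma cocompact_over_chain (F : set (set M)) :
  (forall X, F X -> [/\ submod act X, closed X & X `<=` N]) ->
  (exists X, F X) -> total_on F subset ->
  cocompact_over (closure (\bigcup_(X in F) X)) -> exists2 X, F X & cocompact_over X.
Proof.
move=> hF F0 tF [Y [V [[sY cY] [UY YP] cV YV PY]]].
have [S [cS sS genS]] := compactly_generated_act lM gA.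
have XY X : F X -> X `<=` Y.
  by move=> FX x Xx; apply: UY; apply: subset_closure; exists X.
have [| |Vh [X [[cVh VhY] FX [Vh0 sVh] [hD hS] YVh]]] :=
    @compact_absorb _ _ _ lM _ F id Y V S F0 _ _ sY cY cV cS YV.
- move=> X1 X2 F1 F2; have [h|h] := tF X1 X2 F1 F2; first by exists X2; split.
  by exists X1; split.
- by move=> X; exact: XY.
have [sX cX XN] := hF X FX.
exists X => //; exists (sums Vh X), Vh; split=> //.
- split; last exact: closed_sums.
  split.
    split; first by exists 0 => //; rewrite subrr; exact: sX.1.1.
    move=> x y [v Vv Xv] [w Vw Xw]; have [u Vu Xu] := hD _ _ Vv (sVh _ Vw).
    exists u => //; have -> : x - y - u = (x - v) - (y - w) + (v - w - u) by zmod.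
    by apply: subgroupD => //; [exact: sX.1|exact: sX.1.2].
  apply: genS => s x Ss [v Vv Xv]; have [u Vu Xu] := hS s v Ss Vv.
  exists u => //; have -> : act s x - u = act s (x - v) + (act s v - u).
    by rewrite (actB lM); zmod.
  by apply: subgroupD => //; [exact: sX.1|exact: sX.2].
- split; first by move=> x Xx; exists 0 => //; rewrite subr0.
  move=> x [v Vv Xv]; rewrite -(subrK v x); apply: subgroupD; first exact: sP.1.
    by apply: YP; exact: XY Xv.
  by apply: YP; exact: VhY.
- move=> x /PY[y Yy Nxy]; have [v Vv [X' FX' Xv]] := YVh y Yy.
  exists v; first by exists v => //; rewrite subrr; exact: sX.1.1.
  have -> : x - v = (x - y) + (y - v) by zmod.
  by apply: subgroupD => //; [exact: sN.1|have [_ _] := hF X' FX'; apply].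
Qed.

(** Modulo a maximal bad [N'], every nonzero closed submodule of N/N' is good, so
    [compact_complement_min] applies there; the preimage of its compact submodule shows that [N']
    was good. *)
Lemma compact_complement :
  exists Y, [/\ submod act Y, compact Y, Y `<=` P & P `<=` sums Y N].
Proof.
apply: contrapT => bad.
have [| | | | |N' [[sN' cN' N'N] bN'] maxN'] := @Zorn_sets M
  [set X | [/\ submod act X, closed X & X `<=` N] /\ ~ cocompact_over X] subset.
- by move=> X x.
- by move=> X Y Z XY YZ x /XY /YZ.
- by move=> X Y XY YX; apply/seteqP.
- exists [set 0]; split; first split.
  + split; first by split=> // x y -> ->; rewrite subrr.
    by move=> a x ->; rewrite (actr0 lM).
  + exact: (LC_closed1 lM.1).
  + by move=> x ->; exact: sN.1.1.
  + move=> [Y [V [[sY cY] [_ YP] cV YV PY]]]; apply: bad; exists Y; split=> //.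
    apply: (subclosed_compact cY cV) => y /YV[v Vv /eqP].
    by rewrite subr_eq0 => /eqP ->.
- move=> F FP F0 tF; exists (closure (\bigcup_(X in F) X)); last first.
    by move=> X FX x Xx; apply: subset_closure; exists X.
  have hF X : F X -> [/\ submod act X, closed X & X `<=` N] by move=> /FP[].
  split; last by move=> /(cocompact_over_chain hF F0 tF)[X /FP[_ nX]].
  split; last 2 first.
  + exact: closed_closure.
  + move=> x cx; apply: cN; apply: closureS cx => y [X FX Xy].
    by have [_ _] := hF X FX; apply.
  apply: (submod_closure lM); split.
    split; first by have [X FX] := F0; exists X => //; have [sX _ _] := hF X FX; exact: sX.1.1.
    move=> x y [X FX Xx] [X' FX' X'y].
    have [XX|XX] := tF X X' FX FX'.
      by exists X' => //; have [sX _ _] := hF X' FX'; apply: sX.1.2 => //; exact: XX.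
    by exists X => //; have [sX _ _] := hF X FX; apply: sX.1.2 => //; exact: XX.
  by move=> a x [X FX Xx]; exists X => //; have [sX _ _] := hF X FX; exact: sX.2.
have [Q [actQ [p [lQ qp]]]] := quotient_exists lM sN' cN'.
have N'P : N' `<=` P by exact: subset_trans NP.
have clim X : submod act X -> closed X -> N' `<=` X -> closed (p @` X).
  move=> sX cX N'X; apply: (qmap_closed_image qp) => // x n Xx /N'X Xn.
  by apply: subgroupD => //; exact: sX.1.
have [| | | | | | | |Y1 [sY1 cY1 Y1P PY1]] :=
    @compact_complement_min _ _ _ lQ gA (p @` N) (p @` P) (p @` V0).
- exact: (qmap_submod_image qp).
- exact: clim.
- exact: (qmap_submod_image qp).
- exact: clim.
- by apply: compact_image => //; exact: (qmap_cont qp).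
- move=> _ [x /PV0[v Vv Nv] <-]; exists (p v); first by exists v.
  by exists (x - v) => //; exact: (qmapB qp).
- exact: (Omegasharp_image qp).
- move=> L1 sL1 cL1 L1N [q Lq q0].
  pose L := p @^-1` L1.
  have sL : submod act L by exact: (qmap_submod_pre qp).
  have cL : closed L by exact: (qmap_closed_pre qp).
  have LN : L `<=` N.
    move=> x /L1N[n Nn pn]; have : N' (x - n) by apply/(qmap_eq qp).
    by move=> /N'N Nxn; rewrite -(subrK n x); apply: subgroupD => //; exact: sN.1.
  have N'L : N' `<=` L by move=> x /(qmap_ker qp) px; rewrite /L /= px; exact: sL1.1.1.
  have [Y [V [[sY cY] [LY YP] cV YV PY]]] : cocompact_over L.
    apply: contrapT => nL; have LN' := maxN' L (conj (And3 sL cL LN) nL) N'L.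
    have [x px] := qmap_surj qp q; apply: q0; rewrite -px; apply/(qmap_ker qp).
    by rewrite -LN' /L /= px.
  exists (p @` Y), (p @` V); split.
  + by split; [exact: (qmap_submod_image qp)|apply: clim => //; exact: subset_trans LY].
  + split; last exact: image_subset.
    move=> r L1r; have [x px] := qmap_surj qp r; exists x => //; apply: LY.
    by rewrite /L /= px.
  + by apply: compact_image => //; exact: (qmap_cont qp).
  + move=> _ [y /YV[v Vv Lv] <-]; exists (p v); first by exists v.
    by rewrite -(qmapB qp).
  + move=> _ [x /PY[y Yy Ny] <-]; exists (p y); first by exists y.
    by exists (x - y) => //; exact: (qmapB qp).
apply: bN'; have [V cV Y1V] := qmap_compact_lift qp lM.1 cY1.
exists (p @^-1` Y1), V; split=> //.
- split; first exact: (qmap_submod_pre qp).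
  by apply: (qmap_closed_pre qp); exact: (LC_compact_closed lQ.1).
- split; first by move=> x /(qmap_ker qp) px; rewrite /= px; exact: sY1.1.1.
  move=> x /= /Y1P[y Py pxy]; have : N' (x - y) by apply/(qmap_eq qp).
  by move=> /N'P Pxy; rewrite -(subrK y x); apply: subgroupD => //; exact: sP.1.
- by move=> y /= /Y1V[v Vv pv]; exists v => //; apply/(qmap_eq qp).
- move=> x Px; have [|y1 Y1y [n Nn pn]] := PY1 (p x); first by exists x.
  have [y py] := qmap_surj qp y1; exists y; first by rewrite /= py.
  have : N' (x - y - n) by apply/(qmap_ker qp); rewrite !(qmapB qp) pn py subrr.
  by move=> /N'N Nx; rewrite -(subrK n (x - y)); apply: subgroupD => //; exact: sN.1.
Qed.

End CompactComplement.

(** * Cocontractions *)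

Section Generated.
Variable G : zmodType.

Definition gen (X : set G) : set G := [set x | forall H, is_subgroup H -> X `<=` H -> H x].

Lemma subgroup_gen X : is_subgroup (gen X).
Proof.
split; first by move=> H sH _; exact: sH.1.
by move=> x y hx hy H sH XH; apply: sH.2; [exact: hx|exact: hy].
Qed.

Lemma gen_sub X : X `<=` gen X.
Proof. by move=> x Xx H _; exact. Qed.

Lemma gen_min X H : is_subgroup H -> X `<=` H -> gen X `<=` H.
Proof. by move=> sH XH x; exact. Qed.

End Generated.

Section Cocontraction.
Variables (A M : topologicalZmodType) (act : A -> M -> M).
Hypothesis lM : LC_module act.

(** Dual to [contracted]: an open proper [Z] instead of a compact nonzero one, with the a^-k Z
    exhausting [R] instead of the a^k Z shrinking to 0. *)
Definition cocontracted (R : set M) (a : A) (Z : set M) : Prop :=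
  [/\ open_subgroup R Z, exists2 x, R x & ~ Z x,
      forall x, Z x -> Z (act a x),
      forall x, R x -> exists k, Z (act (a *+ k) x) &
      forall b, exists m, forall x, Z x -> Z (act (b + a *+ m) x)].

Lemma gen_act (X : set M) H b x : is_subgroup H ->
  (forall y, X y -> H (act b y)) -> gen X x -> H (act b x).
Proof. by move=> sH XH; apply: (gen_min (subgroup_act_pre lM b sH)). Qed.

Hypothesis gA : compactly_generated A.

(** [E B Phi] is generated by the translates of [O] under [B] and finitely many elements. It is not
    [R] for B = A0, where it lies in a compact set, and is [R] for B = A, where it is an open
    submodule; the critical step gives a0. *)
Lemma cocontraction_exists (R O : set M) : submod act R -> closed R ->
  open_subgroup R O -> compact O -> ~ compact R ->
  (forall L, submod act L -> open_subgroup R L -> L = R) ->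
  exists a Z, cocontracted R a Z.
Proof.
move=> sR cR oO cO ncR noR; case: (oO) => sO OR [WO nWO hWO].
have [A0 [s [sA0 A0O gens]]] := stabilizer_cofinite lM gA sR oO cO.
pose X0 (B : set A) (Phi : seq A) : set M :=
  [set x | exists b f z, [/\ B b, f \in 0 :: Phi, O z & x = act (b + f) z]].
pose E B Phi := gen (X0 B Phi).
have sE B Phi : is_subgroup (E B Phi) by exact: subgroup_gen.
have ER B Phi : E B Phi `<=` R.
  apply: gen_min; first exact: sR.1.
  by move=> _ [b [f [z [_ _ Oz ->]]]]; apply: sR.2; exact: OR.
have OE B Phi : B 0 -> O `<=` E B Phi.
  move=> B0 z Oz; apply: gen_sub; exists 0, 0, z; split=> //; first exact: mem_head.
  by rewrite addr0 (act0 lM).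
have openR (H : set M) : is_subgroup H -> H `<=` R -> O `<=` H -> open_subgroup R H.
  by move=> sH HR OH; split=> //; exists WO => // x Rx Wx; apply: OH; exact: hWO.
(* The finite sum of the f O, a compact group. It contains all generators of E A0 Phi because [A0]
   preserves [O]. *)
pose fix SO (Phi : seq A) : set M :=
  if Phi is f :: Phi' then sums [set x | O (act (- f) x)] (SO Phi') else [set 0].
have sSO Phi : is_subgroup (SO Phi).
  elim: Phi => [|f Phi ih] /=; first by split=> // x y -> ->; rewrite subrr.
  by apply: subgroup_sums => //; exact: (subgroup_act_pre lM).
have cSO Phi : compact (SO Phi).
  elim: Phi => [|f Phi ih] /=; first exact: compact_set1.
  by apply: compact_sums => //; exact: (compact_act_pre lM).
have fSO Phi f z : f \in Phi -> O z -> SO Phi (act f z).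
  elim: Phi => //= g Phi ih; rewrite inE => /predU1P[->|fP] Oz.
    exists (act g z); first by rewrite /= (actK lM).
    by rewrite subrr; exact: (sSO Phi).1.
  by exists 0; [rewrite /= (actr0 lM); exact: sO.1|rewrite subr0; exact: ih].
have SOR Phi : SO Phi `<=` R.
  elim: Phi => [|f Phi ih] x /=; first by move=> ->; exact: sR.1.1.
  move=> [y /= Oy /ih Rxy]; rewrite -(subrK y x); apply: subgroupD => //; first exact: sR.1.
  by rewrite -(actVK lM f y); apply: sR.2; exact: OR.
have [| |B [a0 [sB AB PB nPB]]] := @critical_subgroup A
   (fun B => forall Phi, E B Phi <> R) A0 s sA0.
- move=> Phi eR; apply: ncR; apply: (subclosed_compact cR (cSO (0 :: Phi))).
  rewrite -{1}eR; apply: gen_min => // _ [b [f [z [Ab fP Oz ->]]]].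
  by rewrite addrC (actA lM); apply: fSO => //; exact: A0O.
- move=> B sB AB Bs /(_ [::]); apply; have BT := gens B sB AB Bs.
  apply: noR; last by apply: openR => //; apply: OE; exact: sB.1.
  split=> // a x; apply: gen_act => // _ [b [f [z [Bb fP Oz ->]]]].
  apply: gen_sub; exists (a + b), f, z; split=> //; first by rewrite BT.
  by rewrite -(actA lM) addrA.
move: nPB => /existsNP[Phi /contrapT eR].
pose X := E B Phi; have sX : is_subgroup X by exact: sE.
have OX : O `<=` X by apply: OE; exact: sB.1.
have BX b x : B b -> X x -> X (act b x).
  move=> Bb; apply: gen_act => // _ [c [f [z [Bc fP Oz ->]]]]; apply: gen_sub.
  by exists (b + c), f, z; split=> //; [exact: subgroupD|rewrite -(actA lM) addrA].
have XP (H : set M) c : is_subgroup H -> (forall b x, B b -> H x -> H (act b x)) ->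
    (forall f z, f \in 0 :: Phi -> O z -> H (act (c + f) z)) -> forall x, X x -> H (act c x).
  move=> sH BH fH x; apply: gen_act => // _ [b [f [z [Bb fP Oz ->]]]].
  have -> : act c (act (b + f) z) = act b (act (c + f) z).
    by rewrite -!(actA lM); congr act; zmod.
  by apply: BH => //; exact: fH.
(* The group generated by the a^k X, k >= 0. *)
pose Z a := gen [set x | exists k, X (act (- (a *+ k)) x)].
have sZ a : is_subgroup (Z a) by exact: subgroup_gen.
have XR x : X x -> R x by exact: ER.
have ZR a : Z a `<=` R.
  apply: gen_min; first exact: sR.1.
  by move=> x [k /XR Rx]; rewrite -(actVK lM (a *+ k) x); exact: sR.2.
have XZ a x : X x -> Z a x.
  by move=> Xx; apply: gen_sub; exists 0%N; rewrite mulr0n oppr0 (act0 lM).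
have BZ a b x : B b -> Z a x -> Z a (act b x).
  move=> Bb; apply: gen_act => // y [k Xy]; apply: gen_sub; exists k.
  by rewrite (actC lM); exact: BX.
have aZ a x : Z a x -> Z a (act a x).
  apply: gen_act => // y [k Xy]; apply: gen_sub; exists k.+1.
  by rewrite -(actA lM) mulrS opprD addrAC addNr add0r.
have aZk a k x : Z a x -> Z a (act (a *+ k) x).
  move=> Zx; elim: k => [|k ih]; first by rewrite mulr0n (act0 lM).
  by rewrite mulrS (actA lM); exact: aZ.
have cover (T : set M) (H : nat -> set M) : compact T -> T `<=` R ->
    (forall k, is_subgroup (H k)) -> (forall k, exists2 W, nbhs 0 W & forall x, R x -> W x -> H k x) ->
    (forall k, H k `<=` H k.+1) -> (forall x, T x -> exists k, H k x) ->
    exists k, T `<=` H k.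
  move=> cT TR sH oH mH hT.
  have mon i j : H i `<=` H (j + i)%N.
    by elim: j => [|j ih] x // Hx; rewrite addSn; apply: mH; exact: ih.
  have [| | |k _ hk] := @compact_directed_cover M T nat setT (fun k => [set x | R x -> H k x]) cT.
  - by exists 0%N.
  - move=> i j _ _; exists (i + j)%N; split=> // x h Rx; last by apply: mon; exact: h.
    by rewrite addnC; apply: mon; exact: h.
  - move=> x Tx; have [k Hx] := hT x Tx; exists k => //.
    have [W nW hW] := oH k; apply/nbhs_at0P; apply: filterS nW => w Ww /= Rxw.
    apply: subgroupD => //; apply: hW => //.
    have -> : w = (x + w) - x by zmod.
    by apply: sR.1.2 => //; exact: TR.
  - by exists k => x Tx; apply: hk => //; exact: TR.
have openH (H : set M) : O `<=` H -> exists2 W, nbhs 0 W & forall x, R x -> W x -> H x.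
  by move=> OH; exists WO => // x Rx Wx; apply: OH; exact: hWO.
have [a ha nZ] : exists2 a, a = a0 \/ a = - a0 & Z a <> R.
  have [ZR0|] := pselect (Z a0 = R); last by exists a0 => //; left.
  exists (- a0); first by right.
  (* If [Z a0] is [R], the [Xn] exhaust it, so one contains the compact set a0^-1 SO and is thereby
     stable under -a0. It contains Z (- a0); were this also [R], then E B would be [R] for the
     translates f + a0 k, against [PB]. *)
  pose Xn n := gen [set x | exists2 k, (k <= n)%N & X (act (- (a0 *+ k)) x)].
  have sXn n : is_subgroup (Xn n) by exact: subgroup_gen.
  have mXn n : Xn n `<=` Xn n.+1.
    apply: gen_min => // x [k kn Xx]; apply: gen_sub; exists k => //; exact: leqW.
  have XXn n x : X x -> Xn n x.
    by move=> Xx; apply: gen_sub; exists 0%N => //; rewrite mulr0n oppr0 (act0 lM).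
  have BXn n b x : B b -> Xn n x -> Xn n (act b x).
    move=> Bb; apply: gen_act => // y [k kn Xy]; apply: gen_sub; exists k => //.
    by rewrite (actC lM); exact: BX.
  have mon i j : Xn i `<=` Xn (j + i)%N.
    by elim: j => [|j ih] x // Hx; rewrite addSn; apply: mXn; exact: ih.
  have sXu : is_subgroup [set x | exists n, Xn n x].
    split; first by exists 0%N; exact: (sXn 0%N).1.
    move=> x y [i Xx] [j Xy]; exists (i + j)%N; apply: (sXn _).2; last exact: mon.
    by rewrite addnC; exact: mon.
  have allX x : R x -> exists n, Xn n x.
    rewrite -ZR0; apply: (gen_min sXu) => y [k Xy]; exists k.
    by apply: gen_sub; exists k.
  have [| | | | | |n hn] := cover [set x | SO (0 :: Phi) (act a0 x)] Xn.
  - exact: (compact_act_pre lM).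
  - by move=> x hx; have Rx := SOR (0 :: Phi) _ hx; rewrite -(actK lM a0 x); exact: sR.2.
  - by [].
  - by move=> k; apply: openH => x /OX; exact: XXn.
  - by [].
  - move=> x hx; have Rx := SOR (0 :: Phi) _ hx; apply: allX; rewrite -(actK lM a0 x); exact: sR.2.
  have step1 x : X x -> Xn n (act (- a0) x).
    apply: XP => // [b y|f z fP Oz]; first exact: BXn.
    apply: hn; suff : SO (0 :: Phi) (act a0 (act (- a0 + f) z)) by [].
    by rewrite -(actA lM) addrA subrr add0r; exact: fSO.
  have step x : Xn n x -> Xn n (act (- a0) x).
    apply: gen_act => // y [[|k] kn Xy].
      by apply: step1; move: Xy; rewrite mulr0n oppr0 (act0 lM).
    apply: gen_sub; exists k; first exact: ltnW.
    by move: Xy; rewrite mulrSr opprD (actA lM).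
  move=> ZR1; apply: (PB [seq f + a0 *+ k | f <- 0 :: Phi, k <- iota 0 n.+1]).
  apply/seteqP; split; first exact: ER.
  rewrite -{1}ZR1; apply: gen_min => // x [k]; rewrite mulNrn opprK => Xx.
  have Xnx : Xn n x.
    rewrite -(actK lM (a0 *+ k) x); move: (act (a0 *+ k) x) Xx => y Xy.
    elim: k => [|k ih]; first by rewrite mulr0n oppr0 (act0 lM); exact: XXn.
    by rewrite mulrS opprD (actA lM); exact: step.
  apply: (gen_min _ _ Xnx) => // y [j jn Xy].
  rewrite -(actVK lM (a0 *+ j) y); move: (act _ y) Xy => {}y Xy.
  move: Xy; apply: gen_act => // _ [b [f [z [Bb fP Oz ->]]]]; apply: gen_sub.
  exists b, (f + a0 *+ j), z; split=> //.
    rewrite inE; apply/orP; right; apply/allpairsP; exists (f, j).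
    by rewrite mem_iota.
  by rewrite -(actA lM); congr act; move: (a0 *+ j) => c; zmod.
have exh x : R x -> exists k, Z a (act (a *+ k) x).
  have sH : is_subgroup [set x | exists k, Z a (act (a *+ k) x)].
    split; first by exists 0%N; rewrite (actr0 lM); exact: (sZ a).1.
    move=> u v [i Zu] [j Zv]; exists (i + j)%N; rewrite (actB lM); apply: (sZ a).2.
      by rewrite addnC -(actP lM); exact: aZk.
    by rewrite -(actP lM); exact: aZk.
  rewrite -eR; apply: (gen_min sH) => _ [b' [f [z [[b Bb [n bn]] fP Oz ->]]]].
  have Xo : X (act (b + f) z) by apply: gen_sub; exists b, f, z.
  have -> : act (b' + f) z = act (a0 *~ n) (act (b + f) z).
    by rewrite -bn -(actA lM); congr act; zmod.
  have pos j y : X y -> exists k, Z a (act (a *+ k) (act (a *+ j) y)).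
    by move=> Xy; exists 0%N; rewrite mulr0n (act0 lM); apply: aZk; exact: XZ.
  have neg j y : X y -> exists k, Z a (act (a *+ k) (act (- (a *+ j)) y)).
    by move=> Xy; exists j; rewrite (actVK lM); exact: XZ.
  case: n bn => n bn; rewrite ?NegzE ?mulrNz -pmulrn; case: ha => ha.
  - by rewrite -ha; exact: pos.
  - have -> : a0 *+ n = - (a *+ n) by rewrite ha mulNrn opprK.
    exact: neg.
  - by rewrite -ha; exact: neg.
  - have -> : - (a0 *+ n.+1) = a *+ n.+1 by rewrite ha mulNrn.
    exact: pos.
exists a, (Z a); split=> //.
- by apply: openR => // z /OX; exact: XZ.
- apply: contrapT => hZ; apply: nZ; apply/seteqP; split=> // x Rx.
  by apply: contrapT => nZx; apply: hZ; exists x.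
- exact: aZ.
- move=> b.
  have [| | | | | |m hm] := cover [set x | SO (0 :: Phi) (act (- b) x)]
     (fun k => [set x | Z a (act (a *+ k) x)]).
  + exact: (compact_act_pre lM).
  + by move=> x hx; have Rx := SOR (0 :: Phi) _ hx; rewrite -(actVK lM b x); exact: sR.2.
  + by move=> k; exact: (subgroup_act_pre lM).
  + move=> k; exists [set x | WO (act (a *+ k) x)]; first exact: (nbhs0_act lM).
    by move=> x Rx Wx; apply: XZ; apply: OX; apply: hWO => //; exact: sR.2.
  + by move=> k x /= Zx; rewrite mulrS (actA lM); exact: aZ.
  + by move=> x hx; have Rx := SOR (0 :: Phi) _ hx; apply: exh; rewrite -(actVK lM b x); exact: sR.2.
  exists m => x; apply: gen_act => // y [j Xy].
  rewrite -(actVK lM (a *+ j) y); move: (act _ y) Xy => {}y Xy.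
  rewrite (actC lM); apply: aZk; move: y Xy; apply: (XP (Z a)) => // [b' y|f z fP Oz]; first exact: BZ.
  have -> : act (b + a *+ m + f) z = act (a *+ m) (act (b + f) z).
    by rewrite -(actA lM); congr act; move: (a *+ m) => c; zmod.
  apply: hm; suff : SO (0 :: Phi) (act (- b) (act (b + f) z)) by [].
  by rewrite -(actA lM) addrA addNr add0r; exact: fSO.
Qed.

End Cocontraction.

(** * Open complements *)

(** Near 0 the finitely many closed cosets f + L with f outside [L] are avoided. *)
Lemma finite_index_relopen (T : topologicalZmodType) (R L : set T) :
  is_subgroup L -> closed L -> finite_index R L ->
  exists2 W, nbhs 0 W & forall x, R x -> W x -> L x.
Proof.
move=> sL cL [E [fE RE]]; pose E' := [set f | E f /\ ~ L f].
have cE' : compact E' by apply: finite_compact; apply: sub_finite_set fE => f [].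
have [f [Ef nLf]|W nW hW] := @compact_tube T T E' 0 (fun f w => ~ L (w - f)) cE'.
  have nb : nbhs (0 - f) (~` L).
    apply: open_nbhs_nbhs; split; first exact: closed_openC.
    by rewrite sub0r => Lf; apply: nLf; rewrite -[f]opprK; exact: subgroupN.
  have [[U1 U2] /= [n1 n2] hU] := @sub_continuous T (0, f) _ nb.
  by exists U2, U1; split=> // g w Ug Uw; exact: (hU (w, g)).
exists W => // x /RE[f [l [Ef [Ll xe]]]] Wx.
have [Lf|nLf] := pselect (L f); first by rewrite xe; exact: subgroupD.
by exfalso; apply: (hW f x) => //; rewrite xe addrC addKr.
Qed.

Section OpenComplement.
Variables (A M Q : topologicalZmodType) (act : A -> M -> M) (actQ : A -> Q -> Q).
Variables (N : set M) (p : M -> Q).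
Hypotheses (lM : LC_module act) (lQ : LC_module actQ) (gA : compactly_generated A).
Hypothesis qp : quotient_map act actQ N p.
Variable U : set M.
Hypotheses (sU : submod act U) (UN : U `<=` N).
Hypothesis oU : exists2 W, nbhs 0 W & forall x, N x -> W x -> U x.

Definition open_complement_over (R : set Q) : Prop := exists Y,
  [/\ submod act Y, Y `<=` p @^-1` R,
      exists2 W, nbhs 0 W & forall x, R (p x) -> W x -> Y x,
      U `<=` Y & forall x, N x -> Y x -> U x].

(** Dual to [compact_absorb]. For a small compact [V], the sets V + V and S V lie in [W], so over
    the intersection of the [C i] they lie in [Y1]; allowing an error in [V], compactness gives this
    over a single [C i]. *)
Lemma open_absorb (I : Type) (D : set I) (C : I -> set Q) (R1 : set Q) (Y1 : set M)
    (S : set A) :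
  (exists i, D i) ->
  (forall i j, D i -> D j -> exists k, [/\ D k, C k `<=` C i & C k `<=` C j]) ->
  (forall i, D i -> closed (C i)) ->
  (forall q, (forall i, D i -> C i q) -> R1 q) ->
  (exists2 W, nbhs 0 W & forall x, R1 (p x) -> W x -> Y1 x) ->
  compact S ->
  exists (V : set M) (i : I), [/\ D i, nbhs 0 V /\ (forall x, V x -> V (- x)),
    forall x, R1 (p x) -> V x -> Y1 x,
    forall x y, V x -> V y -> C i (p (x + y)) -> sums V Y1 (x + y) &
    forall s x, S s -> V x -> C i (p (act s x)) -> sums V Y1 (act s x)].
Proof.
move=> D0 dir cC CR [W nW hW] cS.
have [V' [nV' _ hV']] := nbhs0D nW.
have [V'' nV'' hV''] := compact_act_nbhs lM cS nW.
have [V [cV nV sV VV]] := LC_compact_nbhs_in lM.1 (filterI nV' nV'').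
pose T := sums V V `|` [set x | exists s v, [/\ S s, V v & x = act s v]].
have cT : compact T.
  by apply: compactU; [exact: compact_sums|exact: (compact_act_image lM)].
have TW : T `<=` W.
  move=> x [[v /VV[V'v _] /VV[V'x _]]|[s [v [Ss /VV[_ V''v] ->]]]]; last exact: hV''.
  by rewrite -(subrK v x) addrC; exact: hV'.
have [| |x Tx hx|i Di hi] := @compact_directed_cap_sub M T I D (fun i => p @^-1` C i)
   (sums V Y1) cT D0.
- move=> i j Di Dj; have [k [Dk ki kj]] := dir i j Di Dj; exists k; split=> // x.
    exact: ki.
  exact: kj.
- by move=> i Di; apply: (qmap_closed_pre qp); exact: cC.
- apply/nbhs_at0P; apply: filterS nV => v Vv /=; rewrite addrC; apply: sumsP => //.
  by apply: hW; [exact: CR|exact: TW].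
exists V, i; split=> //.
- move=> x R1x Vx; apply: hW => //; rewrite -[x]addr0; apply: hV'.
    by have [] := VV x Vx.
  exact: nbhs_singleton.
- by move=> x y Vx Vy Cxy; apply: hi; split=> //; left; exact: sumsP.
- by move=> s x Ss Vx Csx; apply: hi; split=> //; right; exists s, x.
Qed.

(** [Y1] is thickened by [V] over a member [X]. Over the intersection of the chain [V] is inside
    [Y1], so the trace on [N] is still [U]. *)
Lemma open_complement_chain (F : set (set Q)) :
  (forall X, F X -> submod actQ X /\ closed X) -> (exists X, F X) ->
  total_on F subset ->
  open_complement_over (\bigcap_(X in F) X) -> exists2 X, F X & open_complement_over X.
Proof.
move=> hF F0 tF [Y1 [sY1 Y1R oY1 UY1 NY1]].
have [S [cS sS genS]] := compactly_generated_act lM gA.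
have [| | |V [X [FX [nV sV] hV hD hS]]] := @open_absorb _ F id (\bigcap_(X in F) X) Y1 S F0 _ _ _ oY1 cS.
- move=> X1 X2 F1 F2; have [h|h] := tF X1 X2 F1 F2; first by exists X1; split.
  by exists X2; split.
- by move=> X /hF[].
- by move=> q h X FX; exact: h.
have [sX cX] := hF X FX.
have Y1X y : Y1 y -> X (p y) by move=> /Y1R; apply.
pose Y := [set x | exists v, [/\ V v, X (p v) & Y1 (x - v)]].
have inY x : X (p x) -> sums V Y1 x -> Y x.
  move=> Xx [v Vv Yv]; exists v; split=> //.
  have -> : v = x - (x - v) by zmod.
  by rewrite (qmapB qp); apply: sX.1.2 => //; exact: Y1X.
have V0 : V 0 by exact: nbhs_singleton.
have Y1Y y : Y1 y -> Y y.
  by move=> Yy; exists 0; split=> //; rewrite ?(qmap0 qp) ?subr0 //; exact: sX.1.1.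
have addY x y : Y x -> Y1 y -> Y (x + y).
  move=> [v [Vv Xv Yv]] Yy; exists v; split=> //; rewrite addrAC.
  by apply: subgroupD => //; exact: sY1.1.
exists X => //; exists Y; split.
- split.
    split; first by apply: Y1Y; exact: sY1.1.1.
    move=> x y [v [Vv Xv Yv]] [w [Vw Xw Yw]].
    have -> : x - y = (v - w) + ((x - v) - (y - w)) by zmod.
    apply: addY; last exact: sY1.1.2.
    have Xvw : X (p (v - w)) by rewrite (qmapB qp); exact: sX.1.2.
    by apply: inY => //; apply: hD => //; exact: sV.
  apply: genS => s x Ss [v [Vv Xv Yv]].
  rewrite -(subrK v x) (actD lM) addrC; apply: addY; last exact: sY1.2.
  have Xsv : X (p (act s v)) by rewrite (qmap_act qp); exact: sX.2.
  by apply: inY => //; exact: hS.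
- move=> x [v [Vv Xv Yv]] /=; rewrite -(subrK v x) (qmapD qp).
  by apply: subgroupD => //; [exact: sX.1|exact: Y1X].
- exists V => // x Xx Vx; exists x; split=> //.
  by rewrite subrr; exact: sY1.1.1.
- by move=> x /UY1; exact: Y1Y.
- move=> x Nx [v [Vv Xv Yv]]; apply: NY1 => //.
  rewrite -(subrK v x); apply: subgroupD => //; first exact: sY1.1.
  apply: hV => //; have px : p x = 0 by apply/(qmap_ker qp).
  move=> X' FX'; have -> : p v = - p (x - v) by rewrite (qmapB qp) px sub0r opprK.
  have [sX' _] := hF X' FX'; apply: subgroupN; first exact: sX'.1.
  exact: (Y1R _ Yv).
Qed.

Section Minimal.
Variable R : set Q.
Hypotheses (sR : submod actQ R) (cR : closed R).
Hypothesis good : forall R1, submod actQ R1 -> closed R1 -> R1 `<=` R -> R1 <> R ->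
  open_complement_over R1.

(** The a^k Z decrease to a proper closed submodule [R1], which has a complement [Y1]. Thickened by
    [V] over one a^i Z, which is open in [R], it becomes a group [Y0] stable under [a]; the union of
    the a^-k Y0 is stable under all of [A]. *)
Lemma cocontracted_complement a Z : cocontracted actQ R a Z -> open_complement_over R.
Proof.
move=> [oZ [x0 Rx0 nZx0] aZ exZ bZ].
case: (oZ) => sZ ZR [WZ nWZ hWZ].
have clZ : closed Z by apply: open_subgroup_closed oZ => //; exact: sR.1.
pose C k := [set x | Z (actQ (- (a *+ k)) x)].
have powZ k x : Z x -> Z (actQ (a *+ k) x).
  move=> Zx; elim: k => [|k ih]; first by rewrite mulr0n (act0 lQ).
  by rewrite mulrS (actA lQ); exact: aZ.
have Cdown i j x : C (i + j)%N x -> C i x.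
  by rewrite /C /= addnC => h; rewrite -(actPV lQ a j i); exact: powZ.
have CR k x : C k x -> R x.
  by move=> /ZR Rx; rewrite -(actVK lQ (a *+ k) x); exact: sR.2.
have sC k : is_subgroup (C k) by exact: (subgroup_act_pre lQ).
have clC k : closed (C k) by exact: (closed_act_pre lQ).
have Ca k x : C k x -> C k (actQ a x) by move=> Cx; rewrite /C /= (actC lQ); exact: aZ.
have Cb k b m : (forall x, Z x -> Z (actQ (b + a *+ m) x)) ->
    forall x, C k x -> C k (actQ (b + a *+ m) x).
  by move=> h x Cx; rewrite /C /= (actC lQ); exact: h.
have CV k m x : C (k + m)%N x <-> C k (actQ (- (a *+ m)) x).
  by rewrite /C /= -(actA lQ) -opprD -mulrnDr.
pose R1 := [set x | forall k, C k x].
have sR1 : submod actQ R1.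
  split.
    split; first by move=> k; exact: (sC k).1.
    by move=> x y hx hy k; apply: (sC k).2; [exact: hx|exact: hy].
  move=> b x hx k; have [m hm] := bZ b.
  have -> : actQ b x = actQ (b + a *+ m) (actQ (- (a *+ m)) x).
    by rewrite -(actA lQ) addrK.
  by apply: Cb => //; apply/CV; exact: hx.
have [| | |Y1 [sY1 Y1R oY1 UY1 NY1]] := good sR1.
- have -> : R1 = \bigcap_k C k.
    by apply/seteqP; split=> x hx k; [move=> _; exact: (hx k)|exact: (hx k I)].
  by apply: closed_bigI => k _.
- by move=> x /(_ 0%N); exact: CR.
- move=> e; apply: nZx0; have : R1 x0 by rewrite e.
  by move=> /(_ 0%N); rewrite /C /= mulr0n oppr0 (act0 lQ).
have [S [cS sS genS]] := compactly_generated_act lM gA.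
have cS' : compact (S `|` [set a; - a]).
  apply: compactU => //; apply: finite_compact; exact: finite_set2.
have [| | | |V [i [_ [nV sV] hV hD hS]]] :=
    @open_absorb nat setT C R1 Y1 (S `|` [set a; - a]) _ _ _ _ oY1 cS'.
- by exists 0%N.
- move=> i j _ _; exists (i + j)%N; split=> // x; first exact: Cdown.
  by rewrite addnC; exact: Cdown.
- by move=> k _.
- by move=> q h k; exact: h.
have V0 : V 0 by exact: nbhs_singleton.
have Y1C k y : Y1 y -> C k (p y) by move=> /Y1R /(_ k).
pose Y0 := [set x | exists v, [/\ V v, C i (p v) & Y1 (x - v)]].
have inY x : C i (p x) -> sums V Y1 x -> Y0 x.
  move=> Cx [v Vv Yv]; exists v; split=> //.
  have -> : v = x - (x - v) by zmod.
  by rewrite (qmapB qp); apply: (sC i).2 => //; exact: Y1C.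
have Y1Y y : Y1 y -> Y0 y.
  by move=> Yy; exists 0; split=> //; rewrite ?(qmap0 qp) ?subr0 //; exact: (sC i).1.
have addY x y : Y0 x -> Y1 y -> Y0 (x + y).
  move=> [v [Vv Cv Yv]] Yy; exists v; split=> //; rewrite addrAC.
  by apply: subgroupD => //; exact: sY1.1.
have actY s x : (S s \/ (s = a \/ s = - a)) -> (exists v, [/\ V v, C i (p (act s v)) & Y1 (x - v)]) ->
    Y0 (act s x).
  move=> Ss [v [Vv Cv Yv]].
  rewrite -(subrK v x) (actD lM) addrC; apply: addY; last exact: sY1.2.
  by apply: inY => //; exact: hS.
have sY0 : is_subgroup Y0.
  split; first by apply: Y1Y; exact: sY1.1.1.
  move=> x y [v [Vv Xv Yv]] [w [Vw Xw Yw]].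
  have -> : x - y = (v - w) + ((x - v) - (y - w)) by zmod.
  apply: addY; last exact: sY1.1.2.
  have Xvw : C i (p (v - w)) by rewrite (qmapB qp); exact: (sC i).2.
  by apply: inY => //; apply: hD => //; exact: sV.
have Y0C x : Y0 x -> C i (p x).
  move=> [v [Vv Cv Yv]]; rewrite -(subrK v x) (qmapD qp).
  by apply: subgroupD => //; exact: Y1C.
have aY0 x : Y0 x -> Y0 (act a x).
  move=> [v [Vv Cv Yv]]; apply: actY; first by right; left.
  by exists v; split=> //; rewrite (qmap_act qp); exact: Ca.
have aY0k k x : Y0 x -> Y0 (act (a *+ k) x).
  move=> Yx; elim: k => [|k ih]; first by rewrite mulr0n (act0 lM).
  by rewrite mulrS (actA lM); exact: aY0.
pose Y := [set y | exists k, Y0 (act (a *+ k) y)].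
have upY k j y : Y0 (act (a *+ k) y) -> Y0 (act (a *+ (j + k)) y).
  by move=> h; rewrite -(actP lM); exact: aY0k.
have NY0 x : N x -> Y0 x -> U x.
  move=> Nx [v [Vv Xv Yv]]; apply: NY1 => //.
  rewrite -(subrK v x); apply: subgroupD => //; first exact: sY1.1.
  apply: hV => //; have px : p x = 0 by apply/(qmap_ker qp).
  have -> : p v = - p (x - v) by rewrite (qmapB qp) px sub0r opprK.
  by apply: (subgroupN sR1.1); exact: Y1R.
have sN b x : N x -> N (act b x).
  move=> /(qmap_ker qp) px; apply/(qmap_ker qp).
  by rewrite (qmap_act qp) px (actr0 lQ).
exists Y; split.
- split.
    split; first by exists 0%N; rewrite (actr0 lM); exact: sY0.1.
    move=> x y [j Yx] [k Yy]; exists (j + k)%N; rewrite (actB lM); apply: sY0.2.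
      by rewrite addnC; exact: upY.
    exact: upY.
  (* The element b alone need not preserve [C i], but b a^m does. As a^m y and v differ by an
     element of [Y1], the image of a^-m v is still in [C i], so b v lies over [C i]. *)
  apply: genS => b y Sb [k Yy]; have [m hm] := bZ b; exists (k + m)%N.
  have -> : act (a *+ (k + m)) (act b y) = act b (act (a *+ m) (act (a *+ k) y)).
    rewrite (actP lM) addnC -!(actA lM); congr act; exact: addrC.
  move: (act (a *+ k) y) Yy => {}y Yy.
  apply: actY; first by left.
  have [v [Vv Cv Yv]] := aY0k m _ Yy; exists v; split=> //.
  have -> : act b v = act (b + a *+ m) (act (- (a *+ m)) v) by rewrite -(actA lM) addrK.
  rewrite (qmap_act qp); apply: Cb => //; rewrite (qmap_act qp).
  have -> : v = act (a *+ m) y - (act (a *+ m) y - v) by zmod.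
  rewrite (qmapB qp) (actB lQ) (qmap_act qp) (actK lQ).
  by apply: (sC i).2; [exact: Y0C|apply/CV; exact: Y1C].
- move=> y [k /Y0C /CR]; rewrite (qmap_act qp) => Ry /=.
  by rewrite -(actK lQ (a *+ k) (p y)); exact: sR.2.
- exists (V `&` [set x | WZ (actQ (- (a *+ i)) (p x))]).
    by apply: filterI => //; exact: (qmap_nbhs0_pre qp (nbhs0_act lQ (- (a *+ i)) nWZ)).
  move=> x Rx [Vx Wx]; exists 0%N; rewrite mulr0n (act0 lM); exists x; split=> //.
    by apply: hWZ => //; exact: sR.2.
  by rewrite subrr; exact: sY1.1.1.
- by move=> x /UY1 Yx; exists 0%N; rewrite mulr0n (act0 lM); exact: Y1Y.
- move=> x Nx [k Yx]; rewrite -(actK lM (a *+ k) x); apply: sU.2.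
  by apply: NY0 => //; exact: sN.
Qed.

End Minimal.
End OpenComplement.

(** * Open complements when there is no compact open subgroup *)

Section Halving.
Variables (T : topologicalZmodType) (lT : LCA T) (S : set T) (h : T -> nat) (c : nat).
Hypotheses (sS : is_subgroup S) (cS : closed S) (nS : nobdd S) (hc : coarse_norm S h c).

Lemma nobdd_torsion t k : S t -> t *+ 2 ^ k = 0 -> t = 0.
Proof.
move=> St t0; apply: nS => //.
exists ([set t *+ 2 ^ j | j in `I_k] `|` [set 0]).
  apply: compactU; last exact: compact_set1.
  by apply: finite_compact; apply: finite_image; exact: finite_II.
move=> n; have [nk|kn] := ltnP n k; first by left; exists n.
by right; rewrite -(subnKC kn) expnD mulrnA t0 mul0rn.
Qed.

(** Division by 2^k is continuous at 0 uniformly in k. The norm confines t to a compact [K1]; large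
    k are covered by [nobdd_uniform]. For k < J the part of [K1] outside the interior of [V] has a
    compact image under 2^k, which misses 0 by [nobdd_torsion]. *)
Lemma halving_nbhs (V : set T) : nbhs 0 V ->
  exists2 W, nbhs 0 W & forall t k, S t -> W (t *+ 2 ^ k) -> V t.
Proof.
move=> nV; case: (hc) => _ h2 _ h4 h5.
have [K0 nK0 cK0] := lT.2 0; have [r hr] := h5 K0 cK0.
have [K1 cK1 hK1] := h4 (maxn r c).
have [J hJ] := nobdd_uniform lT cS nS cK1 nV.
have down t k : S t -> K0 (t *+ 2 ^ k) -> K1 t.
  move=> St Kt; apply: hK1 => //; elim: k t St Kt => [|k ih] t St Kt.
    by rewrite (leq_trans (hr t St _)) ?leq_maxl //; move: Kt; rewrite expn0 mulr1n.
  have St2 : S (t *+ 2) by exact: subgroupMn.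
  have := ih _ St2; rewrite -mulrnA -expnS => /(_ Kt).
  have := h2 t St; lia.
pose C := K1 `&` S `&` ~` V°.
have cC : compact C.
  apply: compact_closedI; first exact: compact_closedI.
  by apply: open_closedC; exact: open_interior.
have [W nW hW] : exists2 W, nbhs 0 W & forall k t, (k < J)%N -> C t -> ~ W (t *+ 2 ^ k).
  elim: (J) => [|j [W nW hW]]; first by exists setT => //; exact: filterT.
  pose Cj := (fun t : T => t *+ 2 ^ j) @` C.
  have clj : closed Cj.
    apply: (LC_compact_closed lT); apply: compact_image => //.
    exact: continuous_mulrn.
  exists (W `&` ~` Cj).
    apply: filterI => //; apply: open_nbhs_nbhs; split; first exact: closed_openC.
    move=> [t [[_ St] nVt] t0]; apply: nVt; suff -> : t = 0 by [].
    exact: nobdd_torsion t0.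
  move=> k t; rewrite ltnS leq_eqVlt => /predU1P[->|kj] Ct [Wt nCt]; last exact: hW Wt.
  by apply: nCt; exists t.
exists (K0 `&` W); first exact: filterI.
move=> t k St [Kt Wt]; have [kJ|Jk] := ltnP k J.
  apply: contrapT => nVt; apply: (hW k t kJ) => //; split; last by move/interior_subset.
  by split=> //; exact: down Kt.
apply: hJ => // j jJ; apply: (down _ (k - j)%N); first exact: subgroupMn.
by rewrite -mulrnA -expnD subnKC // (leq_trans jJ).
Qed.

End Halving.

Section OpenComplementVector.
Variables (A M Q : topologicalZmodType) (act : A -> M -> M) (actQ : A -> Q -> Q).
Variables (N : set M) (p : M -> Q).
Hypotheses (lM : LC_module act) (lQ : LC_module actQ) (gA : compactly_generated A).
Hypothesis qp : quotient_map act actQ N p.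
Variable U : set M.
Hypotheses (sU : submod act U) (UN : U `<=` N).
Hypothesis oU : exists2 W, nbhs 0 W & forall x, N x -> W x -> U x.
Variable R : set Q.
Hypotheses (sR : submod actQ R) (cR : closed R).
Hypothesis noR : forall L, submod actQ L -> open_subgroup R L -> L = R.

(** The quotient of [R] by its bounded part has no bounded elements, so its dyadic part is open, and
    by [noR] it is everything. Halving chains there carry [Y1] from the bounded part to [R]. *)
Lemma bdd_complement :
  open_complement_over act N p U [set q | R q /\ bdd q] -> open_complement_over act N p U R.
Proof.
set B := [set q | _] => -[Y1 [sY1 Y1B [W1 nW1 hW1] UY1 NY1]].
have sB : submod actQ B by exact: submod_bdd.
have clB : closed B by apply: (closed_bdd lQ) => //; exact: sR.1.
have [T [actT [q [lT qq]]]] := quotient_exists lQ sB clB.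
have BR : B `<=` R by move=> x [].
pose S := q @` R.
have sS : submod actT S by exact: (qmap_submod_image qq).
have cS : closed S.
  apply: (qmap_closed_image qq) => // x n Rx /BR Rn.
  by apply: subgroupD => //; exact: sR.1.
have nS : nobdd S by apply: (nobdd_bdd_quotient lQ _ cR qq); exact: sR.1.
have SR x : S (q x) -> R x.
  move=> [y Ry /esym /(qmap_eq qq) /BR Rxy]; rewrite -(subrK y x).
  by apply: subgroupD => //; exact: sR.1.
have SD s : S s -> dyadic S s.
  have [W nW hW] := dyadic_open lT sS cS nS.
  have sD := submod_dyadic lT sS.
  have eR : R `&` q @^-1` dyadic S = R.
    apply: noR; first by apply: submod_setI => //; exact: (qmap_submod_pre qq).
    split; [|exact: subIsetl|].
      by apply: (submod_setI sR (qmap_submod_pre qq sD)).1.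
    exists (q @^-1` W); first exact: (qmap_nbhs0_pre qq).
    by move=> x Rx Wx; split=> //; apply: hW => //; exists x.
  by move=> [x Rx <-]; have : (R `&` q @^-1` dyadic S) x by [rewrite eR]; case.
have [_ [h [c hc]]] := dyadic_coarse_norm lT.1 sS.1 cS nS.
have {hc} hc : coarse_norm S h c by exact: coarse_normS hc.
have gS x : R (p x) -> S (q (p x)) by move=> Rx; exists (p x).
have gY1 x : q (p x) = 0 <-> B (p x) by exact: (qmap_ker qq).
(* The elements over [R] with a chain of halves tending to 0, everything taken modulo [Y1]. *)
pose Y := [set y | R (p y) /\ exists u : nat -> M, [/\ u 0%N = y, forall k, R (p (u k)),
  forall k, Y1 (u k.+1 *+ 2 - u k) &
  forall W, nbhs 0 W -> exists k0, forall k, (k0 <= k)%N -> exists2 w, W w & Y1 (u k - w)]].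
exists Y; split.
- split.
    split.
      split; first by rewrite (qmap0 qp); exact: sR.1.1.
      exists (fun=> 0); split=> //.
      + by move=> _; rewrite (qmap0 qp); exact: sR.1.1.
      + by move=> _; rewrite mul0rn subrr; exact: sY1.1.1.
      + move=> W nW; exists 0%N => k _; exists 0; first exact: nbhs_singleton.
        by rewrite subrr; exact: sY1.1.1.
    move=> x y [Rx [u [u0 Ru hu lu]]] [Ry [v [v0 Rv hv lv]]]; split.
      by rewrite (qmapB qp); exact: sR.1.2.
    exists (fun k => u k - v k); split.
    + by rewrite u0 v0.
    + by move=> k; rewrite (qmapB qp); exact: sR.1.2.
    + move=> k.
      have -> : (u k.+1 - v k.+1) *+ 2 - (u k - v k) =
        (u k.+1 *+ 2 - u k) - (v k.+1 *+ 2 - v k) by zmod.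
      exact: sY1.1.2.
    + move=> W nW; have [V [nV sV hV]] := nbhs0D nW.
      have [k1 h1] := lu V nV; have [k2 h2] := lv V nV; exists (maxn k1 k2) => k.
      rewrite geq_max => /andP[/h1[w1 Vw1 Y1w1] /h2[w2 Vw2 Y1w2]].
      exists (w1 - w2); first by apply: hV => //; exact: sV.
      have -> : u k - v k - (w1 - w2) = (u k - w1) - (v k - w2) by zmod.
      exact: sY1.1.2.
  move=> a x [Rx [u [u0 Ru hu lu]]]; split; first by rewrite (qmap_act qp); exact: sR.2.
  exists (fun k => act a (u k)); split.
  + by rewrite u0.
  + by move=> k; rewrite (qmap_act qp); exact: sR.2.
  + by move=> k; rewrite -(actMn lM) -(actB lM); exact: sY1.2.
  + move=> W nW; have [k0 hk] := lu _ (nbhs0_act lM a nW); exists k0 => k /hk[w Ww Y1w].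
    by exists (act a w) => //; rewrite -(actB lM); exact: sY1.2.
- by move=> y [].
- have [V [nV sV hV]] := nbhs0D3 nW1.
  have V0 : V 0 by exact: nbhs_singleton.
  have gV W : nbhs 0 W -> nbhs 0 ((fun x => q (p x)) @` W).
    move=> nW; have := qmap_nbhs0 qq (qmap_nbhs0 qp nW); apply: filterS => _ [_ [x Wx <-] <-].
    by exists x.
  (* For small [y] the whole chain of its image is small and lifts to small v k. Then 2 v (k+1) - v
     k is small and lies over the bounded part, hence in [Y1]. *)
  have [W nW hW] := halving_nbhs lT.1 sS.1 cS nS hc (gV V nV).
  exists (V `&` [set x | W (q (p x))]).
    apply: filterI => //.
    exact: (qmap_nbhs0_pre qp (qmap_nbhs0_pre qq nW)).
  move=> y Ry [Vy Wy]; split=> //.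
  have [u [u0 Su hu lu]] := SD _ (gS y Ry).
  have Vu k : ((fun x => q (p x)) @` V) (u k).
    apply: (hW _ k) => //; have := dyadic_chainE hu 0 k; rewrite add0n => ->.
    by rewrite u0.
  have /choice[v hv] : forall k, exists v, [/\ V v, q (p v) = u k & k = 0%N -> v = y].
    case=> [|k]; first by exists y.
    by have [v Vv gv] := Vu k.+1; exists v.
  exists v; split.
  + by have [_ _] := hv 0%N; apply.
  + by move=> k; apply: SR; have [_ -> _] := hv k; exact: Su.
  + move=> k; have [Vk gk _] := hv k; have [Vk1 gk1 _] := hv k.+1.
    apply: hW1; last by rewrite mulr2n; apply: hV => //; exact: sV.
    apply/gY1; rewrite (qmapB qp) (qmapB qq) (qmapMn qp) (qmapMn qq) gk gk1 hu.
    exact: subrr.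
  + move=> W' nW'; have [k0 hk0] := lu _ (gV _ (filterI nW' nV)); exists k0 => k /hk0.
    move=> [w [W'w Vw] gw]; have [Vk gk _] := hv k; exists w => //.
    apply: hW1; last by rewrite -[v k - w]addr0; apply: hV => //; exact: sV.
    by apply/gY1; rewrite (qmapB qp) (qmapB qq) gk gw subrr.
- move=> x Ux; have px : p x = 0 by apply/(qmap_ker qp); exact: UN.
  have R0 : R 0 by exact: sR.1.1.
  split; first by rewrite px.
  exists (fun k => if k is 0%N then x else 0); split=> //.
  + by case=> [|k]; rewrite ?px ?(qmap0 qp).
  + case=> [|k]; rewrite mul0rn sub0r.
      by apply: subgroupN; [exact: sY1.1|exact: UY1].
    by rewrite oppr0; exact: sY1.1.1.
  + move=> W nW; exists 1%N => -[//|k] _; exists 0; first exact: nbhs_singleton.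
    by rewrite subr0; exact: sY1.1.1.
- move=> x Nx [Rx [u [u0 Ru hu lu]]]; apply: NY1 => //.
  (* For x in [N] the image chain starts at 0, hence vanishes by [nobdd_torsion], and the u k lie
     over the bounded part. There a late u k is in [Y1], and doubling leads back to u 0. *)
  have g2 k : q (p (u k.+1)) *+ 2 = q (p (u k)).
    have /gY1 := Y1B _ (hu k); rewrite (qmapB qp) (qmapB qq) (qmapMn qp) (qmapMn qq).
    by move/eqP; rewrite subr_eq0 => /eqP.
  have g0 k : B (p (u k)).
    apply/gY1; apply: (@nobdd_torsion _ _ nS _ k); first exact: gS.
    have := dyadic_chainE g2 0 k; rewrite add0n => ->; rewrite u0.
    by have -> : p x = 0 by [apply/(qmap_ker qp)]; rewrite (qmap0 qq).
  have [k0 hk0] := lu _ nW1; have [w Ww Yw] := hk0 k0 (leqnn _).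
  have Yk : Y1 (u k0).
    rewrite -(subrK w (u k0)); apply: subgroupD => //; first exact: sY1.1.
    apply: hW1 => //; have -> : w = u k0 - (u k0 - w) by zmod.
    by rewrite (qmapB qp); apply: sB.1.2; [exact: g0|exact: Y1B].
  rewrite -u0; elim: k0 Yk {hk0 Yw} => [//|k ih] Yk; apply: ih.
  have -> : u k = u k.+1 *+ 2 - (u k.+1 *+ 2 - u k) by zmod.
  by apply: sY1.1.2 => //; apply: subgroupMn => //; exact: sY1.1.
Qed.

Hypothesis wR : forall K, K `<=` R -> compact_parafinite actQ setT K -> K `<=` [set 0].

Lemma open_complement_min :
  (forall R1, submod actQ R1 -> closed R1 -> R1 `<=` R -> R1 <> R ->
    open_complement_over act N p U R1) ->
  open_complement_over act N p U R.
Proof.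
move=> good.
have [cptR|ncR] := pselect (compact R).
  (* By [noR] a compact [R] is parafinite, since closed submodules of finite index are relatively
     open. *)
  have R0 : R `<=` [set 0].
    apply: wR => //; split; first by split.
    split=> // L [LR sL] [D [cD eL]] fL.
    have cL : closed L by rewrite eL; exact: closedI.
    apply: noR => //; split=> //; first exact: sL.1.
    by apply: finite_index_relopen => //; exact: sL.1.
  exists U; split=> //.
  - by move=> x /UN /(qmap_ker qp) px; rewrite /= px; exact: sR.1.1.
  - have [W nW hW] := oU; exists W => // x Rx; apply: hW.
    by apply/(qmap_ker qp); exact: R0.
have [[J oO cO]|nO] := pselect (exists2 J, open_subgroup R J & compact J).
  have [a [Z hZ]] := cocontraction_exists lQ gA sR cR oO cO ncR noR.
  exact: (cocontracted_complement lM lQ gA qp sU sR cR good hZ).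
apply: bdd_complement; apply: good => //.
- exact: submod_bdd.
- by apply: (closed_bdd lQ) => //; exact: sR.1.
- by move=> x [].
(* If all of [R] were bounded, an open subgroup with a coarse norm would have norm at most [c] and
   be compact. *)
- move=> e; apply: nO.
  have [G [h [c [[sG GR] Gopen _ hc]]]] := coarse_norm_exists lQ.1 sR.1 cR (@compact0 Q).
  have oG : open_subgroup R G by split.
  exists G => //; case: (hc) => _ _ _ h4 _; have [K cK hK] := h4 c.
  apply: (subclosed_compact _ cK); first by apply: open_subgroup_closed oG => //; exact: sR.1.
  move=> x Gx; apply: hK => //; have := GR x Gx; rewrite -e => -[_ bx].
  exact: coarse_norm_bdd hc Gx bx.
Qed.

End OpenComplementVector.

Section OpenComplementExists.
Variables (A M Q : topologicalZmodType) (act : A -> M -> M) (actQ : A -> Q -> Q).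
Variables (N : set M) (p : M -> Q).
Hypotheses (lM : LC_module act) (lQ : LC_module actQ) (gA : compactly_generated A).
Hypothesis qp : quotient_map act actQ N p.
Variable U : set M.
Hypotheses (sU : submod act U) (UN : U `<=` N).
Hypothesis oU : exists2 W, nbhs 0 W & forall x, N x -> W x -> U x.
Hypothesis wQ : forall K, compact_parafinite actQ setT K -> K `<=` [set 0].

Lemma open_complement : exists Y, [/\ submod act Y, nbhs 0 Y,
  U `<=` Y & forall x, N x -> Y x -> U x].
Proof.
suff [Y [sY _ [W nW hW] UY NY]] : open_complement_over act N p U setT.
  by exists Y; split=> //; apply: filterS nW => x; exact: hW.
apply: contrapT => badT.
pose good := open_complement_over act N p U.
have [| | | | |R [[sR cR] bR] minR] := @Zorn_sets Q
  [set X | (submod actQ X /\ closed X) /\ ~ good X] (fun X Y => Y `<=` X).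
- by move=> X x.
- by move=> X Y Z XY YZ x /YZ /XY.
- by move=> X Y XY YX; apply/seteqP.
- by exists setT.
- move=> F FP F0 tF; exists (\bigcap_(X in F) X); last by move=> X FX x; apply.
  have hF X : F X -> submod actQ X /\ closed X by move=> /FP[].
  split; last first.
    move=> /(open_complement_chain lM gA qp hF F0)[|X /FP[_ nX] //].
    by move=> X Y FX FY; have [h|h] := tF X Y FX FY; [right|left].
  split; last by apply: closed_bigI => X /hF[].
  split.
    split; first by move=> X /hF[sX _]; exact: sX.1.1.
    move=> x y hx hy X FX; have [sX _] := hF X FX.
    by apply: sX.1.2; [exact: hx|exact: hy].
  by move=> a x hx X FX; have [sX _] := hF X FX; apply: sX.2; exact: hx.
have good1 R1 : submod actQ R1 -> closed R1 -> R1 `<=` R -> R1 <> R -> good R1.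
  move=> sR1 cR1 R1R neR; apply: contrapT => nR1; apply: neR.
  exact: (minR R1).
apply: (bR); apply: (open_complement_min lM lQ gA qp sU UN oU sR cR) => //.
(* A complement over a relatively open [L] is also one over [R], so by minimality of [R] no such [L]
   is proper. *)
- move=> L sL oL; apply: contrapT => neL.
  have cL : closed L by apply: open_subgroup_closed oL => //; exact: sR.1.
  case: (oL) => _ LR [WL nWL hWL].
  have [Y [sY YL [W nW hW] UY NY]] := good1 L sL cL LR neL.
  apply: bR; exists Y; split=> //; first by move=> x /YL /LR.
  exists (W `&` [set x | WL (p x)]).
    by apply: filterI => //; exact: (qmap_nbhs0_pre qp).
  by move=> x Rx [Wx WLx]; apply: hW => //; exact: hWL.
- by move=> K _; exact: wQ.
Qed.

End OpenComplementExists.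

(** * Sheer modules *)

Lemma Wflat_eq0 (A M : topologicalZmodType) (act : A -> M -> M) (S : set M) :
  Wflat act S = [set 0] <-> forall K, compact_parafinite act S K -> K `<=` [set 0].
Proof.
split=> [e K cK y Ky|h]; first by rewrite -e; exists [:: y]; split;
  [move=> z; rewrite inE => /eqP ->; exists K|rewrite big_seq1].
apply/seteqP; split=> x; last by move=> ->; exists [::]; rewrite big_nil.
move=> [s [hs ->]]; rewrite big_seq big1 // => y ys.
by have [K [cK Ky]] := hs y ys; exact: h Ky.
Qed.

Section ParafiniteLift.
Variables (A M Q : topologicalZmodType) (act : A -> M -> M) (actQ : A -> Q -> Q).
Variables (N : set M) (p : M -> Q).
Hypotheses (lM : LC_module act) (lQ : LC_module actQ) (gA : compactly_generated A).
Hypothesis qp : quotient_map act actQ N p.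
Hypotheses (sN : submod act N) (cN : closed N).

(* A minimal compact complement of [N] in the preimage of [K] is parafinite. *)
Lemma parafinite_lift (K : set Q) : Omegasharp act N = N -> compact_parafinite actQ setT K ->
  exists2 Y, compact_parafinite act setT Y & K `<=` p @` Y.
Proof.
move=> oN [[_ sK] [cK pK]]; pose P := p @^-1` K.
have sP : submod act P by exact: (qmap_submod_pre qp).
have clK : closed K by exact: (LC_compact_closed lQ.1).
have cP : closed P by exact: (qmap_closed_pre qp).
have NP : N `<=` P by move=> x /(qmap_ker qp) px; rewrite /P /= px; exact: sK.1.1.
have [V0 cV0 KV0] := qmap_compact_lift qp lM.1 cK.
have PV0 : P `<=` sums V0 N.
  by move=> x /KV0[v Vv pv]; exists v => //; apply/(qmap_eq qp).
have [Y0 [sY0 cY0 Y0P PY0]] := compact_complement lM gA sN cN sP cP NP cV0 PV0 oN.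
pose good := [set Y | [/\ submod act Y, compact Y, Y `<=` P & P `<=` sums Y N]].
have clY X : good X -> closed X by move=> [_ cX _ _]; exact: (LC_compact_closed lM.1).
have [| | | | |Y [sY cY YP PY] minY] := @Zorn_sets M good (fun X Y => Y `<=` X).
- by move=> X x.
- by move=> X Y Z XY YZ x /YZ /XY.
- by move=> X Y XY YX; apply/seteqP.
- by exists Y0.
- move=> F FP [X0 FX0] tF; exists (\bigcap_(X in F) X); last by move=> X FX x; apply.
  have [sX0 cX0 X0P PX0] := FP X0 FX0.
  split.
  + split.
      split; first by move=> X /FP[sX _ _ _]; exact: sX.1.1.
      move=> x y hx hy X FX; have [sX _ _ _] := FP X FX.
      by apply: sX.1.2; [exact: hx|exact: hy].
    by move=> a x hx X FX; have [sX _ _ _] := FP X FX; apply: sX.2; exact: hx.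
  + apply: (subclosed_compact _ cX0); last by move=> x; apply.
    by apply: closed_bigI => X /FP /clY.
  + by move=> x /(_ X0 FX0) /X0P.
  + move=> x Px.
    have [| | | |y _ hy] := @compact_directed_cap M X0 (set M) F
       (fun X => [set y | X y /\ N (x - y)]) cX0.
    * by exists X0.
    * move=> X1 X2 F1 F2; have [h|h] := tF X1 X2 F1 F2.
        by exists X2; split=> // y [/h].
      by exists X1; split=> // y [/h].
    * move=> X FX; apply: closedI; first by apply: clY; exact: FP.
      apply: preimage_closed => // y _.
      apply: (@continuous_comp _ _ _ -%R (fun z => x + z)); first exact: opp_continuous.
      exact: continuous_addr.
    * move=> X FX; have [h|h] := tF X0 X FX0 FX.
        by have [_ _ _ /(_ x Px)[y Xy Ny]] := FP X FX; exists y => //; exact: h.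
      by have [y Xy Ny] := PX0 x Px; exists y => //; split=> //; exact: h.
    by exists y; [move=> X FX; have [] := hy X FX|have [] := hy X0 FX0].
have KY : K `<=` p @` Y.
  move=> q Kq; have [x px] := qmap_surj qp q.
  have [y Yy Ny] : sums Y N x by apply: PY; rewrite /P /= px.
  by exists y => //; rewrite -px; apply/esym/(qmap_eq qp).
exists Y => //; split; first by split.
split=> // L [LY sL] [C [cC eL]] fL.
have cL : compact L by rewrite eL; exact: compact_closedI.
have cpL : compact (p @` L) by apply: compact_image => //; exact: (qmap_cont qp).
(* Parafiniteness of [K] forces p L = K, so [L] again supplements [N] and minimality of [Y] gives L
   = Y. *)
have pLK : p @` L = K.
  apply: pK.
  - split; last exact: (qmap_submod_image qp).
    by move=> _ [x /LY /YP Px <-].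
  - exists (p @` L); split; first exact: (LC_compact_closed lQ.1).
    by apply/esym/setIidPr => _ [x /LY /YP Px <-].
  - have : finite_index (p @` Y) (p @` L) by apply: (finite_index_image qp) fL.
    by move=> [E [fE hE]]; exists E; split=> // q /KY /hE.
apply: minY => //; split=> //.
  by move=> x /LY /YP.
move=> x Px; have : (p @` L) (p x) by rewrite pLK.
by move=> [y Ly pxy]; exists y => //; apply/(qmap_eq qp).
Qed.

End ParafiniteLift.

Lemma subgroup_open (T : topologicalZmodType) (G : set T) :
  is_subgroup G -> nbhs 0 G -> open G.
Proof.
move=> sG nG; rewrite openE => x Gx; apply/nbhs_at0P.
by apply: filterS nG => y Gy /=; exact: subgroupD.
Qed.

Section PurelyDiscreteExtension.
Variables (A M : topologicalZmodType) (act : A -> M -> M) (N U : set M).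
Hypotheses (sN : submod act N) (UN : U `<=` N).

(* A maximal open submodule meeting [N] in [U] has a purely discrete quotient. *)
Lemma purely_discrete_extension : purely_discrete_quot act N U ->
  (exists Y, [/\ submod act Y, nbhs 0 Y, U `<=` Y & forall x, N x -> Y x -> U x]) ->
  exists Y, [/\ submod act Y, open Y, purely_discrete_quot act setT Y &
    forall x, N x -> Y x -> U x].
Proof.
move=> pU [Y0 gY0].
pose good := [set Y | [/\ submod act Y, nbhs 0 Y, U `<=` Y & forall x, N x -> Y x -> U x]].
have [| | | | |Y [sY nY UY NY] maxY] := @Zorn_sets M good subset.
- by move=> X x.
- by move=> X Y Z XY YZ x /XY /YZ.
- by move=> X Y XY YX; apply/seteqP.
- by exists Y0.
- move=> F FP [X0 FX0] tF; exists (\bigcup_(X in F) X); last by move=> X FX x; exists X.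
  have [sX0 nX0 UX0 NX0] := FP X0 FX0; split.
  + split.
      split; first by exists X0 => //; exact: sX0.1.1.
      move=> x y [X FX Xx] [X' FX' X'y]; have [h|h] := tF X X' FX FX'.
        by exists X' => //; have [sX _ _ _] := FP X' FX'; apply: sX.1.2 => //; exact: h.
      by exists X => //; have [sX _ _ _] := FP X FX; apply: sX.1.2 => //; exact: h.
    by move=> a x [X FX Xx]; exists X => //; have [sX _ _ _] := FP X FX; exact: sX.2.
  + by apply: filterS nX0 => x Xx; exists X0.
  + by move=> x /UX0; exists X0.
  + by move=> x Nx [X FX Xx]; have [_ _ _] := FP X FX; apply.
exists Y; split=> //; first by apply: subgroup_open => //; exact: sY.1.
move=> F [_ sF] YF [E [fE FE]]; apply: maxY => //.
have sFN : submod act (F `&` N) by exact: submod_setI.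
have eU : F `&` N = U.
  apply: pU; [by split=> //; exact: subIsetr|by move=> x Ux; split; [apply/YF/UY|exact: UN]|].
  (* [r f] is an element of F and N congruent to [f] modulo [Y], if there is one, and 0 otherwise;
     thus representatives of F/Y yield representatives modulo [U]. *)
  have /choice[r hr] : forall f, exists x, (exists2 x, (F `&` N) x & Y (x - f)) ->
      (F `&` N) x /\ Y (x - f).
    move=> f; have [[x FNx Yx]|nx] := pselect (exists2 x, (F `&` N) x & Y (x - f)).
      by exists x.
    by exists 0.
  exists (r @` E); split; first exact: finite_image.
  move=> x [Fx Nx]; have [f [l [Ef [Yl xe]]]] := FE x Fx.
  have Yxf : Y (x - f) by rewrite xe addrC addKr.
  have [[Fr Nr] Yr] := hr f (ex_intro2 _ _ x (conj Fx Nx) Yxf).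
  exists (r f), (x - r f); split; first by exists f.
  split; last by rewrite addrC subrK.
  apply: NY; first exact: sN.1.2.
  have -> : x - r f = (x - f) - (r f - f) by zmod.
  exact: sY.1.2.
split=> //.
- exact: filterS nY.
- by move=> x /UY /YF.
- by move=> x Nx Fx; rewrite -eU.
Qed.

End PurelyDiscreteExtension.

(* Q together with p : M -> Q is the quotient LC A-module M/N *)
Theorem mainTheorem7 (A M Q : topologicalZmodType)
    (actM : A -> M -> M) (actQ : A -> Q -> Q) (N : set M) (p : M -> Q) :
  LCA A -> compactly_generated A ->
  LC_module actM -> LC_module actQ ->
  submodule_in actM setT N -> closed N ->
  (forall x y, p (x + y) = p x + p y) ->
  (forall a x, p (actM a x) = actQ a (p x)) ->
  continuous p ->
  (forall V : set M, open V -> open (p @` V)) ->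
  (forall q : Q, exists x, p x = q) ->
  p @^-1` [set 0] = N ->
  sheer actM setT ->
  (sheer actM N <-> sheer actQ setT).
Proof.
move=> lA gA lM lQ [_ sN] cN pD pA pc po ps pk [WM OM].
have qp : quotient_map actM actQ N p by split.
move/Wflat_eq0 : WM => WM.
split=> -[WX OX]; split.
- apply/Wflat_eq0 => K pK q Kq.
  have [Y pY KY] := parafinite_lift lM lQ gA qp sN cN OX pK.
  by have [y /(WM Y pY) -> <-] := KY q Kq; exact: (qmap0 qp).
- have pT : p @` setT = setT.
    by apply/seteqP; split=> // q _; have [x <-] := ps q; exists x.
  by rewrite -pT; apply: (Omegasharp_image qp).
- apply/Wflat_eq0 => K [[_ sK] hK]; apply: WM.
  by split.
- apply/seteqP; split; first by move=> x [].
  move=> x Nx; split=> // U [UN sU] [W [oW eU]] pU.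
  have [Y [sY oY pY NY]] : exists Y, [/\ submod actM Y, open Y,
      purely_discrete_quot actM setT Y & forall x, N x -> Y x -> U x].
    apply: purely_discrete_extension => //.
    apply: (open_complement lM lQ gA qp sU UN); last exact/Wflat_eq0.
    have W0 : W 0 by have : U 0 by [exact: sU.1.1]; rewrite eU => -[].
    exists W; first by apply: open_nbhs_nbhs.
    by move=> y Ny Wy; rewrite eU.
  apply: NY => //; have : Omegasharp actM setT x by rewrite OM.
  case=> _; apply=> //.
  by exists Y; split=> //; rewrite setTI.
Qed.
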